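(* In the affine truncated-stable class described in the context, there exists $C<\infty$, independent of $\varepsilon\in[0,1]$, $P\in\mathcal P$, $s\in[0,T]$ and $\rho\in(0,1]$, such that for every $P\in\mathcal P$ and every deterministic $s\in[0,T]$ $$\mathbb E^P\Big[\int_s^T\mathbf 1_{\{\operatorname{dist}(X^{\varepsilon,P}_{t-},\Sigma)\le\rho\}}\,dt\ \Big|\ \mathcal F^P_s\Big]\le C\rho\qquad P\text{-a.s.}$$ Consequently, there is $C'<\infty$ such that for all $0<\rho\le1$, uniformly in $\varepsilon\in[0,1]$, $$\sup_{P\in\mathcal P}\mathbb E^P\Big[\Big(\int_0^T\mathbf 1_{\{\operatorname{dist}(X^{\varepsilon,P}_{t-},\Sigma)\le\rho\}}\,dt\Big)^2\Big]\le C'\rho^2.$$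
   Context: **Framework.** Fix $T>0$, $d\ge1$, $E=\mathbb R^d\setminus\{0\}$. Let $\Omega=\mathbb R^d\times C_0([0,T];\mathbb R^d)\times\mathcal M$ ($C_0$: continuous paths from $0$; $\mathcal M$: integer-valued measures on $(0,T]\times E$ finite on $(0,T]\times\{|e|>1/n\}$ for all $n$), with coordinates $(\xi,B,\mathbf N)$ and raw filtration $\mathcal F^0_t=\sigma(\xi,B_s,\mathbf N((0,s]\times G):s\le t,\ G\in\mathcal B(E),\ \operatorname{dist}(G,0)>0)$. $\mathcal P$ is a nonempty family of probability measures on $\Omega$; for $P\in\mathcal P$, $(\mathcal F^P_t)$ is the usual ($P$-complete, right-continuous) augmentation of $(\mathcal F^0_t)$. **Affine truncated-stable class.** Let $\upsilon\in(1,2)$, $c_1,\dots,c_d>0$, $(\mathbf e_j)$ the canonical basis; the Lévy measure $\Pi$ is given, for nonnegative $v$, by $$\int_Ev(e)\Pi(de)=\sum_{j=1}^dc_j\int_{0<|z|\le1}v(z\mathbf e_j)|z|^{-1-\upsilon}dz.$$ Under each $P$: $\xi,B,\mathbf N$ are mutually independent; $\mathbf N$ is a Poisson random measure with compensator $\Pi(de)dt$, $\widetilde{\mathbf N}^P=\mathbf N-\Pi(de)dt$; $B$ is a continuous Gaussian martingale with independent increments and deterministic covariance $\int_0^ta^P_sds$, with $\underline a\le a^P_s\le\overline a$ for fixed symmetric positive definite matrices $\underline a,\overline a$ independent of $P$; every square-integrable $(\mathcal F_t^P)$-local martingale is of the form $M_0+\int Z\,dB+\int\!\!\int U\,d\widetilde{\mathbf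 N}^P$, and for every $n$ the analogous representation holds under $P^{\otimes n}$ for the augmented product filtration of $n$ copies of $(\xi,B,\mathbf N)$. The law of $\xi$ is common to all $P$ and has a finite moment of order $q>4$. Fix $\kappa\ge0$, a map $H:\mathcal P_2(\mathbb R^d)\to\mathbb R^d$ with $|H(\mu)-H(\nu)|\le L_HW_2(\mu,\nu)$ ($W_2$ the quadratic Wasserstein distance on the set $\mathcal P_2$ of probability measures with finite second moment), and a deterministic $h\in L^q([0,T];\mathbb R^d)$. For $\varepsilon\in[0,1]$, $X^{\varepsilon,P}$ is the unique square-integrable càdlàg solution of $$X^{\varepsilon,P}_t=\xi+\int_0^t[-\kappa X^{\varepsilon,P}_{s-}+H(\mu^{\varepsilon,P}_s)+h_s]\,ds+\varepsilon B_t+\int_0^t\int_Ee\,\widetilde{\mathbf N}^P(ds,de),\qquad\mu^{\varepsilon,P}_t=\mathcal L^P(X^{\varepsilon,P}_t),$$ $\mathcal L^P$ denoting the law under $P$. Further, $\Sigma=\bigcup_{k=1}^d\{x\in\mathbb R^d:x_k=0\}$. **Standing data of the class not entering the conclusion.** Borel real functions $f(t,x,\mu,y,z,u,\nu,\alpha)$ and $g(x,\mu)$ that are Lipschitz in all arguments other than $t$ (with $W_2$ for measures and the $L^2(\Pi)$ norm for $u$), with $f(t,0,\delta_0,0,0,0,\delta_0,0)$ bounded in $t$; and the operator $A(x,\mu)=\partial\phi(x)+F_\mu(x)$ with $\phi(x)=\sum_k\{\kappa_+(x_k)_++\kappa_-(x_k)_-\}+\frac{\alpha_A}2|x|^2$,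 $F_\mu(x)=\eta_K\int\frac{x-y}{\sqrt{1+|x-y|^2}}\mu(dy)$, $\kappa_->\kappa_+>0$, $\alpha_A,\eta_K>0$, whose switching set is $\Sigma$. *)

(* Defs.v *)
From HB Require Import structures.
From mathcomp Require Import all_boot all_order all_algebra.
From mathcomp Require Import all_classical all_reals all_analysis.
From mathcomp Require Import measurable_realfun.

Set Implicit Arguments.
Unset Strict Implicit.
Unset Printing Implicit Defensive.

Import Order.TTheory GRing.Theory Num.Theory.
Import numFieldNormedType.Exports.

Local Open Scope classical_set_scope.
Local Open Scope ring_scope.

(** * Euclidean space *)

(* The norm that the library puts on ['rV[R]_d] is the sup norm; the Euclidean
   norm below is the one that enters moments, W_2 and distances. *)
Definition dot (R : realType) (d : nat) (x y : 'rV[R]_d) : R :=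
  \sum_(i < d) x 0 i * y 0 i.

Definition enorm (R : realType) (d : nat) (x : 'rV[R]_d) : R :=
  Num.sqrt (dot x x).

(* Extended-real valued, so that [edist x set0 = +oo]. *)
Definition edist (R : realType) (d : nat) (x : 'rV[R]_d) (A : set 'rV[R]_d) :
    \bar R :=
  ereal_inf [set (enorm (x - y))%:E | y in A].

Definition punctured (R : realType) (d : nat) : set 'rV[R]_d := [set e | e != 0].
Arguments punctured {R d}.

HB.instance Definition _ (R : realType) (m n : nat) :=
  @isMeasurable.Build (sigma_display (@open 'M[R]_(m, n))) 'M[R]_(m, n)
    <<s @open 'M[R]_(m, n) >> (@sigma_algebra0 _ setT (@open 'M[R]_(m, n)))
    (@sigma_algebraC _ (@open 'M[R]_(m, n)))
    (@sigma_algebra_bigcup _ setT (@open 'M[R]_(m, n))).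

Definition posdef (R : realType) (d : nat) (a : 'M[R]_d) : Prop :=
  a^T = a /\ forall v : 'rV[R]_d, v != 0 -> 0 < (v *m a *m v^T) 0 0.

Definition loewner_le (R : realType) (d : nat) (a b : 'M[R]_d) : Prop :=
  forall v : 'rV[R]_d, (v *m a *m v^T) 0 0 <= (v *m b *m v^T) 0 0.

(** * Wasserstein space *)

Definition P2 (R : realType) (d : nat) : set (probability 'rV[R]_d R) :=
  [set mu | (\int[mu]_x (enorm x ^+ 2)%:E < +oo)%E].
Arguments P2 {R d}.

Definition coupling (R : realType) (d : nat) (mu nu : probability 'rV[R]_d R) :
    set (probability ('rV[R]_d * 'rV[R]_d)%type R) :=
  [set p | forall A : set 'rV[R]_d, measurable A ->
     p (A `*` setT) = mu A /\ p (setT `*` A) = nu A].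

Definition W2 (R : realType) (d : nat) (mu nu : probability 'rV[R]_d R) : R :=
  Num.sqrt (fine (ereal_inf
    [set (\int[p]_z (enorm (z.1 - z.2) ^+ 2)%:E)%E | p in coupling mu nu])).

(** * The canonical space *)

(* C_0([0,T]; R^d); the value 0 outside [0,T] makes the total function [cpath_fun]
   a faithful representation of a path indexed by [0,T]. *)
Record cpath (R : realType) (T : R) (d : nat) := CPath {
  cpath_fun :> R -> 'rV[R]_d ;
  path_start : cpath_fun 0 = 0 ;
  path_continuous : {within `[0, T], continuous cpath_fun} ;
  path_outside : forall t, ~ (0 <= t <= T) -> cpath_fun t = 0 }.

(* Integer-valued measures on (0,T] x E, represented as measures on R x R^d
   carried by (0,T] x E. *)
Record jumps (R : realType) (T : R) (d : nat) := Jumps {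
  jmeasure :> {measure set (R * 'rV[R]_d)%type -> \bar R} ;
  jumps_support : jmeasure (~` (`]0, T] `*` punctured)) = 0%E ;
  jumps_integer : forall A : set (R * 'rV[R]_d), measurable A ->
    jmeasure A = +oo%E \/ exists k : nat, jmeasure A = (k%:R)%:E ;
  jumps_finite : forall n : nat,
    (jmeasure (`]0%R, T] `*` [set e : 'rV[R]_d | (n.+1%:R^-1 < enorm e)%R]) < +oo)%E }.

Record omega (R : realType) (T : R) (d : nat) := Omega {
  coord_xi : 'rV[R]_d ;
  coord_B : cpath T d ;
  coord_N : jumps T d }.

Lemma continuous_path0 (R : realType) (T : R) (d : nat) :
  {within `[0, T], continuous (fun=> 0 : 'rV[R]_d)}.
Proof. by apply: continuous_subspaceT => x; exact: cvg_cst. Qed.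

Definition cpath0 (R : realType) (T : R) (d : nat) : cpath T d :=
  @CPath R T d (fun=> 0) erefl (@continuous_path0 R T d) (fun _ _ => erefl).

Lemma mzero_support (R : realType) (T : R) (d : nat) :
  @mzero _ (R * 'rV[R]_d)%type R (~` (`]0, T] `*` punctured)) = 0%E.
Proof. by []. Qed.

Lemma mzero_integer (R : realType) (d : nat) (A : set (R * 'rV[R]_d)) :
  measurable A -> @mzero _ (R * 'rV[R]_d)%type R A = +oo%E \/
    exists k : nat, @mzero _ (R * 'rV[R]_d)%type R A = (k%:R)%:E.
Proof. by move=> _; right; exists 0%N. Qed.

Lemma mzero_finite (R : realType) (T : R) (d : nat) (n : nat) :
  (@mzero _ (R * 'rV[R]_d)%type R
     (`]0%R, T] `*` [set e : 'rV[R]_d | (n.+1%:R^-1 < enorm e)%R]) < +oo)%E.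
Proof. by rewrite /mzero ltry. Qed.

Definition jumps0 (R : realType) (T : R) (d : nat) : jumps T d :=
  Jumps (mzero_support T d) (@mzero_integer R d) (@mzero_finite R T d).

HB.instance Definition _ (R : realType) (T : R) (d : nat) :=
  gen_eqMixin (omega T d).
HB.instance Definition _ (R : realType) (T : R) (d : nat) :=
  gen_choiceMixin (omega T d).
HB.instance Definition _ (R : realType) (T : R) (d : nat) :=
  isPointed.Build (omega T d) (Omega 0 (cpath0 T d) (jumps0 T d)).

Definition gen_xi (R : realType) (T : R) (d : nat) : set (set (omega T d)) :=
  [set A | exists2 C : set 'rV[R]_d, measurable C & A = @coord_xi R T d @^-1` C].
Arguments gen_xi {R T d}.

Definition gen_B (R : realType) (T : R) (d : nat) (t : R) :
    set (set (omega T d)) :=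
  [set A | exists s, exists2 C : set 'rV[R]_d, 0 <= s <= t /\ measurable C &
     A = (fun w => coord_B w s) @^-1` C].
Arguments gen_B {R T d} t.

(* Borel sets of E at a positive distance from the origin. *)
Definition off_origin (R : realType) (d : nat) : set (set 'rV[R]_d) :=
  [set G | [/\ measurable G, G `<=` punctured & (0 < edist 0 G)%E]].
Arguments off_origin {R d}.

Definition gen_N (R : realType) (T : R) (d : nat) (t : R) :
    set (set (omega T d)) :=
  [set A | exists s, exists G : set 'rV[R]_d, exists2 C : set (\bar R),
     [/\ 0 <= s <= t, off_origin G & measurable C] &
     A = (fun w => coord_N w (`]0, s] `*` G)) @^-1` C].
Arguments gen_N {R T d} t.

Definition raw_filtration (R : realType) (T : R) (d : nat) (t : R) :
    set (set (omega T d)) :=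
  <<s gen_xi `|` gen_B t `|` gen_N t >>.
Arguments raw_filtration {R T d} t.

HB.instance Definition _ (R : realType) (T : R) (d : nat) :=
  @isMeasurable.Build
    (sigma_display (gen_xi `|` gen_B T `|` gen_N T : set (set (omega T d))))
    (omega T d) (raw_filtration T)
    (@sigma_algebra0 _ setT _) (@sigma_algebraC _ _)
    (@sigma_algebra_bigcup _ setT _).

(** * Filtered probability spaces *)

(* Expectations are taken under the completion, since augmented
   sigma-algebras contain non-measurable subsets of null sets. *)
Notation completion P := (@completed_measure_extension _ _ _ P).

(* The usual augmentation of [F]. For [raw_filtration], the sigma-algebras with
   u > T all equal the one at T, so nothing is added at t = T. *)
Definition augmented (R : realType) (dW : measure_display)
    (W : measurableType dW) (Q : probability W R) (F : R -> set (set W)) :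
    R -> set (set W) :=
  fun t => [set A | forall u, t < u ->
    <<s F u `|` [set D | Q.-negligible D] >> A].

Definition measurable_wrt (W : Type) (dS : measure_display)
    (S : measurableType dS) (G : set (set W)) (f : W -> S) : Prop :=
  forall C : set S, measurable C -> G (f @^-1` C).

(* [Y] is a version of E^Q[Z | G]. *)
Definition cond_expectation (R : realType) (dW : measure_display)
    (W : measurableType dW) (Q : probability W R) (G : set (set W))
    (Z Y : W -> R) : Prop :=
  [/\ (completion Q).-integrable setT (EFin \o Z),
      (completion Q).-integrable setT (EFin \o Y),
      measurable_wrt G Y &
      forall A, G A ->
        (\int[completion Q]_(w in A) (Y w)%:E =
         \int[completion Q]_(w in A) (Z w)%:E)%E].

Definition adapted (R : realType) (T : R) (W : Type) (dS : measure_display)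
    (S : measurableType dS) (F : R -> set (set W)) (X : R -> W -> S) : Prop :=
  forall t, 0 <= t <= T -> measurable_wrt (F t) (X t).

Definition cadlag (R : realType) (T : R) (d : nat) (x : R -> 'rV[R]_d) : Prop :=
  (forall t, 0 <= t < T -> x s @[s --> t^'+] --> x t) /\
  (forall t, 0 < t <= T -> cvg (x s @[s --> t^'-])).

Definition cadlag_real (R : realType) (T : R) (x : R -> R) : Prop :=
  (forall t, 0 <= t < T -> x s @[s --> t^'+] --> x t) /\
  (forall t, 0 < t <= T -> cvg (x s @[s --> t^'-])).

Definition martingale (R : realType) (T : R) (dW : measure_display)
    (W : measurableType dW) (Q : probability W R) (F : R -> set (set W))
    (M : R -> W -> R) : Prop :=
  forall s t, 0 <= s -> s <= t -> t <= T ->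
    cond_expectation Q (F s) (M t) (M s).

Definition stopping_time (R : realType) (T : R) (W : Type)
    (F : R -> set (set W)) (tau : W -> R) : Prop :=
  (forall w, 0 <= tau w) /\
  forall t, 0 <= t <= T -> F t [set w | tau w <= t].

Definition local_martingale (R : realType) (T : R) (dW : measure_display)
    (W : measurableType dW) (Q : probability W R) (F : R -> set (set W))
    (M : R -> W -> R) : Prop :=
  [/\ adapted T F M, forall w, cadlag_real T (M^~ w) &
      exists tau : nat -> W -> R,
      [/\ forall n, stopping_time T F (tau n),
          forall n w, tau n w <= tau n.+1 w,
          {ae Q, forall w, exists n, T <= tau n w} &
          forall n, martingale T Q F
            (fun t w => M (Num.min t (tau n w)) w - M 0 w)]].

(** * Stochastic integrals *)

(* The drivers are [n] pairs (B, N), carried by a space [W] and read off the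
   maps [c i : W -> omega]. *)

(* The integrand [bt_coef * 1_(bt_start, bt_end]] against the [bt_idx]-th B. *)
Record bterm (R : realType) (d : nat) (W : Type) (n : nat) := BTerm {
  bt_idx : 'I_n ; bt_start : R ; bt_end : R ; bt_coef : W -> 'rV[R]_d }.

(* The integrand [nt_coef * 1_(nt_start, nt_end] * 1_nt_set] against the
   [nt_idx]-th compensated N. *)
Record nterm (R : realType) (d : nat) (W : Type) (n : nat) := NTerm {
  nt_idx : 'I_n ; nt_start : R ; nt_end : R ; nt_coef : W -> R ;
  nt_set : set 'rV[R]_d }.

Definition bterm_ok (R : realType) (T : R) (d : nat) (W : Type) (n : nat)
    (F : R -> set (set W)) (x : bterm R d W n) : Prop :=
  [/\ 0 <= bt_start x, bt_start x <= bt_end x, bt_end x <= T,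
      measurable_wrt (F (bt_start x)) (bt_coef x) &
      exists K : R, forall w, enorm (bt_coef x w) <= K].

Definition nterm_ok (R : realType) (T : R) (d : nat) (W : Type) (n : nat)
    (F : R -> set (set W)) (y : nterm R d W n) : Prop :=
  [/\ [/\ 0 <= nt_start y, nt_start y <= nt_end y & nt_end y <= T],
      measurable_wrt (F (nt_start y)) (nt_coef y),
      (exists K : R, forall w, `|nt_coef y w| <= K) &
      off_origin (nt_set y)].

Definition simple_integrand (R : realType) (d : nat) (W : Type) (n : nat) : Type :=
  (seq (bterm R d W n) * seq (nterm R d W n))%type.

Definition simple_ok (R : realType) (T : R) (d : nat) (W : Type) (n : nat)
    (F : R -> set (set W)) (S : simple_integrand R d W n) : Prop :=
  (forall k x0, (k < size S.1)%N -> bterm_ok T F (nth x0 S.1 k)) /\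
  (forall k y0, (k < size S.2)%N -> nterm_ok T F (nth y0 S.2 k)).

Definition simple_Z (R : realType) (d : nat) (W : Type) (n : nat)
    (S : simple_integrand R d W n) (i : 'I_n) (r : R) (w : W) : 'rV[R]_d :=
  \sum_(x <- S.1 | bt_idx x == i)
    \1_(`]bt_start x, bt_end x] : set R) r *: bt_coef x w.

Definition simple_U (R : realType) (d : nat) (W : Type) (n : nat)
    (S : simple_integrand R d W n) (i : 'I_n) (r : R) (w : W) (e : 'rV[R]_d) : R :=
  \sum_(y <- S.2 | nt_idx y == i)
    \1_(`]nt_start y, nt_end y] : set R) r * nt_coef y w * \1_(nt_set y) e.

(* N((a,b] x G) - (b - a) Pi(G), for G at a positive distance from 0. *)
Definition compensated (R : realType) (T : R) (d : nat)
    (Pi : {measure set 'rV[R]_d -> \bar R}) (w : omega T d)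
    (a b : R) (G : set 'rV[R]_d) : R :=
  fine (coord_N w (`]a, b] `*` G)) - (b - a) * fine (Pi G).

Definition simple_integral (R : realType) (T : R) (d : nat)
    (Pi : {measure set 'rV[R]_d -> \bar R}) (W : Type) (n : nat)
    (c : 'I_n -> W -> omega T d) (S : simple_integrand R d W n) (t : R) (w : W) : R :=
  \sum_(x <- S.1) dot (bt_coef x w)
     (coord_B (c (bt_idx x) w) (Num.min (bt_end x) t) -
      coord_B (c (bt_idx x) w) (Num.min (bt_start x) t)) +
  \sum_(y <- S.2) nt_coef y w *
     compensated Pi (c (nt_idx y) w)
       (Num.min (nt_start y) t) (Num.min (nt_end y) t) (nt_set y).

(* As the covariance density of B lies between two positive definite matrices,
   the Lebesgue measure may replace it in the norm of the B-integrands. *)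
Definition integrand_norm2 (R : realType) (T : R) (d : nat)
    (Pi : {measure set 'rV[R]_d -> \bar R})
    (dW : measure_display) (W : measurableType dW) (Q : probability W R)
    (n : nat) (Z : 'I_n -> R -> W -> 'rV[R]_d)
    (U : 'I_n -> R -> W -> 'rV[R]_d -> R) : \bar R :=
  (\int[completion Q]_w \int[lebesgue_measure]_(r in `[0%R, T])
    \sum_(i < n) ((enorm (Z i r w) ^+ 2)%:E +
                  \int[Pi]_e (U i r w e ^+ 2)%:E))%E.

Definition predictable (R : realType) (T : R) (W : Type)
    (F : R -> set (set W)) : set (set (R * W)) :=
  <<s [set D | exists s t A, [/\ 0 <= s, s <= t, t <= T & F s A] /\
         D = `]s, t] `*` A] >>.

Definition integrand (R : realType) (T : R) (d : nat)
    (Pi : {measure set 'rV[R]_d -> \bar R})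
    (dW : measure_display) (W : measurableType dW) (Q : probability W R)
    (F : R -> set (set W)) (n : nat) (Z : 'I_n -> R -> W -> 'rV[R]_d)
    (U : 'I_n -> R -> W -> 'rV[R]_d -> R) : Prop :=
  [/\ forall i, measurable_wrt (predictable T F) (fun p : R * W => Z i p.1 p.2),
      forall i, measurable_wrt
        <<s [set D | exists A G, [/\ predictable T F A, measurable G &
               D = A `*` G]] >>
        (fun p : (R * W) * 'rV[R]_d => U i p.1.1 p.1.2 p.2) &
      (integrand_norm2 T Pi Q Z U < +oo)%E].

(* [I] is the L^2-isometric extension of the simple integral, i.e.
   I = sum_i (int Z^i dB^i + int int U^i d(compensated N^i)):
   the simple integrals converge to it along every approximating sequence. *)
Definition stochastic_integral (R : realType) (T : R) (d : nat)
    (Pi : {measure set 'rV[R]_d -> \bar R})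
    (dW : measure_display) (W : measurableType dW) (Q : probability W R)
    (F : R -> set (set W)) (n : nat) (c : 'I_n -> W -> omega T d)
    (Z : 'I_n -> R -> W -> 'rV[R]_d) (U : 'I_n -> R -> W -> 'rV[R]_d -> R)
    (I : R -> W -> R) : Prop :=
  [/\ adapted T F I, forall w, cadlag_real T (I^~ w) &
      forall S : nat -> simple_integrand R d W n,
      (forall k, simple_ok T F (S k)) ->
      integrand_norm2 T Pi Q
        (fun i r w => simple_Z (S k) i r w - Z i r w)
        (fun i r w e => simple_U (S k) i r w e - U i r w e)
        @[k --> \oo] --> 0%E ->
      forall t, 0 <= t <= T ->
      (\int[completion Q]_w
         ((simple_integral Pi c (S k) t w - I t w) ^+ 2)%:E)%E
        @[k --> \oo] --> 0%E].

(* A square-integrable process is one whose running supremum is in L^2. *)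
Definition martingale_representation (R : realType) (T : R) (d : nat)
    (Pi : {measure set 'rV[R]_d -> \bar R})
    (dW : measure_display) (W : measurableType dW) (Q : probability W R)
    (F : R -> set (set W)) (n : nat) (c : 'I_n -> W -> omega T d) : Prop :=
  forall M : R -> W -> R,
    local_martingale T Q F M ->
    (\int[completion Q]_w
       ereal_sup [set (M t w ^+ 2)%:E | t in `[0%R, T]] < +oo)%E ->
    exists Z U I, [/\ integrand T Pi Q F Z U,
      stochastic_integral Pi Q F c Z U I &
      {ae Q, forall w, forall t, 0 <= t <= T -> M t w = M 0 w + I t w}].

(** * The class of laws *)

(* [normal_prob m 0] is a uniform law in the library, whence the case split. *)
Definition gaussian (R : realType) (m s : R) (A : set R) : \bar R :=
  if s == 0 then \d_m A else normal_prob m s A.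

Definition gaussian_process (R : realType) (T : R) (d : nat)
    (P : probability (omega T d) R) : Prop :=
  forall (m : nat) (t : 'I_m -> R) (u : 'I_m -> 'rV[R]_d),
    (forall j, 0 <= t j <= T) ->
    exists mean sd : R, forall A : set R, measurable A ->
      P [set w | A (\sum_(j < m) dot (u j) (coord_B w (t j)))] = gaussian mean sd A.

Definition independent_increments (R : realType) (T : R) (d : nat)
    (P : probability (omega T d) R) : Prop :=
  forall (m : nat) (t : nat -> R) (G : 'I_m -> set 'rV[R]_d),
    (forall j, (j <= m)%N -> 0 <= t j <= T) ->
    (forall j, (j < m)%N -> t j <= t j.+1) ->
    (forall j, measurable (G j)) ->
    P [set w | forall j : 'I_m, G j (coord_B w (t j.+1) - coord_B w (t j))] =
    (\prod_(j < m) fine (P [set w | G j (coord_B w (t j.+1) - coord_B w (t j))]))%:E.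

Definition poisson_random_measure (R : realType) (T : R) (d : nat)
    (Pi : {sigma_finite_measure set 'rV[R]_d -> \bar R})
    (P : probability (omega T d) R) : Prop :=
  let intensity := (@lebesgue_measure R \x Pi)%E in
  (* the second argument of [poisson_prob] is not used in its definition *)
  (forall A : set (R * 'rV[R]_d), measurable A ->
     A `<=` `]0, T] `*` punctured ->
     ((intensity A < +oo)%E -> forall k : nat,
        P [set w | coord_N w A = (k%:R)%:E] =
        poisson_prob (fine (intensity A)) 0 [set k]) /\
     (intensity A = +oo%E -> P [set w | coord_N w A = +oo%E] = 1%E)) /\
  (forall (m : nat) (A : 'I_m -> set (R * 'rV[R]_d)) (C : 'I_m -> set (\bar R)),
     (forall j, measurable (A j) /\ A j `<=` `]0, T] `*` punctured) ->
     trivIset setT A -> (forall j, measurable (C j)) ->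
     P [set w | forall j, C j (coord_N w (A j))] =
     (\prod_(j < m) fine (P [set w | C j (coord_N w (A j))]))%:E).

Definition independent_coordinates (R : realType) (T : R) (d : nat)
    (P : probability (omega T d) R) : Prop :=
  forall A1 A2 A3 : set (omega T d),
    <<s gen_xi >> A1 -> <<s gen_B T >> A2 -> <<s gen_N T >> A3 ->
    (P (A1 `&` A2 `&` A3) = P A1 * P A2 * P A3)%E.

Definition FP (R : realType) (T : R) (d : nat) (P : probability (omega T d) R) :
    R -> set (set (omega T d)) :=
  augmented P raw_filtration.

Definition product_filtration (R : realType) (T : R) (d n : nat) (t : R) :
    set (set (n.-tuple (omega T d))) :=
  <<s [set D | exists (i : 'I_n) A, raw_filtration t A /\
         D = (fun w : n.-tuple (omega T d) => tnth w i) @^-1` A] >>.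
Arguments product_filtration {R T d n} t.

Definition is_product_law (R : realType) (T : R) (d n : nat)
    (P : probability (omega T d) R)
    (Q : probability (n.-tuple (omega T d)) R) : Prop :=
  forall A : 'I_n -> set (omega T d), (forall i, measurable (A i)) ->
    Q [set w | forall i, A i (tnth w i)] = (\prod_(i < n) fine (P (A i)))%:E.

(* int v dPi = sum_j c_j int_(0 < |z| <= 1) v(z e_j) |z|^(-1-upsilon) dz *)
Definition truncated_stable (R : realType) (d : nat) (upsilon : R)
    (c : 'I_d -> R) (Pi : {measure set 'rV[R]_d -> \bar R}) : Prop :=
  forall v : 'rV[R]_d -> \bar R, measurable_fun setT v ->
    (forall e, (0 <= v e)%E) ->
    (\int[Pi]_e v e =
     \sum_(j < d) (c j)%:E *
       \int[lebesgue_measure]_(z in [set z : R | (0 < `|z| <= 1)%R])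
         (v (z *: delta_mx 0 j)%R * (`|z| `^ (- 1 - upsilon))%:E))%E.

Definition affine_law (R : realType) (T : R) (d : nat)
    (Pi : {sigma_finite_measure set 'rV[R]_d -> \bar R})
    (a_lo a_hi : 'M[R]_d) (P : probability (omega T d) R) : Prop :=
  [/\ independent_coordinates P,
      poisson_random_measure Pi P,
      exists a : R -> 'M[R]_d,
      [/\ measurable_fun `[0, T] a,
          forall s, 0 <= s <= T ->
            [/\ (a s)^T = a s, loewner_le a_lo (a s) & loewner_le (a s) a_hi],
          gaussian_process P /\ independent_increments P,
          forall k, martingale T P (FP P) (fun t w => coord_B w t 0 k) &
          forall t k l, 0 <= t <= T ->
            covariance P (fun w => coord_B w t 0 k) (fun w => coord_B w t 0 l) =
            (\int[lebesgue_measure]_(s in `[0, t]) a s k l)%:E],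
      martingale_representation Pi P (FP P) (fun _ : 'I_1 => id) &
      forall n (Q : probability (n.-tuple (omega T d)) R), (0 < n)%N ->
        is_product_law P Q ->
        martingale_representation Pi Q (augmented Q product_filtration)
          (fun (i : 'I_n) w => tnth w i)].

(** * The affine equation *)

Definition left_limit (R : realType) (d : nat) (W : Type)
    (X : R -> W -> 'rV[R]_d) (t : R) (w : W) : 'rV[R]_d :=
  lim (X s w @[s --> t^'-]).

Definition solution (R : realType) (T : R) (d : nat)
    (Pi : {measure set 'rV[R]_d -> \bar R}) (kappa : R)
    (H : probability 'rV[R]_d R -> 'rV[R]_d) (h : R -> 'rV[R]_d)
    (eps : R) (P : probability (omega T d) R)
    (X : R -> omega T d -> 'rV[R]_d) : Prop :=
  [/\ adapted T (FP P) X,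
      forall w, cadlag T (X^~ w),
      (\int[completion P]_w
         ereal_sup [set (enorm (X t w) ^+ 2)%:E | t in `[0%R, T]] < +oo)%E &
      exists (mu : R -> probability 'rV[R]_d R) (J : 'I_d -> R -> omega T d -> R),
      [/\ forall t, 0 <= t <= T -> forall A : set 'rV[R]_d, measurable A ->
            mu t A = completion P (X t @^-1` A),
          forall k, stochastic_integral Pi P (FP P) (fun _ : 'I_1 => id)
            (fun _ _ _ => 0) (fun _ _ _ e => e 0 k) (J k) &
          {ae P, forall w, forall t, 0 <= t <= T -> forall k,
             X t w 0 k = coord_xi w 0 k +
               \int[lebesgue_measure]_(s in `[0, t])
                 (- kappa *: left_limit X s w + H (mu s) + h s) 0 k +
               eps * coord_B w t 0 k + J k t w}]].

Definition Sigma (R : realType) (d : nat) : set 'rV[R]_d :=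
  \bigcup_(k : 'I_d) [set x | x 0 k = 0].
Arguments Sigma {R d}.

(* Time in [s,T] that the left limits of [X] spend within [rho] of [Sigma]. *)
Definition occupation (R : realType) (T : R) (d : nat) (W : Type)
    (X : R -> W -> 'rV[R]_d) (s rho : R) (w : W) : R :=
  \int[lebesgue_measure]_(t in `[s, T])
    \1_[set r | (edist (left_limit X r w) Sigma <= rho%:E)%E] t.

(* Main.v *)
Require Import Defs.
From HB Require Import structures.
From mathcomp Require Import all_boot all_order all_algebra.
From mathcomp Require Import all_classical all_reals all_analysis.
From mathcomp Require Import measurable_realfun.
From mathcomp Require Import ring lra.

Set Implicit Arguments.
Unset Strict Implicit.
Unset Printing Implicit Defensive.

Import Order.TTheory GRing.Theory Num.Theory.
Import numFieldNormedType.Exports.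

Local Open Scope classical_set_scope.
Local Open Scope ring_scope.

(** The occupation time of the [rho]-neighbourhood of [Sigma] is of order [rho]
because every coordinate of [X], seen from the past, has a smooth law, and the
smoothness comes from the small jumps alone.

Fix a coordinate [k], times [s < t] and an event [A] of the past of [s]. The core
of the proof is the decay, for [lambda >= 1],
[[
  |E[1_A cos (lambda X^k_{t-})]| <= P(A) exp (- delta lambda^upsilon (t - s) / 2)
]]
with [delta] depending only on [T], [kappa] and [c_k] ([solution_chf]). To get it,
write the equation as [X^k = driver - kappa int X^k], where the driver collects the
initial value, the deterministic drift, [eps B^k] and the compensated jumps. Then
[X^k_t] is the limit of explicit Euler sums, which are linear in the increments
of the driver with coefficients between [exp (- 2 kappa T)] and [1]
([euler_cvg], [one_sub_pow_ge]). The jump part of the driver is itself an L^2 limit of linear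
combinations of numbers of jumps in boxes, products of a time interval and of a
cell of jump sizes. These numbers are
independent of each other, of [xi] and [B], and of the past when the box lies in
the future, so the modulus of the characteristic function is at most the product
of the moduli of the factors. A Poisson count of mean [m <= 1] contributes at
most [exp (- 2 e^{-1} (1 - cos (theta / 2)) m)] at frequency [theta], as one sees by
looking at its atoms at [0] and [1] only ([chfmod_two_atoms]). Only the boxes with
jump sizes between [1 / (2 lambda)] and [1 / lambda] after time [s] are kept, all other
factors being at most 1: there the frequencies stay away from 0, and the Levy mass
is at least [c_k lambda^upsilon / 2] ([levy_mass_lower]). This is [disc_chfmod].
Since the factor that contains [xi], the drift and [eps B] is only bounded by [P(A)],
the estimate is uniform in [eps] and in the law.

The decay controls small balls through the Fejer kernel of order [n = floor (1 / rho)],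
a nonnegative sum of cosines that is at least [n^2 cos^2 1] on [|x| <= rho]
([fejer_small_ball]):
[[
  P(A, |X^k_{t-}| <= rho) <= P(A) / (n cos^2 1) (1 + 2 sum_{1 <= m <= n} exp (- delta m^upsilon (t - s) / 2)).
]]
Integration over [t] in ]s, T] turns the [m]-th exponential into at most
[2 / (delta m^upsilon)], which is summable because [upsilon > 1]. Hence the
expectation of the occupation time over [A] is at most [C rho P(A)] for all [A] in
the past of [s] ([occupied_conditional]), and this is the conditional bound.

For the second moment, the square of the length of a set is twice the integral,
over the points of the set, of the length of the part of the set that comes after
([sqr_length_le]). As the event of being near [Sigma] at time [t] belongs to the
past of [t], the conditional bound at time [t] applies under the integral, and
then once more at time 0 ([occupied_sqr_integral]). *)

(** * The Fejer kernel and power sums *)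

Section Trigonometry.
Variable R : realType.
Implicit Types (a b t x y : R) (n : nat).

(** The squared modulus of the Dirichlet sum over 0 <= l < n of exp (i l x), so that
nonnegativity is visible. *)
Definition fejer n x : R :=
  (\sum_(l < n) cos (l%:R * x)) ^+ 2 + (\sum_(l < n) sin (l%:R * x)) ^+ 2.

Lemma fejerE n x :
  fejer n x = \sum_(l < n) \sum_(m < n) cos ((l%:R - m%:R) * x).
Proof.
rewrite /fejer !expr2 !mulr_suml -big_split /=; apply: eq_bigr => l _.
rewrite !mulr_sumr -big_split /=; apply: eq_bigr => m _.
by rewrite mulrBl cosB.
Qed.

Lemma fejer_ge0 n x : 0 <= fejer n x.
Proof. by rewrite addr_ge0 // sqr_ge0. Qed.

Lemma cos_small x : `|x| <= 1 -> cos 1 <= cos x.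
Proof.
move=> x1; rewrite -(cos_norm x) leNgt ltr_cos ?in_itv /= -?leNgt //.
- by rewrite ler01 (le_trans _ (pi_ge2 R)) // ler1n.
- by rewrite normr_ge0 (le_trans x1) // (le_trans _ (pi_ge2 R)) // ler1n.
Qed.

(** On |x| <= 1 / n every term cos (l x) of the Dirichlet sum is at least cos 1. *)
Lemma fejer_lower n x : n%:R * `|x| <= 1 -> n%:R ^+ 2 * cos 1 ^+ 2 <= fejer n x.
Proof.
move=> nx; rewrite /fejer -exprMn.
have h : n%:R * cos 1 <= \sum_(l < n) cos (l%:R * x).
  rewrite -{1}(card_ord n) mulr_natl -sumr_const; apply: ler_sum => l _.
  apply: cos_small; rewrite normrM ger0_norm // (le_trans _ nx) //.
  by rewrite ler_wpM2r // ler_nat ltnW.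
apply: (@le_trans _ _ ((\sum_(l < n) cos (l%:R * x)) ^+ 2)); last first.
  by rewrite lerDl sqr_ge0.
by rewrite ler_pXn2r // nnegrE ?(le_trans _ h) // mulr_ge0 // ltW // cos1_gt0.
Qed.

Lemma trig_comb_le a b x : (a * cos x + b * sin x) ^+ 2 <= a ^+ 2 + b ^+ 2.
Proof.
have := cos2Dsin2 x; move: (cos x) (sin x) => c s cs.
have : 0 <= (a * s - b * c) ^+ 2 by rewrite sqr_ge0.
nra.
Qed.

Lemma trig_comb_norm_le a b x :
  `|a * cos x + b * sin x| <= Num.sqrt (a ^+ 2 + b ^+ 2).
Proof. by rewrite -sqrtr_sqr ler_wsqrtr // trig_comb_le. Qed.

(** Sum to product: for two angles at distance t the amplitude shrinks by the factor
cos (t / 2). This is the source of the decay of all characteristic functions below. *)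
Lemma trig_comb_add a b t : a * cos 0 + b * sin 0 + (a * cos t + b * sin t) =
  2 * cos (t / 2) * (a * cos (t / 2) + b * sin (t / 2)).
Proof.
have e : t = t / 2 + t / 2 by rewrite -mulr2n -mulr_natr; field.
rewrite {1 2}e cosD sinD cos0 sin0.
have := cos2Dsin2 (t/2); move: (cos _) (sin _) => c s cs.
have -> : a * 1 = a * (c ^+ 2 + s ^+ 2) by rewrite cs.
ring.
Qed.

End Trigonometry.

Section PowerSum.
Variable R : realType.

(** After division by (m + 1)^-a this reads 1 + a / (m + 1) <= ((m + 1) / m)^a, and it
follows from exp x >= 1 + x. *)
Lemma powR_telescope (a : R) (m : nat) : 0 < a -> (0 < m)%N ->
  a * (m.+1%:R `^ (- a - 1)) <= m%:R `^ (- a) - m.+1%:R `^ (- a).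
Proof.
move=> a0 m0.
have m1 : (0 : R) < m.+1%:R by rewrite ltr0n.
have m2 : (0 : R) < m%:R by rewrite ltr0n.
have h : 1 + a / m.+1%:R <= m%:R `^ (- a) / m.+1%:R `^ (- a).
  rewrite !powRN invrK.
  rewrite /powR !gt_eqF // -expRN -expRD.
  apply: le_trans (expR_ge1Dx _); rewrite lerD2l.
  rewrite -mulrN -mulrDr ler_wpM2l ?(ltW a0) //.
  have := expR_ge1Dx (ln (m%:R / m.+1%:R : R)).
  rewrite lnK ?posrE ?divr_gt0 // ln_div // => k.
  have : m%:R / m.+1%:R = 1 - m.+1%:R^-1 :> R.
    by rewrite -natr1; field; rewrite ?natr1 ?nat1r lt0r_neq0.
  by move=> e; move: k; rewrite e lerD2l -opprB lerN2 addrC.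
have p0 : 0 < m.+1%:R `^ (- a) :> R by rewrite powR_gt0.
move: h; rewrite ler_pdivlMr // mulrDl mul1r => h.
rewrite -lerBrDl in h; apply: le_trans h.
rewrite powRD ?(gt_eqF m1) ?implybT // powR_inv1 ?(ltW m1) //.
by rewrite mulrA mulrAC.
Qed.

Lemma sum_powR_le (u : R) (n : nat) : 1 < u ->
  \sum_(m < n) m.+1%:R `^ (- u) <= 1 + (u - 1)^-1.
Proof.
move=> u1.
have u0 : 0 < u - 1 by lra.
suff h k : \sum_(m < k.+1) m.+1%:R `^ (- u) <=
    1 + (u - 1)^-1 * (1 - k.+1%:R `^ (- (u - 1))).
  case: n => [|n]; first by rewrite big_ord0 addr_ge0 // invr_ge0 ltW.
  apply: le_trans (h n) _; rewrite lerD2l ler_piMr ?invr_ge0 ?(ltW u0) //.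
elim: k => [|k IH].
  by rewrite big_ord_recr big_ord0 /= add0r !powR1; lra.
rewrite big_ord_recr /=; apply: le_trans (lerD IH (lexx _)) _.
have := @powR_telescope (u - 1) k.+1 u0 isT.
rewrite -ler_pdivlMl // (_ : - (u - 1) - 1 = - u); last by ring.
move=> h; rewrite -addrA lerD2l; apply: le_trans (lerD (lexx _) h) _.
by rewrite -mulrDr addrC subrKA.
Qed.

End PowerSum.

(** * Characteristic functions on an event *)

Section RealIntegrable.
Context {dW : measure_display} {W : measurableType dW} {R : realType}.
Variable mu : {measure set W -> \bar R}.

Lemma integrableDr (A : set W) (f g : W -> R) : measurable A ->
  mu.-integrable A (EFin \o f) -> mu.-integrable A (EFin \o g) ->
  mu.-integrable A (EFin \o (fun w => f w + g w)).
Proof. by move=> mA fi gi; exact: (integrableD mA fi gi). Qed.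

Lemma integrableZlr (A : set W) (c : R) (f : W -> R) : measurable A ->
  mu.-integrable A (EFin \o f) -> mu.-integrable A (EFin \o (fun w => c * f w)).
Proof. by move=> mA fi; exact: (integrableZl mA c fi). Qed.

End RealIntegrable.

Section Independence.
Context {dW : measure_display} {W : measurableType dW} {R : realType}.
Variable Q : probability W R.
Implicit Types (A : set W) (Y : W -> R).

(** The joint law agrees with the product of the marginal laws on rectangles, hence
everywhere, and Tonelli factorizes the integral. *)
Lemma indep_integralM_ge0 (f g : {mfun W >-> R}) :
  (forall w, 0 <= f w) -> (forall w, 0 <= g w) ->
  (forall B C : set R, measurable B -> measurable C ->
     Q (f @^-1` B `&` g @^-1` C) = (Q (f @^-1` B) * Q (g @^-1` C))%E) ->
  (\int[Q]_w (f w * g w)%:E = \int[Q]_w (f w)%:E * \int[Q]_w (g w)%:E)%E.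
Proof.
move=> f0 g0 fg.
pose h (w : W) : (R * R)%type := (f w, g w).
have mh : measurable_fun setT h by apply: measurable_fun_pair.
pose mf := distribution Q f; pose mg := distribution Q g.
pose hh : {mfun W >-> (R * R)%type} := HB.pack h (isMeasurableFun.Build _ _ _ _ _ mh).
pose m' : {measure set (R * R)%type -> \bar R} := distribution Q hh.
have E X : measurable X -> (mf \x mg)%E X = m' X.
  by apply: product_measure_unique => B C mB mC; rewrite -fg.
pose F (z : R * R) : \bar R := (Num.max z.1 0 * Num.max z.2 0)%:E.
have mF : measurable_fun setT F.
  by apply/measurable_EFinP; apply: measurable_funM; apply: measurable_maxr.
have F0 z : (0 <= F z)%E by rewrite lee_fin mulr_ge0 // le_max lexx orbT.
have -> : (\int[Q]_w (f w * g w)%:E = \int[m']_z F z)%E.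
  rewrite ge0_integral_distribution //; apply: eq_integral => w _.
  by rewrite /F /= !max_l.
rewrite (eq_measure_integral (mf \x mg)%E); last by move=> A mA _; rewrite -[LHS]E.
rewrite fubini_tonelli1 //= /fubini_F.
have i1 (k : {mfun W >-> R}) : (forall w, 0 <= k w) ->
   (\int[distribution Q k]_y (Num.max y 0)%:E = \int[Q]_w (k w)%:E)%E.
  move=> k0; rewrite ge0_integral_distribution //.
  - by apply: eq_integral => w _ /=; rewrite max_l.
  - by apply/measurable_EFinP; apply: measurable_maxr.
  - by move=> y; rewrite lee_fin le_max lexx orbT.
under eq_integral.
  move=> x _; rewrite /F /=; under eq_integral do rewrite EFinM.
  rewrite ge0_integralZl //; last 3 first.
  - by apply/measurable_EFinP; apply: measurable_maxr.
  - by move=> y _; rewrite lee_fin le_max lexx orbT.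
  - by rewrite lee_fin le_max lexx orbT.
  rewrite i1 //.
  over.
rewrite ge0_integralZr //; first by rewrite i1.
- by apply/measurable_EFinP; apply: measurable_maxr.
- by move=> y _; rewrite lee_fin le_max lexx orbT.
- by apply: integral_ge0 => w _; rewrite lee_fin.
Qed.

Lemma bounded_integrable (A : set W) (f : W -> R) (M : R) : measurable A ->
  measurable_fun A f -> (forall w, A w -> `|f w| <= M) -> Q.-integrable A (EFin \o f).
Proof.
move=> mA mf fM; apply: measurable_bounded_integrable => //.
  by rewrite (le_lt_trans (probability_le1 _ _)) ?ltry.
exists M; split; first exact: num_real.
by move=> x Mx w Aw; apply: le_trans (fM _ Aw) _; exact: ltW.
Qed.

Lemma Rintegral_prob_cst r : \int[Q]_w r = r :> R.
Proof.
by rewrite Rintegral_cst // [X in fine X](probability_setT Q) mulr1.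
Qed.

(** Shifting f and g by 1 makes them nonnegative, which reduces the claim to the case
of Tonelli. *)
Lemma indep_RintegralM (f g : W -> R) :
  measurable_fun setT f -> measurable_fun setT g ->
  (forall w, `|f w| <= 1) -> (forall w, `|g w| <= 1) ->
  (forall B C : set R, measurable B -> measurable C ->
     Q (f @^-1` B `&` g @^-1` C) = (Q (f @^-1` B) * Q (g @^-1` C))%E) ->
  \int[Q]_w (f w * g w) = \int[Q]_w f w * \int[Q]_w g w.
Proof.
move=> mf mg f1 g1 fg.
have mf' : measurable_fun setT (fun w => f w + 1) by apply: measurable_funD.
have mg' : measurable_fun setT (fun w => g w + 1) by apply: measurable_funD.
pose ff : {mfun W >-> R} := HB.pack (fun w => f w + 1) (isMeasurableFun.Build _ _ _ _ _ mf').
pose gg : {mfun W >-> R} := HB.pack (fun w => g w + 1) (isMeasurableFun.Build _ _ _ _ _ mg').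
have iC : Q.-integrable setT (EFin \o (fun _ : W => 1 : R)).
  by apply: (@bounded_integrable _ _ 1) => // w _; rewrite normr1.
have if_ : Q.-integrable setT (EFin \o f) by apply: (@bounded_integrable _ _ 1).
have ig : Q.-integrable setT (EFin \o g) by apply: (@bounded_integrable _ _ 1).
have ifg : Q.-integrable setT (EFin \o (fun w => f w * g w)).
  apply: (@bounded_integrable _ _ 1) => //; first exact: measurable_funM.
  by move=> w _; rewrite normrM mulr_ile1.
have i1 : \int[Q]_w (1 : R) = 1 by exact: Rintegral_prob_cst.
have := @indep_integralM_ge0 ff gg.
have -> : (\int[Q]_w (ff w * gg w)%:E)%E =
   (\int[Q]_w (f w * g w) + \int[Q]_w f w + \int[Q]_w g w + 1)%:E.
  have e w : ff w * gg w = f w * g w + f w + g w + 1 by rewrite /=; ring.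
  under eq_integral do rewrite e.
  have i3 : Q.-integrable setT (EFin \o (fun w => f w * g w + f w)).
    exact: integrableDr.
  have i4 : Q.-integrable setT (EFin \o (fun w => f w * g w + f w + g w)).
    exact: integrableDr.
  have -> : \int[Q]_w (f w * g w) + \int[Q]_w f w + \int[Q]_w g w + 1 =
      \int[Q]_w (f w * g w + f w + g w + 1) by rewrite !RintegralD // i1.
  rewrite /Rintegral fineK //; apply: integrable_fin_num => //.
  exact: integrableDr.
have j (k : W -> R) : Q.-integrable setT (EFin \o k) ->
   (\int[Q]_w (k w + 1)%:E)%E = (\int[Q]_w k w + 1)%:E.
  move=> ik.
  have -> : \int[Q]_w k w + 1 = \int[Q]_w (k w + 1) by rewrite RintegralD // i1.
  rewrite /Rintegral fineK //.
  by apply: integrable_fin_num => //; exact: integrableDr.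
have -> : (\int[Q]_w (ff w)%:E)%E = (\int[Q]_w f w + 1)%:E by exact: j.
have -> : (\int[Q]_w (gg w)%:E)%E = (\int[Q]_w g w + 1)%:E by exact: j.
move=> H; have {H} : \int[Q]_w (f w * g w) + \int[Q]_w f w + \int[Q]_w g w + 1 =
   (\int[Q]_w f w + 1) * (\int[Q]_w g w + 1).
  apply: EFin_inj; rewrite EFinM; apply: H.
  - by move=> w /=; have := f1 w; rewrite ler_norml => /andP[]; lra.
  - by move=> w /=; have := g1 w; rewrite ler_norml => /andP[]; lra.
  have e (k : W -> R) (B : set R) : (fun w => k w + 1) @^-1` B = k @^-1` ((fun x => x + 1) @^-1` B).
    by [].
  move=> B C mB mC; rewrite /= !e; apply: fg.
    by rewrite -[X in measurable X]setTI; apply: measurable_funD.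
  by rewrite -[X in measurable X]setTI; apply: measurable_funD.
move: (\int[Q]_w (f w * g w)) (\int[Q]_w f w) (\int[Q]_w g w) => a b c; lra.
Qed.

(** The modulus of E[1_A exp (i Y)], through real integrals. *)
Definition chfmod (A : set W) (Y : W -> R) : R :=
  Num.sqrt ((\int[Q]_(w in A) cos (Y w)) ^+ 2 + (\int[Q]_(w in A) sin (Y w)) ^+ 2).

Lemma measurable_cos_comp (A : set W) (Y : W -> R) :
  measurable_fun A Y -> measurable_fun A (cos \o Y).
Proof.
by apply: measurableT_comp; apply: continuous_measurable_fun; exact: continuous_cos.
Qed.

Lemma measurable_sin_comp (A : set W) (Y : W -> R) :
  measurable_fun A Y -> measurable_fun A (sin \o Y).
Proof.
by apply: measurableT_comp; apply: continuous_measurable_fun; exact: continuous_sin.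
Qed.

Lemma integrable_cos (A : set W) (Y : W -> R) : measurable A ->
  measurable_fun A Y -> Q.-integrable A (EFin \o (fun w => cos (Y w))).
Proof.
move=> mA mY; apply: (@bounded_integrable _ _ 1) => //.
  exact: measurable_cos_comp.
by move=> w _; exact: cos_max.
Qed.

Lemma integrable_sin (A : set W) (Y : W -> R) : measurable A ->
  measurable_fun A Y -> Q.-integrable A (EFin \o (fun w => sin (Y w))).
Proof.
move=> mA mY; apply: (@bounded_integrable _ _ 1) => //.
  exact: measurable_sin_comp.
by move=> w _; exact: sin_max.
Qed.

Lemma chfmod_ge0 A Y : 0 <= chfmod A Y.
Proof. exact: sqrtr_ge0. Qed.

Lemma chfmod_cos A Y : `|\int[Q]_(w in A) cos (Y w)| <= chfmod A Y.
Proof. by rewrite -sqrtr_sqr ler_wsqrtr // lerDl sqr_ge0. Qed.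

Lemma chfmod_eq A Y Y' : {in A, Y =1 Y'} -> chfmod A Y = chfmod A Y'.
Proof.
by move=> e; rewrite /chfmod; congr (Num.sqrt (_ ^+ 2 + _ ^+ 2));
  apply: eq_Rintegral => w wA; rewrite e.
Qed.

(** If r exp (i phi) = E[1_A exp (i Y)], then r^2 = r E[1_A cos (Y - phi)]; the
integrand on the right is written with a = r cos phi and b = r sin phi, so that
no phase has to be chosen. *)
Lemma chfmod_sqr A Y : measurable A -> measurable_fun A Y ->
  let a := \int[Q]_(w in A) cos (Y w) in
  let b := \int[Q]_(w in A) sin (Y w) in
  chfmod A Y ^+ 2 = \int[Q]_(w in A) (a * cos (Y w) + b * sin (Y w)).
Proof.
move=> mA mY a b.
rewrite sqr_sqrtr ?addr_ge0 ?sqr_ge0 //.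
have ic := integrable_cos mA mY; have is_ := integrable_sin mA mY.
rewrite RintegralD //; last 2 first.
- exact: integrableZlr.
- exact: integrableZlr.
by rewrite !RintegralZl // !expr2.
Qed.

Lemma chfmod_le A Y : measurable A -> measurable_fun A Y ->
  chfmod A Y <= fine (Q A).
Proof.
move=> mA mY; set r := chfmod A Y.
have r0 : 0 <= r by exact: chfmod_ge0.
have h : r ^+ 2 <= r * fine (Q A).
  rewrite [in leLHS]/r chfmod_sqr // -Rintegral_cst //.
  have ic := integrable_cos mA mY; have is_ := integrable_sin mA mY.
  apply: le_Rintegral => //.
  - apply: integrableDr => //.
    + exact: integrableZlr.
    + exact: integrableZlr.
  - apply: (@bounded_integrable _ _ r) => // w _; by rewrite ger0_norm.
  - move=> w _; apply: le_trans (ler_norm _) _; exact: trig_comb_norm_le.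
move: r0; rewrite le_eqVlt => /orP[/eqP <-|r0]; first by rewrite fine_ge0.
by move: h; rewrite expr2 ler_pM2l.
Qed.

(** Only the atoms of U at 0 and 1 are used. In the notation of chfmod_sqr, the
integrand g is at most r everywhere, while g(0) + g(t) <= 2 cos (t / 2) r. As the
atom at 0 is at least as heavy as p, the part of mass p of both atoms together
loses 2 p (1 - cos (t / 2)) r. *)
Lemma chfmod_two_atoms (U : W -> R) (t p : R) :
  measurable_fun setT U ->
  0 <= cos (t / 2) ->
  p%:E = Q (U @^-1` [set 1]) -> (Q (U @^-1` [set 1%R]) <= Q (U @^-1` [set 0%R]))%E ->
  chfmod setT (fun w => t * U w) <= 1 - 2 * p * (1 - cos (t / 2)).
Proof.
move=> mU ct pE p01; set r := chfmod _ _.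
have r0 : 0 <= r by exact: chfmod_ge0.
have mtU : measurable_fun setT (fun w => t * U w) by apply: measurable_funM.
have ic := integrable_cos measurableT mtU.
have is_ := integrable_sin measurableT mtU.
pose a := \int[Q]_w cos (t * U w); pose b := \int[Q]_w sin (t * U w).
pose g x := a * cos x + b * sin x.
have gr x : g x <= r by rewrite (le_trans (ler_norm _)) // trig_comb_norm_le.
pose A0 := U @^-1` [set 0]; pose A1 := U @^-1` [set 1].
have m0 : measurable A0 by rewrite -[A0]setTI; apply: mU.
have m1 : measurable A1 by rewrite -[A1]setTI; apply: mU.
have iA (A : set W) : measurable A -> Q.-integrable setT (EFin \o \1_A).
  move=> mA; apply: (@bounded_integrable _ _ 1) => // w _.
  by rewrite indicE; case: (_ \in _); rewrite ?normr1 ?normr0.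
have h : r ^+ 2 <= r + (g 0 - r) * fine (Q A0) + (g t - r) * fine (Q A1).
  rewrite [in leLHS]/r chfmod_sqr //.
  have q (A : set W) (c : R) : measurable A -> c * fine (Q A) = \int[Q]_w (c * \1_A w).
    move=> mA; rewrite RintegralZl ?iA //; congr (_ * _).
    by rewrite /Rintegral integral_indic // setIT.
  have -> : r = \int[Q]_w (cst r w) by rewrite Rintegral_prob_cst.
  have iZ (A : set W) (c : R) : measurable A -> Q.-integrable setT (EFin \o (fun w => c * \1_A w)).
    move=> mA; exact: integrableZlr (iA A mA).
  have ir : Q.-integrable setT (EFin \o cst r).
    by apply: (@bounded_integrable _ _ `|r|).
  rewrite !q // -!RintegralD ?iZ //; last by apply: integrableDr; rewrite ?iZ.
  apply: le_Rintegral => //.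
  - apply: integrableDr => //.
    + exact: integrableZlr.
    + exact: integrableZlr.
  - by apply: integrableDr; rewrite ?iZ //; apply: integrableDr; rewrite ?iZ.
  move=> w _; rewrite !indicE /=.
  rewrite Rintegral_prob_cst.
  have [|n0] := boolP (w \in A0).
    rewrite inE => e0; rewrite memNset ?mulr1 ?mulr0; last first.
      by rewrite /A1 /= e0; apply/eqP; rewrite eq_sym oner_eq0.
    by rewrite e0 mulr0 -[leLHS]/(g 0); lra.
  have [|n1] := boolP (w \in A1).
    by rewrite inE => e1; rewrite e1 !mulr1 mulr0 -[leLHS]/(g t); lra.
  by rewrite !mulr0 !addr0; exact: gr.
have pe : fine (Q A1) = p by rewrite /A1 -pE.
have p0 : 0 <= p by rewrite -pe fine_ge0.
have pp : p <= fine (Q A0).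
  by rewrite -pe fine_le // fin_num_measure.
have g01 : g 0 + g t <= 2 * cos (t / 2) * r.
  rewrite /g trig_comb_add; apply: ler_wpM2l; last exact: gr.
  by rewrite mulr_ge0.
move: r0; rewrite le_eqVlt => /orP[/eqP r0|r0].
  rewrite -r0 subr_ge0.
  have pl : p <= 1 - fine (Q A0).
    rewrite -pe -lee_fin EFinB fineK ?fin_num_measure // fineK ?fin_num_measure //.
    rewrite -(probability_setC Q m0); apply: le_measure; rewrite ?inE //.
      exact: measurableC.
    move=> w; rewrite /A0 /A1 /= => ->; apply/eqP; exact: oner_neq0.
  have := cos_le1 (t/2); nra.
rewrite -(ler_pM2l r0) -expr2; apply: le_trans h _.
rewrite pe; have := gr 0; nra.
Qed.

Definition independent_of (G : set (set W)) (U : W -> R) : Prop :=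
  forall B C, <<s G >> B -> measurable C ->
    Q (B `&` U @^-1` C) = (Q B * Q (U @^-1` C))%E.

(** The addition formulas for cos and sin express the complex product of the two
characteristic functions, and the modulus is multiplicative. *)
Lemma chfmod_indep (G : set (set W)) A Y (U : W -> R) :
  (forall B, <<s G >> B -> measurable B) ->
  <<s G >> A -> measurable_fun setT (Y : g_sigma_algebraType G -> R) ->
  measurable_fun setT U -> independent_of G U ->
  chfmod A (fun w => Y w + U w) = chfmod A Y * chfmod setT U.
Proof.
move=> Gm GA mY mU ind.
have mA : measurable A by exact: Gm.
have mYW : measurable_fun setT Y.
  by move=> _ C mC; rewrite setTI; apply: Gm; rewrite -[X in _ X]setTI; exact: mY.
have key (f : g_sigma_algebraType G -> R) (g : R -> R) :
    measurable_fun setT f -> (forall x, `|f x| <= 1) ->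
    measurable_fun setT g -> (forall x, `|g x| <= 1) ->
    \int[Q]_(w in A) (f w * g (U w)) = \int[Q]_(w in A) f w * \int[Q]_w g (U w).
  move=> mf f1 mg g1.
  rewrite Rintegral_mkcond [X in X * _]Rintegral_mkcond.
  have mfA : measurable_fun setT ((f \_ A) : g_sigma_algebraType G -> R).
    apply/(measurable_restrictT f GA); exact: measurable_funS mf.
  rewrite -(@indep_RintegralM (f \_ A) (g \o U)).
  - by apply: eq_Rintegral => w _; rewrite !patchE; case: ifP; rewrite ?mul0r.
  - move=> _ C mC; rewrite setTI; apply: Gm.
    by rewrite -[X in _ X]setTI; exact: mfA.
  - exact: measurableT_comp.
  - by move=> w; rewrite patchE; case: ifP; rewrite // normr0.
  - by move=> w; exact: g1.
  move=> B C mB mC; rewrite comp_preimage; apply: ind.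
    by rewrite -[X in _ X]setTI; exact: mfA.
  by rewrite -[X in _ X]setTI; exact: mg.
have mc : measurable_fun setT (@cos R).
  by apply: continuous_measurable_fun; exact: continuous_cos.
have ms : measurable_fun setT (@sin R).
  by apply: continuous_measurable_fun; exact: continuous_sin.
have mcY : measurable_fun setT (cos \o Y : g_sigma_algebraType G -> R).
  exact: measurableT_comp.
have msY : measurable_fun setT (sin \o Y : g_sigma_algebraType G -> R).
  exact: measurableT_comp.
have i1 (f : W -> R) (g : R -> R) : measurable_fun A f -> (forall w, `|f w| <= 1) ->
    measurable_fun setT g -> (forall x, `|g x| <= 1) ->
    Q.-integrable A (EFin \o (fun w => f w * g (U w))).
  move=> mf f1 mg g1; apply: (@bounded_integrable _ _ 1) => //.
    apply: measurable_funM => //; apply: measurable_funTS.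
    exact: measurableT_comp.
  by move=> w _; rewrite normrM mulr_ile1.
have mYA : measurable_fun A Y by exact: measurable_funTS.
have mcA : measurable_fun A (cos \o Y) by exact: measurable_cos_comp.
have msA : measurable_fun A (sin \o Y) by exact: measurable_sin_comp.
have cm := @cos_max R; have sm := @sin_max R.
have k1 : \int[Q]_(w in A) (cos (Y w) * cos (U w)) =
    \int[Q]_(w in A) cos (Y w) * \int[Q]_w cos (U w).
  exact: (key _ _ mcY (fun=> cm _) mc (fun=> cm _)).
have k2 : \int[Q]_(w in A) (sin (Y w) * sin (U w)) =
    \int[Q]_(w in A) sin (Y w) * \int[Q]_w sin (U w).
  exact: (key _ _ msY (fun=> sm _) ms (fun=> sm _)).
have k3 : \int[Q]_(w in A) (sin (Y w) * cos (U w)) =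
    \int[Q]_(w in A) sin (Y w) * \int[Q]_w cos (U w).
  exact: (key _ _ msY (fun=> sm _) mc (fun=> cm _)).
have k4 : \int[Q]_(w in A) (cos (Y w) * sin (U w)) =
    \int[Q]_(w in A) cos (Y w) * \int[Q]_w sin (U w).
  exact: (key _ _ mcY (fun=> cm _) ms (fun=> sm _)).
have eC : \int[Q]_(w in A) cos (Y w + U w) =
    \int[Q]_(w in A) cos (Y w) * \int[Q]_w cos (U w) -
    \int[Q]_(w in A) sin (Y w) * \int[Q]_w sin (U w).
  rewrite -k1 -k2 -RintegralB //; last 2 first.
  - exact: (i1 (cos \o Y) _ mcA (fun=> cm _)).
  - exact: (i1 (sin \o Y) _ msA (fun=> sm _)).
  by apply: eq_Rintegral => w _; rewrite cosD.
have eS : \int[Q]_(w in A) sin (Y w + U w) =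
    \int[Q]_(w in A) sin (Y w) * \int[Q]_w cos (U w) +
    \int[Q]_(w in A) cos (Y w) * \int[Q]_w sin (U w).
  rewrite -k3 -k4 -RintegralD //; last 2 first.
  - exact: (i1 (sin \o Y) _ msA (fun=> sm _)).
  - exact: (i1 (cos \o Y) _ mcA (fun=> cm _)).
  by apply: eq_Rintegral => w _; rewrite sinD.
rewrite /chfmod eC eS -sqrtrM ?addr_ge0 ?sqr_ge0 //; congr Num.sqrt; ring.
Qed.

(** Each U i has to be independent of a sigma-algebra G i that contains A and makes Y
and all the other U j measurable; the factors then split off one at a time. *)
Lemma chfmod_sum (I : eqType) (s : seq I) (G : I -> set (set W))
    (U : I -> W -> R) A Y :
  uniq s -> measurable_fun setT Y -> measurable A ->
  (forall i B, i \in s -> <<s G i >> B -> measurable B) ->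
  (forall i, i \in s -> [/\ <<s G i >> A, measurable_fun setT (U i),
     independent_of (G i) (U i) &
     measurable_fun setT (Y : g_sigma_algebraType (G i) -> R)]) ->
  (forall i j, i \in s -> j \in s -> i != j ->
     measurable_fun setT (U j : g_sigma_algebraType (G i) -> R)) ->
  chfmod A (fun w => Y w + \sum_(i <- s) U i w) =
  chfmod A Y * \prod_(i <- s) chfmod setT (U i).
Proof.
elim: s => [|i s IH] /= us mY mA Gm h hU.
  by rewrite big_nil mulr1; apply: chfmod_eq => w _; rewrite big_nil addr0.
have /andP[nis us'] := us.
have [GA mUi ind mYi] := h i (mem_head _ _).
rewrite big_cons mulrCA -IH //; first last.
- by move=> j k js ks; apply: hU; rewrite inE ?js ?ks orbT.
- by move=> j js; apply: h; rewrite inE js orbT.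
- by move=> j B js; apply: Gm; rewrite inE js orbT.
rewrite mulrC -(@chfmod_indep (G i)) //; last 2 first.
- by move=> B; apply: Gm; exact: mem_head.
- apply: measurable_funD => //; rewrite -(filter_predT s).
  under eq_fun do rewrite big_filter big_seq_cond.
  have -> : (fun w => \sum_(j <- s | (j \in s) && true) U j w) =
    (fun w => \sum_(j <- s) (if j \in s then U j w else 0)).
    by apply/funext => w; rewrite -big_mkcond /=; under eq_bigl do rewrite andbT.
  apply: (@measurable_sum _ (g_sigma_algebraType (G i)) R setT I s (fun j w => if j \in s then U j w else 0)) => j.
  have [js|_] := boolP (j \in s); last exact: measurable_cst.
  apply: hU; rewrite ?mem_head ?inE ?js ?orbT //.
  by apply: contraNneq nis => ->.
apply: chfmod_eq => w _; rewrite big_cons; ring.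
Qed.

End Independence.

(** * Measurability of the numbers of jumps *)

Section RandomMeasure.
Context {dW dV : measure_display} {W : measurableType dW} {V : measurableType dV}
  {R : realType}.

(** The sets A with this property form a lambda-system, by finiteness of N w D, and
contain the pi-system G. *)
Lemma measurable_fun_measure_gen (N : W -> {measure set V -> \bar R}) (D : set V)
    (G : set (set V)) :
  measurable D -> (forall w, N w D < +oo)%E ->
  @measurable _ V = <<s G >> -> setI_closed G ->
  measurable_fun setT (fun w => N w D) ->
  (forall A, G A -> measurable_fun setT (fun w => N w (A `&` D))) ->
  forall A, measurable A -> measurable_fun setT (fun w => N w (A `&` D)).
Proof.
move=> mD Dfin mG GI hD hG A; rewrite mG; move: A.
apply: (dynkin_induction mG GI) => //.
- by under eq_fun do rewrite setTI.
- move=> A mA hA.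
  have -> : (fun w => N w (~` A `&` D)) = (fun w => N w D - N w (A `&` D))%E.
    apply/funext => w; rewrite (_ : ~` A `&` D = D `\` A).
      by rewrite measureD ?(setIC D) //; exact: Dfin.
    by rewrite setDE setIC.
  exact: emeasurable_funB.
- move=> F mF tF hF.
  have -> : (fun w => N w (\bigcup_k F k `&` D)) =
      (fun w => \sum_(0 <= k <oo) N w (F k `&` D))%E.
    apply/funext => w; rewrite setI_bigcupl measure_bigcup //.
    - by apply: eq_eseriesl => k; rewrite in_setT.
    - by move=> k _; apply: measurableI.
    - by apply: trivIset_setIr.
  by apply: ge0_emeasurable_sum.
Qed.

End RandomMeasure.

Section EuclideanMeasurable.
Context {R : realType} {d : nat}.

Lemma open_measurable_rV (A : set 'rV[R]_d) : open A -> measurable A.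
Proof. by move=> oA; exact: sub_sigma_algebra. Qed.

Lemma measurable_coord (k : 'I_d) :
  measurable_fun setT (fun e : 'rV[R]_d => e 0 k).
Proof.
apply: measurability; first exact: measurable_realfun.RGenOpens.measurableE.
move=> _ [_ [a [b ->]] <-]; rewrite setTI; apply: open_measurable_rV.
apply: open_comp; last exact: interval_open.
by move=> x _; exact: coord_continuous.
Qed.

Lemma measurable_enorm : measurable_fun setT (@enorm R d).
Proof.
apply: measurableT_comp.
  by apply: continuous_measurable_fun; exact: sqrt_continuous.
apply: measurable_sum => i; apply: measurable_funM; exact: measurable_coord.
Qed.

Lemma measurable_enorm_gt (r : R) : measurable [set e : 'rV[R]_d | r < enorm e].
Proof.
rewrite -[X in measurable X]setTI.
have -> : [set e | r < enorm e] = @enorm R d @^-1` `]r, +oo[%classic.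
  by apply/seteqP; split => e /=; rewrite in_itv /= andbT.
exact: measurable_enorm.
Qed.

Lemma coord_le_enorm (e : 'rV[R]_d) k : `|e 0 k| <= enorm e.
Proof.
rewrite /enorm -sqrtr_sqr ler_wsqrtr // /dot (bigD1 k) //= expr2 lerDl.
by apply: sumr_ge0 => i _; rewrite -expr2 sqr_ge0.
Qed.

End EuclideanMeasurable.

Section JumpMeasure.
Context {R : realType} {T : R} {d : nat}.
Local Notation V := (R * 'rV[R]_d)%type.
Implicit Types (w : omega T d) (G : set 'rV[R]_d) (a b t : R).

(** A set at a positive distance from the origin avoids some ball of radius
1 / (n + 1), on whose complement the number of jumps is finite. *)
Lemma off_origin_level G : off_origin G ->
  exists n : nat, G `<=` [set e | n.+1%:R^-1 < enorm e].
Proof.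
move=> [mG Gp G0].
have [r [r0 rG]] : exists r : R, 0 < r /\ forall e, G e -> r <= enorm e.
  have sN e : enorm (0 - e) = enorm e.
    by rewrite /enorm /dot; congr Num.sqrt; apply: eq_bigr => i _; rewrite sub0r !mxE mulrNN.
  move: G0; case E : (Defs.edist 0 G) => [r| |] //.
  - rewrite lte_fin => r0; exists r; split => // e Ge.
    by rewrite -lee_fin -E; apply: ereal_inf_lbound; exists e => //; rewrite sN.
  - move=> _; exists 1; split => // e Ge.
    have : (Defs.edist 0 G <= (enorm e)%:E)%E.
      by apply: ereal_inf_lbound; exists e => //; rewrite sN.
    by rewrite E leye_eq.
exists (Num.truncn r^-1) => e Ge /=; apply: lt_le_trans (rG _ Ge).
rewrite -[ltRHS]invrK ltf_pV2 ?posrE ?invr_gt0 //.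
exact: truncnS_gt.
Qed.

Lemma off_originS G G' : measurable G' -> G' `<=` G -> off_origin G -> off_origin G'.
Proof.
move=> mG' GG [mG Gp G0]; split => //; first exact: subset_trans Gp.
apply: lt_le_trans G0 _; apply: le_ereal_inf => _ [y Gy <-]; exists y => //; exact: GG.
Qed.

Lemma measurable_strip a b G : measurable G -> measurable (`]a, b] `*` G : set V).
Proof. by move=> mG; apply: measurableX. Qed.

Lemma jumps_off_origin_lty w G : off_origin G ->
  (coord_N w (`]0%R, T] `*` G) < +oo)%E.
Proof.
move=> oG; have [n Gn] := off_origin_level oG.
have [mG _ _] := oG.
apply: le_lt_trans (jumps_finite (coord_N w) n).
apply: le_measure; rewrite ?inE.
- exact: measurable_strip.
- apply: measurable_strip.
  exact: measurable_enorm_gt.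
- by move=> [x e] /= [xT Ge]; split => //=; exact: Gn.
Qed.

Lemma jumps_strip_lty w a b G : 0 <= a -> b <= T -> off_origin G ->
  (coord_N w (`]a, b] `*` G) < +oo)%E.
Proof.
move=> a0 bT oG; have [mG _ _] := oG.
apply: le_lt_trans (jumps_off_origin_lty w oG).
apply: le_measure; rewrite ?inE; try exact: measurable_strip.
move=> [x e] /= [+ Ge]; rewrite !in_itv /= => /andP[ax xb]; split => //.
by rewrite (le_lt_trans a0 ax) (le_trans xb bT).
Qed.

Lemma jumps_stripE w a b G : 0 <= a -> a <= b -> b <= T -> off_origin G ->
  coord_N w (`]a, b] `*` G) =
  (coord_N w (`]0%R, b] `*` G) - coord_N w (`]0%R, a] `*` G))%E.
Proof.
move=> a0 ab bT oG; have [mG _ _] := oG.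
have -> : `]a, b] `*` G = (`]0%R, b] `*` G) `\` (`]0%R, a] `*` G).
  apply/seteqP; split => -[x e] /=; rewrite !in_itv /=.
    move=> [/andP[ax xb] Ge]; rewrite (le_lt_trans a0 ax) xb; split => //.
    by move=> [+ _]; rewrite leNgt ax.
  move=> [[/andP[x0 xb] Ge]] h; split => //; rewrite xb andbT ltNge.
  by apply/negP => xa; apply: h; rewrite x0.
rewrite measureD; last 3 first.
- exact: measurable_strip.
- exact: measurable_strip.
- exact: jumps_strip_lty.
congr (_ - coord_N w _)%E; apply/seteqP; split => -[x e] /=; rewrite !in_itv /=.
  by move=> [].
move=> [/andP[x0 xa] Ge]; rewrite x0 xa; split => //; split => //.
exact: le_trans ab.
Qed.

Let WN := g_sigma_algebraType (@gen_N R T d T).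

Lemma measurable_jumps_gen (a b : R) G : 0 <= a -> b <= T -> off_origin G ->
  measurable_fun setT (fun w : WN => coord_N w (`]a, b] `*` G)).
Proof.
move=> a0 bT oG; have [ab|ab] := leP a b; last first.
  have -> : `]a, b]%classic = set0 :> set R.
    by rewrite set_itv_ge // bnd_simp -leNgt ltW.
  by under eq_fun do rewrite set0X measure0; exact: measurable_cst.
have h (s : R) : 0 <= s <= T ->
    measurable_fun setT (fun w : WN => coord_N w (`]0, s] `*` G)).
  move=> sT _ C mC; rewrite setTI; apply: sub_sigma_algebra.
  by exists s, G, C.
under eq_fun do rewrite jumps_stripE //.
apply: emeasurable_funB; apply: h; first by rewrite (le_trans a0 ab).
by rewrite a0 (le_trans ab bT).
Qed.

Lemma measurable_jumps (A : set V) G : 0 <= T -> off_origin G -> measurable A ->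
  measurable_fun setT (fun w : WN => coord_N w (A `&` (`]0, T] `*` G))).
Proof.
move=> T0 oG; have [mG _ _] := oG; move: A.
apply: (@measurable_fun_measure_gen _ _ _ _ _ (fun w : WN => jmeasure (coord_N w))).
- exact: measurable_strip.
- by move=> w; exact: jumps_strip_lty.
- exact: measurable_prod_measurableType.
- move=> _ _ [A mA [B mB <-]] [A' mA' [B' mB' <-]].
  exists (A `&` A'); first exact: measurableI.
  by exists (B `&` B'); [exact: measurableI|rewrite setXI].
- exact: measurable_jumps_gen.
move=> _ [A mA [B mB <-]].
have oGB : off_origin (G `&` B).
  by apply: off_originS oG; [exact: measurableI|exact: subIsetl].
have [mGB _ _] := oGB.
pose D : set V := `]0, T] `*` (G `&` B).
have mD : measurable D by exact: measurable_strip.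
have [nu nuE] : exists nu : WN -> {measure set R -> \bar R},
    forall w X, nu w X = coord_N w (fst @^-1` X `&` D).
  unshelve eexists.
    move=> w; refine (pushforward (mrestr (coord_N w) mD) (@fst R 'rV[R]_d)).
    exact: measurable_fst.
  by [].
have -> : (fun w : WN => coord_N w (A `*` B `&` `]0, T] `*` G)) =
   (fun w => nu w (A `&` setT)).
  apply/funext => w; rewrite setIT nuE; congr (coord_N w _).
  apply/seteqP; split => -[x e] /=; first by move=> [[? ?] [? ?]].
  by move=> [? [? [? ?]]].
move: A mA; apply: (@measurable_fun_measure_gen _ _ _ _ _ nu setT (@ocitv R)).
- exact: measurableT.
- move=> w; rewrite nuE preimage_setT setTI.
  exact: jumps_strip_lty.
- by [].
- exact: ocitvI.
- under eq_fun do rewrite nuE preimage_setT setTI.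
  exact: measurable_jumps_gen.
move=> _ [[x y] _ <-] /=.
under eq_fun do rewrite nuE.
have -> : (fun w : WN => coord_N w (fst @^-1` (`]x, y]%classic `&` setT) `&` D)) =
  (fun w : WN => coord_N w (`]Num.max x 0, Num.min y T] `*` (G `&` B))).
  apply/funext => w; congr (coord_N w _); rewrite setIT.
  apply/seteqP; split => -[z e]; rewrite /D /= !in_itv /= gt_max le_min.
    by move=> [/andP[-> ->] [/andP[-> ->] GB]].
  by move=> [/andP[/andP[-> ->] /andP[-> ->]] GB].
apply: measurable_jumps_gen => //; first by rewrite le_max lexx orbT.
by rewrite ge_min lexx orbT.
Qed.

End JumpMeasure.

(** * Independence of the jumps in disjoint regions *)

Section PiIndependence.
Context {dW : measure_display} {W : measurableType dW} {R : realType}.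
Variable Q : probability W R.

(** The sets independent of E form a lambda-system. *)
Lemma indep_sigma_algebra (G : set (set W)) (E : set W) :
  setI_closed G -> G `<=` measurable -> measurable E ->
  (forall F, G F -> Q (F `&` E) = (Q F * Q E)%E) ->
  forall F, <<s G >> F -> Q (F `&` E) = (Q F * Q E)%E.
Proof.
move=> GI Gm mE h F GF.
suff : <<s G >> `<=` [set F | measurable F /\ Q (F `&` E) = (Q F * Q E)%E].
  by move=> /(_ _ GF) [].
apply: lambda_system_subset; [by []| | |by []]; last first.
  by move=> A GA; split; [exact: Gm|exact: h].
apply/dynkin_lambda_system; split => /=.
- by split => //; rewrite setTI [X in (X * _)%E](probability_setT Q) mul1e.
- move=> A [mA hA]; split; first exact: measurableC.
  rewrite setIC -setDE measureD //; last by rewrite ltey_eq fin_num_measure.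
  transitivity (Q E - Q A * Q E)%E; first by rewrite -hA setIC.
  rewrite probability_setC // muleBl ?mul1e //; first exact: fin_num_measure.
- move=> A tA hA.
  have mA n : measurable (A n) by have [] := hA n.
  split; first exact: bigcup_measurable.
  rewrite setI_bigcupl !measure_bigcup //; last 2 first.
  - by move=> n _; exact: measurableI.
  - exact: trivIset_setIr.
  have qE : Q E = (fine (Q E))%:E by rewrite fineK // fin_num_measure.
  rewrite [RHS]muleC [in RHS]qE -nneseriesZl // -qE.
  by apply: eq_eseriesr => n _; rewrite muleC; have [] := hA n.
Qed.

End PiIndependence.

Section SingleCell.
Context {R : realType} {T : R} {d : nat}.
Local Notation V := (R * 'rV[R]_d)%type.
Implicit Types (A C : set V).

(** The regions with finitely many jumps. *)
Definition off_strip A : Prop :=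
  measurable A /\ exists2 G, off_origin G & A `<=` `]0, T] `*` G.

Definition gen_jumps_off C : set (set (omega T d)) :=
  [set E | exists A (S : set (\bar R)),
     [/\ off_strip A, A `&` C = set0, measurable S &
         E = (fun w => coord_N w A) @^-1` S]].

(** All the information of the canonical space except for the jumps in C. *)
Definition gen_off C : set (set (omega T d)) :=
  gen_xi `|` gen_B T `|` gen_jumps_off C.

Hypothesis T0 : 0 <= T.

Lemma measurable_off_strip A : off_strip A ->
  measurable_fun setT (fun w : g_sigma_algebraType (@gen_N R T d T) => coord_N w A).
Proof.
move=> [mA [G oG AG]]; have := measurable_jumps T0 oG mA.
by rewrite (setIidl AG).
Qed.

Lemma off_strip_sub A : off_strip A -> A `<=` `]0, T] `*` punctured.
Proof.
by move=> [mA [G [_ Gp _] AG]] [x e] /AG [/= xT Ge]; split => //=; exact: Gp.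
Qed.

Lemma sub_gen_N (E : set (omega T d)) : <<s gen_N T >> E -> measurable E.
Proof. by apply: sub_smallest2r => // X GX; right. Qed.

Lemma sub_gen_B (E : set (omega T d)) : <<s gen_B T >> E -> measurable E.
Proof. by apply: sub_smallest2r => // X GX; left; right. Qed.

Lemma sub_gen_xi (E : set (omega T d)) : <<s gen_xi >> E -> measurable E.
Proof. by apply: sub_smallest2r => // X GX; left; left. Qed.

Variable Pi : {sigma_finite_measure set 'rV[R]_d -> \bar R}.
Variable P : probability (omega T d) R.
Hypothesis PRM : poisson_random_measure Pi P.
Hypothesis ind : independent_coordinates P.

(** A Poisson random measure is independent over disjoint sets, whereas the A j may
overlap. So the counts on the A j are written as sums of counts on the atoms of
the algebra that they generate, which are disjoint from each other and from C. *)
Lemma indep_jumps (C : set V) (S0 : set (\bar R)) (m : nat)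
    (A : 'I_m -> set V) (S : 'I_m -> set (\bar R)) :
  off_strip C -> measurable S0 ->
  (forall j, [/\ off_strip (A j), A j `&` C = set0 & measurable (S j)]) ->
  P ([set w | forall j, S j (coord_N w (A j))] `&` [set w | S0 (coord_N w C)]) =
  (P [set w | forall j, S j (coord_N w (A j))] * P [set w | S0 (coord_N w C)])%E.
Proof.
move=> oC mS0 hA.
pose B := {ffun 'I_m -> bool}.
(* the atoms; the intersection with the union removes the atom outside of all A j *)
pose At (b : B) : set V := (\bigcup_j A j) `&`
  \bigcap_j (if b j then A j else ~` A j).
have mAj j : measurable (A j) by have [[]] := hA j.
have mAt b : measurable (At b).
  apply: measurableI; first by apply: fin_bigcup_measurable => //; exact: finite_finset.
  apply: fin_bigcap_measurable => [|j _]; first exact: finite_finset.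
  case: (b j) => //.
  exact: measurableC.
have tAt : trivIset setT At.
  move=> b b' _ _ [x [[_ h] [_ h']]]; apply/ffunP => j.
  have := h j I; have := h' j I.
  by case: (b j); case: (b' j).
have AE j : A j = \bigcup_(b in [set b : B | b j]) At b.
  apply/seteqP; split => [x Ax|x [b /= bj [_ /(_ j I)]]]; last by rewrite bj.
  exists [ffun i => `[< A i x >]]; first by rewrite /= ffunE; exact/asboolP.
  split; first by exists j.
  by move=> i _; rewrite ffunE; case: asboolP.
have oAt b : off_strip (At b).
  split => //.
  have [k|n0] := pselect (exists j : 'I_m, True); last first.
    exists set0.
      split => //; rewrite /Defs.edist image_set0 ereal_inf0 ltry //.
    by move=> x [[j _ _] _]; case: n0; exists j.
  have hG (j : 'I_m) : exists G, off_origin G /\ A j `<=` `]0, T] `*` G.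
    by have [[_ [G oG AG]] _ _] := hA j; exists G.
  pose G j := projT1 (cid (hG j)).
  have GP j : off_origin (G j) /\ A j `<=` `]0, T] `*` G j := projT2 (cid (hG j)).
  exists (\bigcup_j G j).
    split.
    - apply: fin_bigcup_measurable => [|j _]; first exact: finite_finset.
      by have [[]] := GP j.
    - by move=> e [j _ Ge]; have [[_ + _] _] := GP j; apply.
      (* the distance to a union is the least of finitely many positive distances *)
    - have fr j : exists r : R, 0 < r /\ (r%:E <= Defs.edist 0 (G j))%E.
        have [[_ _ +] _] := GP j; case: (Defs.edist 0 (G j)) => [r| |] //.
          by rewrite lte_fin => r0; exists r; rewrite lexx.
        by move=> _; exists 1; rewrite leey.
      pose r j := projT1 (cid (fr j)).
      have rP j : 0 < r j /\ ((r j)%:E <= Defs.edist 0 (G j))%E := projT2 (cid (fr j)).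
      pose rm := \big[Num.min/1]_(j < m) r j.
      have rm0 : 0 < rm.
        rewrite /rm; elim/big_ind : _ => //; first by move=> x y x0 y0; rewrite lt_min x0.
        by move=> j _; have [] := rP j.
      apply: (@lt_le_trans _ _ rm%:E); first by rewrite lte_fin.
      apply: le_ereal_inf_tmp => _ [e [j _ Ge] <-].
      apply: (@le_trans _ _ (r j)%:E); first by rewrite lee_fin /rm; exact: bigmin_le_cond.
      have [_ h] := rP j; apply: le_trans h _.
      by apply: ereal_inf_lbound; exists e.
  move=> x [[j _ Ajx] _]; have [_ h] := GP j.
  by have [xT Gx] := h _ Ajx; split => //; exists j.
have AtC b : At b `&` C = set0.
  rewrite -subset0 => x [[[j _ Aj] _] Cx].
  have [_ h _] := hA j; suff : (A j `&` C) x by rewrite h.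
  by [].
pose E := [set w : omega T d | S0 (coord_N w C)].
have mE : measurable E.
  apply: sub_gen_N; rewrite -[X in <<s _ >> X]setTI.
  exact: (measurable_off_strip oC measurableT mS0).
pose PP : set (set (omega T d)) := [set F | exists SS : B -> set (\bar R),
  (forall b, measurable (SS b)) /\ F = [set w | forall b, SS b (coord_N w (At b))]].
have PPI : setI_closed PP.
  move=> _ _ [SS [mSS ->]] [SS' [mSS' ->]]; exists (fun b => SS b `&` SS' b).
  split; first by move=> b; exact: measurableI.
  apply/seteqP; split => w /=; first by move=> [h h'] b; split.
  by move=> h; split => b; have [] := h b.
have mPPb b (X : set (\bar R)) : measurable X ->
    measurable [set w : omega T d | X (coord_N w (At b))].
  move=> mX; apply: sub_gen_N; rewrite -[Y in <<s _ >> Y]setTI.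
  exact: (measurable_off_strip (oAt b) measurableT mX).
have PPm : PP `<=` measurable.
  move=> _ [SS [mSS ->]].
  have -> : [set w : omega T d | forall b, SS b (coord_N w (At b))] =
      \bigcap_b [set w | SS b (coord_N w (At b))].
    by apply/seteqP; split => w /= h b; [move=> _|]; exact: h.
  apply: fin_bigcap_measurable => [|b _]; first exact: finite_finset.
  exact: mPPb.
pose K := #|{: B}|.
(* C is put in front of the enumerated atoms *)
pose AA (i : 'I_K.+1) := oapp (fun k : 'I_K => At (enum_val k)) C (unlift ord0 i).
have PRM2 (SS : B -> set (\bar R)) (X : set (\bar R)) :
  (forall b, measurable (SS b)) -> measurable X ->
  P ([set w | forall b, SS b (coord_N w (At b))] `&` [set w | X (coord_N w C)]) =
  (fine (P [set w | X (coord_N w C)]) *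
   \prod_(k < K) fine (P [set w | SS (enum_val k) (coord_N w (At (enum_val k)))]))%:E.
  move=> mSS mX.
  pose CC (i : 'I_K.+1) := oapp (fun k : 'I_K => SS (enum_val k)) X (unlift ord0 i).
  have := PRM.2 K.+1 AA CC; rewrite big_ord_recl /= /AA /CC unlift_none /=.
  under eq_bigr do rewrite liftK /=.
  move=> <-.
  - congr (P _); apply/seteqP; split => w /=.
      by move=> [h1 h2] j; case: unliftP => [k _|_] /=.
    move=> h; split; last by have := h ord0; rewrite unlift_none.
    move=> b; have := h (lift ord0 (enum_rank b)).
    by rewrite liftK /= enum_rankK.
  - move=> j; case: unliftP => [k _|_] /=; split => //; try exact: off_strip_sub.
    by case: oC.
  - move=> i j _ _; case: unliftP => [k ->|->]; case: unliftP => [l ->|->] //=.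
    + by move=> /(tAt _ _ I I) /enum_val_inj ->.
    + by rewrite AtC => -[].
    + by rewrite setIC AtC => -[].
  - by move=> j; case: unliftP => [k _|_] /=.
have base F : PP F -> P (F `&` E) = (P F * P E)%E.
  move=> [SS [mSS ->]]; rewrite PRM2 //.
  have := PRM2 SS setT mSS measurableT.
  have -> : [set w : omega T d | [set: \bar R] (coord_N w C)] = setT.
    by apply/seteqP; split.
  rewrite setIT [X in fine X](probability_setT P) mul1r => ->.
  by rewrite EFinM fineK ?fin_num_measure // muleC.
apply: (indep_sigma_algebra PPI PPm mE base).
have -> : [set w : omega T d | forall j, S j (coord_N w (A j))] =
    \bigcap_j [set w | S j (coord_N w (A j))].
  by apply/seteqP; split => w /= h j; [move=> _|]; exact: h.
pose WP := g_sigma_algebraType PP.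
apply: (@fin_bigcap_measurable _ WP) => [|j _]; first exact: finite_finset.
have mN b : measurable_fun setT (fun w : WP => coord_N w (At b)).
  move=> _ X mX; rewrite setTI; apply: sub_sigma_algebra.
  exists (fun b' => if b' == b then X else setT); split.
    by move=> b'; case: ifP.
  apply/seteqP; split => w /=.
    by move=> h b'; case: eqP => // ->.
  by move=> /(_ b); rewrite eqxx.
have NE (w : omega T d) : coord_N w (A j) = (\sum_(b <- finmap.enum_fset (fset_set [set b : B | b j])) coord_N w (At b))%E.
  rewrite AE measure_fin_bigcup //; last exact: sub_trivIset tAt.
    by rewrite fsbig_finite //=; exact: finite_finset.
  exact: finite_finset.
have [_ _ mS] := hA j.
have mj : measurable_fun setT (fun w : WP => coord_N w (A j)).
  by under eq_fun do rewrite NE; apply: emeasurable_sum.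
by rewrite -[X in measurable X]setTI; exact: mj.
Qed.

End SingleCell.

Section SingleCellSigma.
Context {R : realType} {T : R} {d : nat}.
Local Notation V := (R * 'rV[R]_d)%type.
Implicit Types (A C : set V).
Hypothesis T0 : 0 <= T.

Lemma off_strip_jumps_measurable A (S : set (\bar R)) : off_strip (T := T) A ->
  measurable S -> <<s gen_N T >> [set w : omega T d | S (coord_N w A)].
Proof.
move=> oA mS; rewrite -[X in <<s _ >> X]setTI.
exact: (measurable_off_strip T0 oA measurableT mS).
Qed.

Lemma gen_off_measurable C (B : set (omega T d)) :
  <<s gen_off C >> B -> measurable B.
Proof.
apply: smallest_sub; first exact: (@sigma_algebra_measurable _ (omega T d)).
move=> E [[GE|GE]|[A [S [oA _ mS ->]]]].
- by apply: sub_gen_xi; exact: sub_sigma_algebra.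
- by apply: sub_gen_B; exact: sub_sigma_algebra.
- by apply: sub_gen_N; exact: off_strip_jumps_measurable.
Qed.

Variable Pi : {sigma_finite_measure set 'rV[R]_d -> \bar R}.
Variable P : probability (omega T d) R.
Hypothesis PRM : poisson_random_measure Pi P.
Hypothesis ind : independent_coordinates P.

(** Intersections of an event of xi, an event of B and an event of finitely many jump
counts form a pi-system that generates gen_off C; on it the claim is the mutual
independence of the three coordinates together with indep_jumps. *)
Lemma gen_off_indep C (S0 : set (\bar R)) (B : set (omega T d)) :
  off_strip (T := T) C -> measurable S0 -> <<s gen_off C >> B ->
  P (B `&` [set w | S0 (coord_N w C)]) =
  (P B * P [set w | S0 (coord_N w C)])%E.
Proof.
move=> oC mS0 sB.
pose ev m (A : 'I_m -> set V) (S : 'I_m -> set (\bar R)) :=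
  [set w : omega T d | forall j, S j (coord_N w (A j))].
pose QQ : set (set (omega T d)) := [set F | exists E1 E2 (m : nat) (A : 'I_m -> set V) (S : 'I_m -> set (\bar R)),
  [/\ <<s gen_xi >> E1, <<s gen_B T >> E2,
    (forall j, [/\ off_strip (T := T) (A j), A j `&` C = set0 & measurable (S j)]) &
    F = E1 `&` E2 `&` ev m A S]].
have evN m (A : 'I_m -> set V) (S : 'I_m -> set (\bar R)) : (forall j, [/\ off_strip (T := T) (A j), A j `&` C = set0 & measurable (S j)]) ->
    <<s gen_N T >> (ev m A S).
  move=> h.
  have -> : ev m A S = \bigcap_j [set w | S j (coord_N w (A j))].
    by apply/seteqP; split => w /= k j; [move=> _|]; exact: k.
  apply: (@fin_bigcap_measurable _ (g_sigma_algebraType (@gen_N R T d T))) => [|j _].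
    exact: finite_finset.
  by have [oA _ mS] := h j; exact: off_strip_jumps_measurable.
have QQI : setI_closed QQ.
  move=> _ _ [E1 [E2 [m [A [S [h1 h2 h3 ->]]]]]] [E1' [E2' [m' [A' [S' [h1' h2' h3' ->]]]]]].
  exists (E1 `&` E1'), (E2 `&` E2'), (m + m')%N.
  exists (fun j => match fintype.split j with inl i => A i | inr i => A' i end).
  exists (fun j => match fintype.split j with inl i => S i | inr i => S' i end).
  split.
  - exact: (@measurableI _ (g_sigma_algebraType (@gen_xi R T d))).
  - exact: (@measurableI _ (g_sigma_algebraType (@gen_B R T d T))).
  - by move=> j; case: (fintype.split j).
  rewrite setIACA [X in X `&` _]setIACA; congr (_ `&` _).
  apply/seteqP; split => w /=.
    by move=> [h h'] j; case: (fintype.split j).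
  move=> h; split => j.
    have := h (lshift m' j).
    by rewrite -[lshift m' j]/(unsplit (inl j)) unsplitK.
  have := h (rshift m j).
  by rewrite -[rshift m j]/(unsplit (inr j)) unsplitK.
have QQm : QQ `<=` measurable.
  move=> _ [E1 [E2 [m [A [S [h1 h2 h3 ->]]]]]].
  apply: measurableI; last by apply: sub_gen_N; exact: evN.
  by apply: measurableI; [exact: sub_gen_xi|exact: sub_gen_B].
have mE : <<s gen_N T >> [set w : omega T d | S0 (coord_N w C)].
  exact: off_strip_jumps_measurable.
have base F : QQ F -> P (F `&` [set w | S0 (coord_N w C)]) =
    (P F * P [set w | S0 (coord_N w C)])%E.
  move=> [E1 [E2 [m [A [S [h1 h2 h3 ->]]]]]].
  rewrite -setIA ind //; last first.
    apply: (@measurableI _ (g_sigma_algebraType (@gen_N R T d T))) => //; exact: evN.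
  rewrite (indep_jumps T0 PRM) // ind //; last exact: evN.
  by rewrite muleA.
apply: (indep_sigma_algebra QQI QQm (sub_gen_N mE) base).
apply: (sub_smallest2r _ _ sB); first exact: smallest_sigma_algebra.
have nil0 (E : set (omega T d)) : E = E `&` ev 0%N (fun=> set0) (fun=> set0).
  by apply/seteqP; split => w //= => [h|[]//]; split => // -[].
have sT (G : set (set (omega T d))) : <<s G >> setT.
  exact: (@measurableT _ (g_sigma_algebraType G)).
move=> E [[GE|GE]|[A [S [oA AC mS ->]]]].
- exists E, setT, 0%N, (fun=> set0), (fun=> set0); split => //.
  + exact: sub_sigma_algebra.
  + by case.
  + by rewrite setIT; exact: nil0.
- exists setT, E, 0%N, (fun=> set0), (fun=> set0); split => //.
  + exact: sub_sigma_algebra.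
  + by case.
  + by rewrite setTI; exact: nil0.
- exists setT, setT, 1%N, (fun=> A), (fun=> S); split => //.
  rewrite setTI setTI; apply/seteqP; split => w /=; first by move=> h _.
  by move=> h; exact: (h ord0).
Qed.

(** After T the path is at rest and there are no jumps, so that nothing is learnt. *)
Lemma raw_filtration_sub (u : R) (B : set (omega T d)) :
  raw_filtration u B -> measurable B.
Proof.
move: B; apply: smallest_sub; first exact: (@sigma_algebra_measurable _ (omega T d)).
have gT E : (gen_xi `|` gen_B T `|` gen_N T : set (set (omega T d))) E -> measurable E.
  by move=> h; apply: sub_sigma_algebra.
move=> E [[GE|[s [S [/andP[s0 su] mS] ->]]]|[s [G [S [/andP[s0 su] oG mS] ->]]]].
- by apply: gT; left; left.
- have [sT|Ts] := leP s T.
    by apply: gT; left; right; exists s, S => //; rewrite s0.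
  have e (w : omega T d) : coord_B w s = 0 by apply: (path_outside (coord_B w)) => /andP[_ h]; have := lt_le_trans Ts h; rewrite ltxx.
  have [S0|S0] := pselect (S 0).
    rewrite (_ : _ @^-1` _ = setT); first exact: measurableT.
    by apply/seteqP; split => w //= _; rewrite e.
  rewrite (_ : _ @^-1` _ = set0); first exact: measurable0.
  by apply/seteqP; split => w //=; rewrite e.
- have [sT|Ts] := leP s T.
    by apply: gT; right; exists s, G, S => //; rewrite s0.
  apply: gT; right; exists T, G, S; first by rewrite T0 lexx.
  have [mG _ _] := oG.
  apply/funext => w /=; congr S.
  have -> : `]0, s] `*` G = (`]0, T] `*` G) `|` (`]T, s] `*` G) :> set (R * 'rV[R]_d).
    apply/seteqP; split => -[x e] /=; rewrite !in_itv /=.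
      move=> [/andP[x0 xs] Ge]; have [xT|Tx] := leP x T; first by left; rewrite x0.
      by right; split => //; rewrite xs.
    move=> [[/andP[x0 xT] Ge]|[/andP[Tx xs] Ge]]; split => //.
      by rewrite x0 (le_trans xT (ltW Ts)).
    by rewrite xs (le_lt_trans T0 Tx).
  rewrite measureU0 //; [exact: measurable_strip|exact: measurable_strip|].
  apply/eqP; rewrite -measure_le0 -(jumps_support (coord_N w)); apply: le_measure.
  - by rewrite inE; exact: measurable_strip.
  - rewrite inE; apply: measurableC; apply: measurableX => //.
    rewrite (_ : punctured = ~` [set 0]); last by apply/seteqP; split => x /= /eqP.
    apply: open_measurable_rV; rewrite openC.
    exact/accessible_closed_set1/hausdorff_accessible/norm_hausdorff.
  - move=> [x e] [/=]; rewrite in_itv /= => /andP[Tx _] _ [/=].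
    by rewrite in_itv /= => /andP[_ /(lt_le_trans Tx)]; rewrite ltxx.
Qed.

(** The past of u does not see the jumps after u. *)
Lemma raw_filtration_gen_off (u : R) C (B : set (omega T d)) :
  u <= T -> C `<=` [set x | u < x.1] ->
  raw_filtration u B -> <<s gen_off C >> B.
Proof.
move=> uT Cu; apply: smallest_sub; first exact: smallest_sigma_algebra.
move=> E [[GE|[s [S [/andP[s0 su] mS] ->]]]|[s [G [S [/andP[s0 su] oG mS] ->]]]];
    apply: sub_sigma_algebra; rewrite /gen_off /setU /mkset.
- by left; left.
- by left; right; exists s, S => //; rewrite s0 (le_trans su uT).
- right; exists (`]0, s] `*` G), S; have [mG _ _] := oG; split => //.
  + split; first exact: measurable_strip.
    exists G => // -[x e] /= []; rewrite !in_itv /= => /andP[-> xs] Ge; split => //.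
    by rewrite (le_trans xs) // (le_trans su).
  + apply/seteqP; split => // -[x e] [[/= + _] /Cu /=].
    by rewrite in_itv /= => /andP[_ xs]; rewrite ltNge (le_trans xs su).
Qed.

Lemma measurable_jumps_gen_off A C : off_strip (T := T) A -> A `&` C = set0 ->
  measurable_fun setT (fun w : g_sigma_algebraType (@gen_off R T d C) => fine (coord_N w A)).
Proof.
move=> oA AC; apply: measurableT_comp; first exact: fine_measurable.
move=> _ S mS; rewrite setTI; apply: sub_sigma_algebra; rewrite /gen_off /setU /mkset; right.
by exists A, S.
Qed.

Lemma measurable_path_gen_off (t : R) (k : 'I_d) C : 0 <= t <= T ->
  measurable_fun setT (fun w : g_sigma_algebraType (@gen_off R T d C) => coord_B w t 0 k).
Proof.
move=> tT; apply: (measurableT_comp (@measurable_coord R d k)).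
move=> _ S mS; rewrite setTI; apply: sub_sigma_algebra; rewrite /gen_off /setU /mkset; left; right.
by exists t, S.
Qed.

Lemma measurable_xi_gen_off (k : 'I_d) C :
  measurable_fun setT (fun w : g_sigma_algebraType (@gen_off R T d C) => coord_xi w 0 k).
Proof.
apply: (measurableT_comp (@measurable_coord R d k)).
move=> _ S mS; rewrite setTI; apply: sub_sigma_algebra; rewrite /gen_off /setU /mkset; left; left.
by exists S.
Qed.

Lemma independent_of_gen_off (t : R) C : off_strip (T := T) C ->
  independent_of P (gen_off C) (fun w => t * fine (coord_N w C)).
Proof.
move=> oC B S sB mS.
have m : measurable_fun setT (fun x : \bar R => t * fine x).
  by apply: measurable_funM => //; exact: fine_measurable.
apply: (@gen_off_indep C ((fun x => t * fine x) @^-1` S)) => //.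
by rewrite -[X in measurable X]setTI; exact: m.
Qed.

End SingleCellSigma.

(** * Completion and augmentation *)

Section Completion.
Context {dW : measure_display} {W : measurableType dW} {R : realType}.
Variable P : probability W R.

Lemma completionE (A : set W) : measurable A -> completion P A = P A.
Proof. by move=> mA; rewrite /completed_measure_extension measurable_mu_extE. Qed.

Let completion_setT : completion P setT = 1%E.
Proof. by rewrite [LHS]completionE // probability_setT. Qed.

HB.instance Definition _ :=
  Measure_isProbability.Build _ _ _ (completion P) completion_setT.

End Completion.

Notation completed P := (caratheodory_type (mu_ext P)).

Section CompletionTheory.
Context {dW : measure_display} {W : measurableType dW} {R : realType}.
Variable P : probability W R.
Local Notation Wc := (completed P).


Lemma completed_measurable (A : set W) : measurable A -> measurable (A : set Wc).
Proof. exact: caratheodory_measurable_mu_ext. Qed.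

Lemma completed_negligible (D : set W) : P.-negligible D ->
  measurable (D : set Wc) /\ completion P D = 0%E.
Proof.
move=> [A [mA PA DA]].
have c0 : completion P A = 0%E by rewrite completionE.
have mD : measurable (D : set Wc).
  apply: (@measure_is_complete_caratheodory R W (mu_ext P)).
  by exists A; split => //; exact: completed_measurable.
split => //; apply/eqP; rewrite eq_le measure_ge0 andbT -c0.
by apply: le_measure => //; rewrite inE //; exact: completed_measurable.
Qed.

(** The outer measure of D is 0, so D is covered by measurable sets of arbitrarily
small probability, and their intersection is null. *)
Lemma completion0_negligible (D : set W) : completion P D = 0%E -> P.-negligible D.
Proof.
move=> D0.
have cov (n : nat) : exists A : set W, [/\ measurable A, D `<=` A & (P A <= (n.+1%:R^-1)%:E)%E].
  have : (completion P D < (n.+1%:R^-1)%:E)%E by rewrite D0 lte_fin invr_gt0 ltr0n.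
  move=> /ereal_inf_lt [_ [F [mF DF] <-] h].
  exists (\bigcup_k F k); split => //; first exact: bigcup_measurable.
  apply: le_trans (ltW h); apply: measure_sigma_subadditive => //.
  exact: bigcup_measurable.
pose A n := projT1 (cid (cov n)).
have AP n : [/\ measurable (A n), D `<=` A n & (P (A n) <= (n.+1%:R^-1)%:E)%E] :=
  projT2 (cid (cov n)).
have mA : measurable (\bigcap_n A n) by apply: bigcapT_measurable => n; have [] := AP n.
exists (\bigcap_n A n); split => //; last by move=> x Dx n _; have [_ + _] := AP n; apply.
apply/eqP; rewrite eq_le measure_ge0 andbT.
apply/lee_addgt0Pr => e e0; rewrite add0e.
have [_ _ h] := AP (Num.truncn e^-1).
apply: (@le_trans _ _ (P (A (Num.truncn e^-1)))).
  apply: le_measure; rewrite ?inE //; first by have [] := AP (Num.truncn e^-1).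
  by move=> x; apply.
apply: le_trans h _; rewrite lee_fin -[leRHS]invrK lef_pV2 ?posrE ?invr_gt0 ?ltr0n //.
exact/ltW/truncnS_gt.
Qed.

Lemma completed_ae (p : W -> Prop) : {ae P, forall w, p w} ->
  {ae completion P, forall w, p w}.
Proof.
move=> h; have [mD D0] := completed_negligible h.
by exists [set w | ~ p w]; split.
Qed.

(** The sets with such an approximation form a sigma-algebra. *)
Lemma augmented_approx (F : set (set W)) (A : set W) :
  sigma_algebra setT F ->
  <<s F `|` [set D | P.-negligible D] >> A ->
  exists2 B, F B & P.-negligible ((A `\` B) `|` (B `\` A)).
Proof.
move=> sF; move: A.
apply: smallest_sub; last first.
  move=> A [FA|/= nA]; first by exists A => //; rewrite setDv setU0; exact: negligible_set0.
  exists set0; first by case: sF.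
  by rewrite setD0 set0D setU0.
split.
- exists set0; first by case: sF.
  by rewrite setDv setU0; exact: negligible_set0.
- move=> A [B FB nAB]; exists (setT `\` B); first by case: sF => _ + _; apply.
  apply: negligibleS nAB => x /= [[[_ nA] nB]|[[_ nB] nA]].
    by right; split => //; apply: contrapT => nB'; apply: nB.
  by left; split => //; apply: contrapT => nA'; apply: nA.
- move=> A h.
  pose B n := projT1 (cid2 (h n)).
  have [FB nB] : (forall n, F (B n)) /\ forall n, P.-negligible ((A n `\` B n) `|` (B n `\` A n)).
    by split => n; rewrite /B; case: (cid2 (h n)).
  exists (\bigcup_k B k); first by case: sF => _ _; apply.
  apply: negligibleS (negligible_bigcup nB) => x [[[k _ Ax] nBx]|[[k _ Bx] nAx]].
    by exists k => //; left; split => // Bx; apply: nBx; exists k.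
  by exists k => //; right; split => // Ax; apply: nAx; exists k.
Qed.

Lemma augmented_measurable (F : set (set W)) (A : set W) :
  F `<=` measurable ->
  <<s F `|` [set D | P.-negligible D] >> A -> measurable (A : set Wc).
Proof.
move=> Fm; move: A; apply: smallest_sub; first exact: sigma_algebra_measurable.
move=> A [FA|/= nA]; first by apply: completed_measurable; exact: Fm.
by have [] := completed_negligible nA.
Qed.


Lemma completed_measurable_fun dS (S : measurableType dS) (f : W -> S) :
  measurable_fun setT f -> measurable_fun setT (f : Wc -> S).
Proof.
move=> mf _ C mC; rewrite setTI; apply: completed_measurable.
by rewrite -[X in measurable X]setTI; exact: mf.
Qed.

End CompletionTheory.

Section AugmentedMeasurability.
Context {R : realType} {T : R} {d : nat}.
Hypothesis T0 : 0 <= T.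

Variable P : probability (omega T d) R.

(** Null sets are measurable for the completed measure. *)
Lemma FP_measurable (t : R) (A : set (omega T d)) : FP P t A ->
  measurable (A : set (completed P)).
Proof.
move=> FA; have := FA (t + 1); rewrite ltrDl ltr01 => /(_ isT).
by apply: augmented_measurable => C; exact: raw_filtration_sub.
Qed.

Lemma adapted_measurable_fun dS (S : measurableType dS) (Y : R -> omega T d -> S) (t : R) :
  adapted T (FP P) Y -> 0 <= t <= T -> measurable_fun setT (Y t : completed P -> S).
Proof.
by move=> aY tT _ C mC; rewrite setTI; exact: FP_measurable (aY t tT C mC).
Qed.

Lemma FP_sigma_algebra t : sigma_algebra setT (FP P t).
Proof.
split.
- by move=> u _; have [] := smallest_sigma_algebra setT
    (raw_filtration u `|` [set D | P.-negligible D]).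
- move=> A hA u tu; have [_ hC _] := smallest_sigma_algebra setT
    (raw_filtration u `|` [set D | P.-negligible D]).
  by apply: hC; exact: hA.
- move=> A hA u tu; have [_ _ hU] := smallest_sigma_algebra setT
    (raw_filtration u `|` [set D | P.-negligible D]).
  by apply: hU => i; exact: hA.
Qed.

Lemma FP_monotone s t A : s <= t -> FP P s A -> FP P t A.
Proof. by move=> st hA u tu; apply: hA; exact: le_lt_trans tu. Qed.

Lemma FP_generated t (A : set (omega T d)) :
  measurable (A : set (g_sigma_algebraType (FP P t))) -> FP P t A.
Proof. by move: A; apply: smallest_sub; [exact: FP_sigma_algebra|]. Qed.

End AugmentedMeasurability.

(** * The truncated stable Levy measure *)

Section PowerIntegral.
Variable R : realType.
Local Notation leb := (@lebesgue_measure R).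

Let dy (n : nat) : set R := [set z | 2^-1 ^+ n.+1 < `|z| <= 2^-1 ^+ n].

Lemma measurable_norm_itv (a b : R) : measurable [set z : R | a < `|z| <= b].
Proof.
rewrite (_ : [set z : R | a < `|z| <= b] = Num.norm @^-1` `]a, b]%classic); last first.
  by apply/seteqP; split => z /=; rewrite in_itv.
by rewrite -[X in measurable X]setTI; exact: normr_measurable.
Qed.

Lemma measurable_norm_powR (b : R) : measurable_fun setT (fun z : R => `|z| `^ b).
Proof.
by apply: (measurableT_comp (measurable_powR b)); exact: normr_measurable.
Qed.

(** On the dyadic shell 2^-(n+1) < |z| <= 2^-n the integral is at most a constant times
2^-(a n), and the geometric series converges. *)
Lemma norm_powR_integral_lty (a : R) : 0 < a -> a <= 1 ->
  (\int[leb]_(z in [set z : R | (0 < `|z| <= 1)%R]) (`|z| `^ (a - 1))%:E < +oo)%E.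
Proof.
move=> a0 a1.
have h0 n : 0 < 2^-1 ^+ n :> R by rewrite exprn_gt0 // invr_gt0.
have dyE : [set z : R | 0 < `|z| <= 1] = \bigcup_n dy n.
  apply/seteqP; split => z /=; last first.
    move=> [n _ /andP[z1 z2]]; rewrite (lt_trans _ z1) ?h0 //= (le_trans z2) //.
    by rewrite exprn_ile1 // invf_le1 // ler1n.
  move=> /andP[z0 z1].
  have [n hn] : exists n, 2^-1 ^+ n.+1 < `|z|.
    have : geometric 1 (2^-1 : R) @ \oo --> 0.
      by apply: cvg_geometric; rewrite ger0_norm // invf_lt1 // ltr1n.
    move=> /cvgrPdist_lt /(_ _ z0) [N _ hN]; exists N.
    have := hN N.+1 (leqnSn _).
    by rewrite /= mul1r sub0r normrN ger0_norm // ltW.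
  (* the shell of z is given by the least such n *)
  have := @ex_minnP (fun n => 2^-1 ^+ n.+1 < `|z|) (ex_intro _ n hn).
  case=> m hm mmin; exists m => //; rewrite /dy /= hm /=.
  case: m hm mmin => [|m] hm mmin; first by rewrite expr0.
  by rewrite leNgt; apply/negP => /mmin; rewrite ltnn.
have mdy n : measurable (dy n) by exact: measurable_norm_itv.
have tdy : trivIset setT dy.
  have aux m n z : (m < n)%N -> dy m z -> dy n z -> False.
    move=> mn /andP[z1 _] /andP[_ z2].
    have := lt_le_trans z1 z2; rewrite ltNge => /negP; apply.
    by rewrite ler_wiXn2l // invf_le1 // ler1n.
  move=> m n _ _ [z [zm zn]]; case: (ltngtP m n) => // mn; exfalso.
    exact: aux mn zm zn.
  exact: aux mn zn zm.
have mpow (D : set R) : measurable_fun D (fun z : R => (`|z| `^ (a - 1))%:E).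
  by apply: measurable_funTS; apply/measurable_EFinP; exact: measurable_norm_powR.
have pow0 (z : R) : (0 <= (`|z| `^ (a - 1))%:E)%E by rewrite lee_fin powR_ge0.
rewrite dyE ge0_integral_bigcup; [|exact: mdy|exact: mpow|by move=> *; exact: pow0|exact: tdy].
pose r : R := 2^-1 `^ a.
have r0 : 0 <= r by exact: powR_ge0.
have r1 : r < 1.
  apply: (@lt_le_trans _ _ (1 `^ a)); last by rewrite powR1.
  by rewrite gt0_ltr_powR // ?nnegrE // invf_lt1 // ltr1n.
(* length 2 * 2^-n of the shell times the largest value of the integrand on it *)
pose C : R := 2 * 2^-1 `^ (a - 1).
have C0 : 0 <= C by rewrite mulr_ge0 // powR_ge0.
have dyle n : (\int[leb]_(z in dy n) (`|z| `^ (a - 1))%:E <= (C * r ^+ n)%:E)%E.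
  apply: (@le_trans _ _ (\int[leb]_(z in dy n) (cst ((2^-1 ^+ n.+1) `^ (a - 1))%:E z))%E).
    apply: ge0_le_integral => //; [exact: mdy|exact: mpow|].
    move=> z /andP[z1 _]; rewrite lee_fin.
    have zp : 0 < `|z| by apply: lt_trans z1.
    rewrite -opprB !powRN lef_pV2 ?posrE ?powR_gt0 //.
    by apply: ge0_ler_powR; rewrite ?subr_ge0 ?nnegrE ?(ltW z1) // ltW.
  rewrite integral_cst; last exact: mdy.
  apply: (@le_trans _ _ (((2^-1 ^+ n.+1) `^ (a - 1))%:E * (2 * 2^-1 ^+ n)%:E)%E).
    apply: lee_wpmul2l; first by rewrite lee_fin powR_ge0.
    apply: (@le_trans _ _ (leb `[- 2^-1 ^+ n, 2^-1 ^+ n]%classic)).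
      apply: le_measure; rewrite ?inE //; first exact: mdy.
      by move=> z /andP[_]; rewrite ler_norml /= in_itv.
    rewrite lebesgue_measure_itv /= lte_fin.
    by rewrite -EFinD opprK; case: ifP => _; rewrite lee_fin ?mulr_ge0 // ?(ltW (h0 n)) //; lra.
  rewrite -EFinM lee_fin /C /r exprS powRM ?invr_ge0 ?exprn_ge0 ?(ltW (h0 n)) //.
  suff -> : (2^-1 `^ a) ^+ n = (2^-1 ^+ n) `^ (a - 1) * 2^-1 ^+ n :> R.
    by rewrite le_eqVlt; apply/orP; left; apply/eqP; ring.
  rewrite -[in RHS]powR_mulrn ?invr_ge0 // -[LHS]powR_mulrn ?powR_ge0 //.
  rewrite -!powRrM -powRD; last by rewrite invr_eq0 pnatr_eq0 implybT.
  by congr (_ `^ _); ring.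
apply: (@le_lt_trans _ _ (C * (1 - r)^-1)%:E); last by rewrite ltry.
apply: lime_le; first by apply: is_cvg_nneseries => n _ _; apply: integral_ge0 => z _; rewrite lee_fin powR_ge0.
apply: nearW => n; apply: (@le_trans _ _ (\sum_(0 <= k < n) (C * r ^+ k)%:E)%E).
  by apply: lee_sum => k _; exact: dyle.
rewrite sumEFin lee_fin.
have -> : \sum_(0 <= k < n) C * r ^+ k = series (geometric C r) n by [].
rewrite geometric_seriesE ?lt_eqF // ler_wpM2r ?invr_ge0 ?subr_ge0 ?(ltW r1) //.
by rewrite ler_piMr // gerBl exprn_ge0.
Qed.

End PowerIntegral.

Section Quantizer.
Variable R : realType.
Implicit Types (x y eta : R) (K : nat).

Definition level eta i : set R := [set y | i.+1%:R * eta <= y < i.+2%:R * eta].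

(** For 0 <= y < (K + 1) eta this is eta times the integer part of y / eta. In
particular it vanishes near 0, so that only finitely many jumps matter. *)
Definition quantp eta K y : R := \sum_(i < K) i.+1%:R * eta * \1_(level eta i) y.

Lemma quantp_le0 eta K y : 0 < eta -> y < eta -> quantp eta K y = 0.
Proof.
move=> e0 ye; apply: big1 => i _; rewrite indicE memNset ?mulr0 // /level /= => /andP[h _].
suff : eta <= y by rewrite leNgt ye.
by apply: le_trans h; rewrite ler_peMl ?(ltW e0) // ler1n.
Qed.

Lemma quantp_bound eta K y : 0 < eta -> 0 <= y -> y < K.+1%:R * eta ->
  0 <= y - quantp eta K y /\ y - quantp eta K y <= eta /\ 0 <= quantp eta K y.
Proof.
move=> e0 y0 yK.
have [ye|ey] := ltP y eta; first by rewrite quantp_le0 // subr0 (ltW ye).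
have ye0 : 0 <= y / eta by rewrite divr_ge0 // ltW.
have /andP[] := Num.Theory.truncn_itv ye0; set m := Num.truncn _.
rewrite ler_pdivlMr // ltr_pdivrMr // => h1 h2.
have m0 : (0 < m)%N.
  by rewrite truncn_gt0 ler_pdivlMr // mul1r.
have mK : (m.-1 < K)%N.
  rewrite -ltnS prednK // -(ltr_nat R).
  by rewrite -(ltr_pM2r e0) (le_lt_trans h1).
have -> : quantp eta K y = m%:R * eta.
  rewrite /quantp (bigD1 (Ordinal mK)) //= prednK // indicE mem_set; last first.
    by rewrite /level /= prednK // h1.
  rewrite mulr1 big1 ?addr0 // => i im; rewrite indicE memNset ?mulr0 //.
  rewrite /level /= => /andP[k1 k2]; move/negP: im; apply; apply/eqP/val_inj => /=.
  have : (i.+1 < m.+1)%N by rewrite -(ltr_nat R) -(ltr_pM2r e0) (le_lt_trans k1).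
  have : (m < i.+2)%N by rewrite -(ltr_nat R) -(ltr_pM2r e0) (le_lt_trans h1).
  rewrite ltnS ltnS => a b; apply/eqP; rewrite -eqSS prednK //; apply/eqP.
  by apply/eqP; rewrite eqn_leq a b.
split; first by rewrite subr_ge0.
split; last by rewrite mulr_ge0 // ltW.
by rewrite lerBlDl (le_trans (ltW h2)) // -natr1 mulrDl mul1r.
Qed.

Definition quant eta K x : R := quantp eta K x - quantp eta K (- x).

Lemma quant_bound eta K x : 0 < eta -> `|x| < K.+1%:R * eta ->
  `|quant eta K x - x| <= eta /\ `|quant eta K x - x| <= `|x|.
Proof.
move=> e0; wlog x0 : x / 0 <= x.
  move=> h xK; have [x0|x0] := leP 0 x; first exact: h.
  have -> : quant eta K x - x = - (quant eta K (- x) - (- x)).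
    by rewrite /quant opprK; ring.
  rewrite normrN -(normrN x); apply: h; first by rewrite oppr_ge0 ltW.
  by rewrite normrN.
rewrite ger0_norm // => xK.
rewrite /quant (@quantp_le0 _ _ (- x)) //; last by rewrite (le_lt_trans _ e0) // oppr_le0.
rewrite subr0 distrC; have [h1 [h2 h3]] := quantp_bound e0 x0 xK.
by rewrite ger0_norm //; split => //; rewrite gerBl.
Qed.

Lemma measurable_level eta i : measurable (level eta i).
Proof.
rewrite (_ : level eta i = `[i.+1%:R * eta, i.+2%:R * eta[%classic) //.
Qed.

Lemma measurable_quantp eta K : measurable_fun setT (quantp eta K).
Proof.
apply: measurable_sum => i; apply: measurable_funM => //.
by apply: measurable_indic; exact: measurable_level.
Qed.

Lemma measurable_quant eta K : measurable_fun setT (quant eta K).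
Proof.
apply: measurable_funB; first exact: measurable_quantp.
by apply: measurableT_comp; [exact: measurable_quantp|exact: oppr_measurable].
Qed.

(** Interpolation between the bounds eta and |x| of the error: part of the power of
|x| is kept, to be integrable against the Levy measure near 0. *)
Lemma quant_sqr_bound eta K x a : 0 < eta -> `|x| < K.+1%:R * eta ->
  0 < a -> a <= 1 ->
  (quant eta K x - x) ^+ 2 <= eta `^ a * `|x| `^ (2 - a).
Proof.
move=> e0 xK a0 a1; have [] := quant_bound e0 xK.
rewrite -[(_ - _) ^+ 2]real_normK ?num_real //.
set D := `|_ - _| => h1 h2.
have D0 : 0 <= D by exact: normr_ge0.
have -> : D ^+ 2 = D `^ a * D `^ (2 - a).
  rewrite -powRD; last by apply/implyP => /eqP; lra.
  by rewrite addrC subrK powR_mulrn.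
apply: ler_pM; rewrite ?powR_ge0 //.
  by apply: ge0_ler_powR; rewrite ?nnegrE // ltW.
by apply: ge0_ler_powR; rewrite ?nnegrE //; lra.
Qed.

End Quantizer.

Section LevyMeasure.
Context {R : realType} {d : nat}.
Variables (upsilon : R) (c : 'I_d -> R).
Variable Pi : {sigma_finite_measure set 'rV[R]_d -> \bar R}.
Hypothesis ub : 1 < upsilon < 2.
Hypothesis c0 : forall j, 0 < c j.
Hypothesis Pi_stable : truncated_stable upsilon c Pi.
Variable k : 'I_d.
Local Notation leb := (@lebesgue_measure R).
Let D1 : set R := [set z : R | 0 < `|z| <= 1].

(** Pi lives on the coordinate axes, and on the axes other than the k-th one the
integrand takes the value g 0 = 0. *)
Lemma levy_coord_integral (g : R -> R) : measurable_fun setT g ->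
  (forall x, 0 <= g x) -> g 0 = 0 ->
  (\int[Pi]_e (g (e 0 k))%:E =
   (c k)%:E * \int[leb]_(z in D1) (g z * `|z| `^ (- 1 - upsilon))%:E)%E.
Proof.
move=> mg g0 g00; rewrite Pi_stable; last 2 first.
- apply/measurable_EFinP; apply: measurableT_comp => //; exact: measurable_coord.
- by move=> e; rewrite lee_fin.
rewrite (bigD1 k) //= big1 ?adde0.
  by congr (_ * _)%E; apply: eq_integral => z _; rewrite !mxE !eqxx mulr1.
move=> j jk; rewrite (_ : (\int[leb]_(z in _) _ = 0)%E) ?mule0 //.
apply: integral0_eq => z _.
by rewrite !mxE eqxx /= eq_sym (negbTE jk) mulr0 g00 mul0e.
Qed.

Let mD1 : measurable D1.
Proof. exact: measurable_norm_itv. Qed.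

Lemma measurable_levy_integrand (D : set R) (g : R -> R) : measurable_fun setT g ->
  measurable_fun D (fun z : R => (g z * `|z| `^ (- 1 - upsilon))%:E).
Proof.
move=> mg; apply/measurable_EFinP; apply: measurable_funTS.
by apply: measurable_funM => //; exact: measurable_norm_powR.
Qed.

Lemma measurable_level_signed eta (s : bool) i :
  measurable_fun setT (fun z : R => \1_(level eta i) ((-1) ^+ s * z) : R).
Proof.
apply: measurableT_comp; first by apply: measurable_indic; exact: measurable_level.
exact: measurable_funM.
Qed.

(** The jumps whose k-th coordinate has sign (-1)^p.1 and modulus in the p.2-th level. *)
Definition cell (eta : R) (p : bool * nat) : set 'rV[R]_d :=
  [set e | level eta p.2 ((-1) ^+ p.1 * e 0 k)].

Lemma measurable_cell eta p : measurable (cell eta p).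
Proof.
rewrite (_ : cell eta p = (fun e : 'rV[R]_d => (-1) ^+ p.1 * e 0 k) @^-1` level eta p.2) //.
rewrite -[X in measurable X]setTI.
have mf : measurable_fun setT (fun e : 'rV[R]_d => (-1) ^+ p.1 * e 0 k).
  by apply: measurable_funM => //; exact: measurable_coord.
exact: (mf measurableT _ (measurable_level _ _)).
Qed.

Lemma cell_off_origin eta p : 0 < eta -> off_origin (cell eta p).
Proof.
move=> e0.
have h e : cell eta p e -> eta <= enorm e.
  rewrite /cell /level /= => /andP[h _]; apply: le_trans (coord_le_enorm e k).
  apply: le_trans (le_trans _ (ler_norm ((-1) ^+ p.1 * e 0 k))) _; last by rewrite normrMsign.
  by apply: le_trans h; rewrite ler_peMl ?(ltW e0) // ler1n.
have n0 : enorm (0 : 'rV[R]_d) = 0.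
  by rewrite /enorm /dot big1 ?sqrtr0 // => i _; rewrite !mxE mulr0.
split; first exact: measurable_cell.
  move=> e /h; rewrite /punctured /=; apply: contraTneq => ->.
  by rewrite n0 -ltNge.
apply: (@lt_le_trans _ _ eta%:E); first by rewrite lte_fin.
apply: le_ereal_inf_tmp => _ [e Ge <-]; rewrite lee_fin.
apply: le_trans (h _ Ge) _.
rewrite le_eqVlt; apply/orP; left; apply/eqP.
by rewrite /enorm /dot; congr Num.sqrt; apply: eq_bigr => i _; rewrite sub0r !mxE mulrNN.
Qed.

Lemma cell_disjoint eta p p' : 0 < eta -> p != p' -> cell eta p `&` cell eta p' = set0.
Proof.
move=> e0; rewrite -subset0; case: p => s i; case: p' => s' i' ne e [].
rewrite /cell /level /= => /andP[h1 h2] /andP[h3 h4].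
have p1 n : 0 < n.+1%:R * eta by rewrite mulr_gt0.
have [ss|ss] := eqVneq s s'; last first.
  have : (-1) ^+ s * e 0 k = - ((-1) ^+ s' * e 0 k).
    by move: ss; case: s h1 h2 {ne}; case: s' h3 h4 => //= *; rewrite !(expr0, expr1); ring.
  have := p1 i; have := p1 i'; lra.
subst s'; have : i != i' by apply: contraNneq ne => ->.
move=> /eqP; apply; apply/eqP; rewrite eqn_leq.
have := le_lt_trans h1 h4; have := le_lt_trans h3 h2.
by rewrite !ltr_pM2r // !ltr_nat !ltnS => -> ->.
Qed.

Lemma quant_cells eta K (e : 'rV[R]_d) : quant eta K (e 0 k) =
  \sum_(s : bool) \sum_(i < K) ((-1) ^+ s * (i.+1%:R * eta)) * \1_(cell eta (s, i : nat)) e.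
Proof.
have h (s : bool) (i : nat) :
  \1_(cell eta (s, i)) e = \1_(level eta i) ((-1) ^+ s * e 0 k) :> R by [].
rewrite big_bool /= addrC /quant /quantp -sumrN; congr (_ + _).
  by apply: eq_bigr => i _; rewrite h expr0 !mul1r.
by apply: eq_bigr => i _; rewrite h expr1 !mulN1r mulNr.
Qed.

(** The exponent (2 - upsilon) / 2 leaves |z|^(a - 1) with a = (2 - upsilon) / 2 > 0
after multiplication by the density |z|^(-1 - upsilon) of the Levy measure. *)
Lemma levy_quant_error : exists2 C : R, 0 <= C & forall eta K,
  0 < eta -> 1 < K.+1%:R * eta ->
  (\int[Pi]_e ((quant eta K (e 0 k) - e 0 k) ^+ 2)%:E <=
   (C * eta `^ ((2 - upsilon) / 2))%:E)%E.
Proof.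
have /andP[u1 u2] := ub.
pose a := (2 - upsilon) / 2.
have a0 : 0 < a by rewrite /a; lra.
have a1 : a <= 1 by rewrite /a; lra.
have KI := @norm_powR_integral_lty R a a0 a1.
set I := (\int[leb]_(z in _) _)%E in KI.
have I0 : (0 <= I)%E by apply: integral_ge0 => z _; rewrite lee_fin powR_ge0.
have IE : I = (fine I)%:E by rewrite fineK // ge0_fin_numE.
exists (c k * fine I); first by rewrite mulr_ge0 ?fine_ge0 // ltW.
move=> eta K e0 Ke.
rewrite (levy_coord_integral (g := fun x => (quant eta K x - x) ^+ 2)); last 3 first.
- by apply: measurable_funX; apply: measurable_funB => //; exact: measurable_quant.
- by move=> x; exact: sqr_ge0.
- rewrite /quant oppr0 quantp_le0 ?(ltW e0) //; ring.
rewrite -mulrA EFinM; apply: lee_wpmul2l; first by rewrite lee_fin ltW.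
have mpow' : measurable_fun D1 (fun z : R => (`|z| `^ (a - 1))%:E).
  by apply/measurable_EFinP; apply: measurable_funTS; exact: measurable_norm_powR.
rewrite mulrC EFinM -IE /I -ge0_integralZl_EFin; [|exact: mD1|by move=> z _; rewrite lee_fin powR_ge0|exact: mpow'|exact: powR_ge0].
apply: ge0_le_integral; first exact: mD1.
- by move=> z _; rewrite lee_fin mulr_ge0 ?sqr_ge0 ?powR_ge0.
- apply: (@measurable_levy_integrand _ (fun z => (quant eta K z - z) ^+ 2)).
  by apply: measurable_funX; apply: measurable_funB => //; exact: measurable_quant.
- by apply: emeasurable_funM.
move=> z /andP[z0 z1]; rewrite -EFinM lee_fin.
have zK : `|z| < K.+1%:R * eta by apply: le_lt_trans z1 _.
apply: (@le_trans _ _ ((eta `^ a * `|z| `^ (2 - a)) * `|z| `^ (- 1 - upsilon))).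
  by apply: ler_wpM2r; [exact: powR_ge0|exact: quant_sqr_bound].
rewrite -mulrA -powRD; last by rewrite (gt_eqF z0) implybT.
by rewrite (_ : 2 - a + (- 1 - upsilon) = a - 1) // /a; field.
Qed.

Lemma levy_cellE eta p : 0 < eta ->
  Pi (cell eta p) = ((c k)%:E *
    \int[leb]_(z in D1) (\1_(level eta p.2) ((-1) ^+ p.1 * z) * `|z| `^ (- 1 - upsilon))%:E)%E.
Proof.
move=> e0.
rewrite -(levy_coord_integral (g := fun x => \1_(level eta p.2) ((-1) ^+ p.1 * x))).
- transitivity (\int[Pi]_e (\1_(cell eta p) e)%:E)%E; last exact: eq_integral.
  by rewrite integral_indic ?setIT //; exact: measurable_cell.
- exact: measurable_level_signed.
- by move=> x; rewrite indicE.
- rewrite indicE memNset ?mulr0 // /level /= => /andP[h _].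
  by move: h; rewrite leNgt mulr_gt0.
Qed.

Lemma level_pos (eta : R) i (y : R) : 0 < eta -> level eta i y -> eta <= y.
Proof.
move=> e0 /andP[h _]; apply: le_trans h; by rewrite ler_peMl ?(ltW e0) // ler1n.
Qed.

Lemma levy_cell_lty eta p : 0 < eta -> (Pi (cell eta p) < +oo)%E.
Proof.
move=> e0; rewrite levy_cellE //.
apply: lte_mul_pinfty; rewrite ?lee_fin ?(ltW (c0 k)) //.
have /andP[u1 u2] := ub.
apply: (@le_lt_trans _ _ (\int[leb]_(z in D1) (cst (eta `^ (- 1 - upsilon))%:E z))%E).
  apply: ge0_le_integral; first exact: mD1.
  - by move=> z _; rewrite lee_fin mulr_ge0 ?indicE ?powR_ge0.
  - exact: (measurable_levy_integrand (measurable_level_signed _ _ _)).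
  - exact: measurable_cst.
  move=> z /andP[z0 z1]; rewrite lee_fin indicE.
  have [|_] := boolP (_ \in _); last by rewrite mul0r powR_ge0.
  rewrite inE => /(level_pos e0) h; rewrite mul1r.
  have ez : eta <= `|z| by rewrite (le_trans h) // (le_trans (ler_norm _)) // normrMsign.
  rewrite (_ : - 1 - upsilon = - (1 + upsilon)); last by ring.
  rewrite !powRN lef_pV2 ?posrE ?powR_gt0 //.
  by apply: ge0_ler_powR; rewrite ?nnegrE ?(ltW e0) //; lra.
rewrite integral_cst //; apply: lte_mul_pinfty; rewrite ?lee_fin ?powR_ge0 //.
apply: (@le_lt_trans _ _ (leb `[-1, 1]%classic)).
  apply: le_measure; rewrite ?inE //.
  by move=> z /andP[_]; rewrite ler_norml /= in_itv.
by rewrite lebesgue_measure_itv /=; case: ifP; rewrite ?ltry.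
Qed.

Lemma sum_level (eta : R) p n (y : R) : 0 < eta -> (p <= n)%N ->
  \sum_(p <= i < n) \1_(level eta i) y =
  \1_([set y | p.+1%:R * eta <= y < n.+1%:R * eta] : set R) y :> R.
Proof.
move=> e0; elim: n => [|n IH].
  rewrite leqn0 => /eqP ->; rewrite big_geq // indicE memNset // => /andP[].
  by move=> /le_lt_trans h /h; rewrite ltxx.
rewrite leq_eqVlt => /orP[/eqP ->|].
  rewrite big_geq // indicE memNset // => /andP[].
  by move=> /le_lt_trans h /h; rewrite ltxx.
rewrite ltnS => pn; rewrite big_nat_recr //= IH // !indicE.
have l1 : p.+1%:R * eta <= n.+1%:R * eta by rewrite ler_pM2r // ler_nat.
have l2 : n.+1%:R * eta <= n.+2%:R * eta by rewrite ler_pM2r // ler_nat.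
have iE (A : set R) (b : bool) : (A y <-> b) -> (y \in A) = b.
  by move=> h; apply/idP/idP => [/set_mem/h|/h/mem_set].
rewrite (iE _ (p.+1%:R * eta <= y < n.+1%:R * eta)) //.
rewrite (iE _ (n.+1%:R * eta <= y < n.+2%:R * eta)) //.
rewrite (iE _ (p.+1%:R * eta <= y < n.+2%:R * eta)) //.
have [h1|h1] := leP (n.+1%:R * eta) y.
  by rewrite (le_trans l1 h1) /= add0r.
rewrite /= addr0 andbT (lt_le_trans h1 l2) andbT //.
Qed.

(** The levels from p - 1 to 2 p - 2 exactly cover the sizes in
[1 / (2 lambda), 1 / lambda[, an interval of length 1 / (2 lambda) on which the
density is at least c_k lambda^(1 + upsilon). *)
Lemma levy_mass_lower (lambda eta : R) (p : nat) : 1 <= lambda -> (0 < p)%N ->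
  eta = (2 * p%:R * lambda)^-1 ->
  c k / 2 * lambda `^ upsilon <=
  \sum_(p.-1 <= i < p.*2.-1) fine (Pi (cell eta (false, i))).
Proof.
move=> l1 p0 etaE.
have l0 : 0 < lambda by apply: lt_le_trans l1.
have pp0 : 0 < p%:R :> R by rewrite ltr0n.
have e0 : 0 < eta by rewrite etaE invr_gt0 !mulr_gt0.
have /andP[u1 u2] := ub.
rewrite -lee_fin -sumEFin.
have fE i : (fine (Pi (cell eta (false, i))))%:E = Pi (cell eta (false, i)).
  by rewrite fineK // ge0_fin_numE // levy_cell_lty.
under eq_bigr do rewrite fE levy_cellE //.
rewrite -ge0_sume_distrr; last first.
  by move=> i _; apply: integral_ge0 => z _; rewrite lee_fin mulr_ge0 ?indicE ?powR_ge0.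
rewrite -mulrA EFinM; apply: lee_wpmul2l; first by rewrite lee_fin ltW.
have mS (D : set R) i : measurable_fun D (fun z : R =>
    (\1_(level eta i) ((-1) ^+ false * z) * `|z| `^ (- 1 - upsilon))%:E).
  exact: (measurable_levy_integrand (measurable_level_signed _ _ _)).
rewrite -ge0_integral_sum; [|exact: mD1|by move=> i; exact: mS|
  by move=> i z _; rewrite lee_fin mulr_ge0 ?indicE ?powR_ge0].
pose J : set R := `[(2 * lambda)^-1, lambda^-1[%classic.
have JD : J `<=` D1.
  move=> z; rewrite /J /= in_itv /= => /andP[z1 z2].
  have z0 : 0 < z by apply: lt_le_trans z1; rewrite invr_gt0 mulr_gt0.
  rewrite /D1 /= gtr0_norm // z0 (le_trans (ltW z2)) // invf_le1 //.
apply: (@le_trans _ _ (\int[leb]_(z in J) (cst (lambda `^ (1 + upsilon))%:E z))%E).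
  have lJ : leb J = (lambda^-1 - (2 * lambda)^-1)%:E.
    rewrite /J lebesgue_measure_itv /= lte_fin.
    by rewrite ltf_pV2 ?posrE ?mulr_gt0 // ifT //; lra.
  rewrite integral_cst; last exact: measurable_itv.
  rewrite [X in (_ <= _ * X)%E]lJ.
  rewrite -EFinM lee_fin powRD; last by rewrite gt_eqF ?implybT //; lra.
  rewrite powRr1 ?(ltW l0) // le_eqVlt; apply/orP; left; apply/eqP.
  by field; rewrite gt_eqF.
apply: (@le_trans _ _ (\int[leb]_(z in J) (\sum_(p.-1 <= i < p.*2.-1)
    (\1_(level eta i) ((-1) ^+ false * z) * `|z| `^ (- 1 - upsilon))%:E))%E).
  apply: ge0_le_integral; first exact: measurable_itv.
  - by move=> z _; rewrite lee_fin powR_ge0.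
  - exact: measurable_cst.
  - by apply: emeasurable_sum => i; exact: mS.
  move=> z; rewrite /J /= in_itv /= => /andP[z1 z2].
  have z0 : 0 < z by apply: lt_le_trans z1; rewrite invr_gt0 mulr_gt0.
  rewrite sumEFin lee_fin -mulr_suml.
  under eq_bigr do rewrite expr0 mul1r.
  rewrite sum_level //; last by rewrite -!subn1 leq_sub2r // -addnn leq_addr.
  rewrite indicE mem_set ?mul1r; last first.
    rewrite /= prednK // prednK ?double_gt0 //; apply/andP; split.
      apply: le_trans z1; rewrite etaE le_eqVlt; apply/orP; left; apply/eqP.
      by field; rewrite !gt_eqF.
    apply: lt_le_trans z2 _; rewrite etaE -muln2 natrM le_eqVlt; apply/orP; left; apply/eqP.
    by field; rewrite !gt_eqF.
  rewrite (_ : - 1 - upsilon = - (1 + upsilon)); last by ring.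
  rewrite powRN gtr0_norm // -[leLHS]invrK lef_pV2 ?posrE ?invr_gt0 ?powR_gt0 //.
  rewrite -powRN -[in leRHS](invrK lambda) -powR_inv1 ?invr_ge0 ?(ltW l0) //.
  rewrite -powRrM mulN1r opprK.
  by apply: ge0_ler_powR; rewrite ?nnegrE ?invr_ge0 ?(ltW l0) ?(ltW z0) ?(ltW z2) //; lra.
apply: ge0_subset_integral; [exact: measurable_itv|exact: mD1| | |exact: JD].
- by apply: emeasurable_sum => i; exact: mS.
- move=> z _; apply: sume_ge0 => i _.
  by rewrite lee_fin mulr_ge0 ?indicE ?powR_ge0.
Qed.

End LevyMeasure.

(** * Characteristic function of a combination of box counts *)

Section CellCharacteristic.
Context {R : realType} {T : R} {d : nat}.
Variables (upsilon : R) (c : 'I_d -> R).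
Variable Pi : {sigma_finite_measure set 'rV[R]_d -> \bar R}.
Hypothesis ub : 1 < upsilon < 2.
Hypothesis c0 : forall j, 0 < c j.
Hypothesis Pi_stable : truncated_stable upsilon c Pi.
Hypothesis T0 : 0 <= T.
Variable P : probability (omega T d) R.
Hypothesis PRM : poisson_random_measure Pi P.
Hypothesis ind : independent_coordinates P.
Variable k : 'I_d.
Local Notation Pc := (completion P).
Local Notation Wc := (completed P).
Local Notation V := (R * 'rV[R]_d)%type.

Definition box (eta t0 t1 : R) (p : bool * nat) : set V :=
  `]t0, t1] `*` cell k eta p.

Lemma box_off_strip eta t0 t1 p : 0 < eta -> 0 <= t0 -> t1 <= T ->
  off_strip (T := T) (box eta t0 t1 p).
Proof.
move=> e0 t00 t1T; split; first by apply: measurable_strip; exact: measurable_cell.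
exists (cell k eta p); first exact: cell_off_origin.
move=> [x e] /= []; rewrite !in_itv /= => /andP[x1 x2] ce; split => //.
by apply/andP; split; [exact: le_lt_trans x1|exact: le_trans t1T].
Qed.

Lemma box_lty eta t0 t1 p (w : omega T d) : 0 < eta -> 0 <= t0 -> t1 <= T ->
  (coord_N w (box eta t0 t1 p) < +oo)%E.
Proof.
move=> e0 t00 t1T.
exact: (jumps_strip_lty w t00 t1T (cell_off_origin k p e0)).
Qed.

Lemma box_intensity eta t0 t1 p : 0 < eta -> t0 <= t1 ->
  ((@lebesgue_measure R \x Pi) (box eta t0 t1 p) =
   ((t1 - t0) * fine (Pi (cell k eta p)))%:E)%E.
Proof.
move=> e0 t01; rewrite product_measure1E //; last exact: measurable_cell.
rewrite EFinM fineK; last first.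
  rewrite ge0_fin_numE //. exact: (levy_cell_lty ub c0 Pi_stable).
have lE : @lebesgue_measure R `]t0, t1]%classic = (t1 - t0)%:E.
  rewrite lebesgue_measure_itv /= lte_fin -EFinD.
  by case: ltP => // t10; rewrite (le_anti (introT andP (conj t01 t10))) subrr.
by congr (_ * _)%E; exact: lE.
Qed.

Definition box_count eta t0 t1 p (w : omega T d) : R :=
  fine (coord_N w (box eta t0 t1 p)).

(** A Poisson variable of mean m <= 1 has atoms exp (- m) at 0 and m exp (- m) at 1,
and exp (- m) >= exp (- 1). *)
Lemma box_count_chfmod eta t0 t1 p (theta : R) : 0 < eta -> 0 <= t0 -> t0 <= t1 ->
  t1 <= T -> (t1 - t0) * fine (Pi (cell k eta p)) <= 1 -> 0 <= cos (theta / 2) ->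
  chfmod Pc setT (fun w => theta * box_count eta t0 t1 p w) <=
  expR (- (2 * expR (- 1) * (1 - cos (theta / 2)) *
           ((t1 - t0) * fine (Pi (cell k eta p))))).
Proof.
move=> e0 t00 t01 t1T; set m := _ * fine _ => m1 ct.
have oC := box_off_strip p e0 t00 t1T.
have m0 : 0 <= m by rewrite mulr_ge0 ?subr_ge0 ?fine_ge0.
have mU0 : measurable_fun setT (box_count eta t0 t1 p).
  move=> _ S mS; rewrite setTI.
  have -> : box_count eta t0 t1 p @^-1` S = [set w | (fine @^-1` S) (coord_N w (box eta t0 t1 p))] by [].
  apply: sub_gen_N; apply: (off_strip_jumps_measurable T0) => //.
  by rewrite -[X in measurable X]setTI; apply: fine_measurable.
have mU : measurable_fun setT (box_count eta t0 t1 p : Wc -> R).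
  exact: completed_measurable_fun.
have [m00|mp] := leP m 0.
  have -> : m = 0 by apply/le_anti; rewrite m00 m0.
  rewrite mulr0 oppr0 expR0.
  apply: (@le_trans _ _ (fine (Pc setT))).
    apply: (@chfmod_le _ Wc R Pc setT _ measurableT).
    exact: (measurable_funM (measurable_cst theta) mU).
  by rewrite [X in fine X](probability_setT Pc).
have law (i : nat) : Pc [set w | coord_N w (box eta t0 t1 p) = (i%:R)%:E] =
    (poisson_pmf m i)%:E.
  rewrite [LHS]completionE; last first.
    apply: sub_gen_N.
    exact: (off_strip_jumps_measurable T0 oC (emeasurable_set1 _)).
  have [mC _] := oC; have [h _] := PRM.1 _ mC (off_strip_sub oC).
  move: h; rewrite /= box_intensity // => h.
  rewrite h ?ltry // /poisson_prob -/m mp esum_set1 //.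
  by rewrite lee_fin poisson_pmf_ge0.
have pre (i : nat) : box_count eta t0 t1 p @^-1` [set i%:R] =
    [set w | coord_N w (box eta t0 t1 p) = (i%:R)%:E].
  apply/seteqP; split => w /=; last by rewrite /box_count => ->.
  rewrite /box_count => <-; rewrite fineK // ge0_fin_numE //; exact: box_lty.
have pm0 : poisson_pmf m 0 = expR (- m) by rewrite /poisson_pmf mp expr0 fact0 invr1 !mul1r.
have pm1 : poisson_pmf m 1 = m * expR (- m) by rewrite /poisson_pmf mp expr1 invr1 mulr1.
have h1 : (m * expR (- m))%:E = Pc (box_count eta t0 t1 p @^-1` [set 1]).
  by rewrite -pm1 -(law 1%N) -(pre 1%N).
have h0 : (expR (- m))%:E = Pc (box_count eta t0 t1 p @^-1` [set 0]).
  by rewrite -pm0 -(law 0%N) -(pre 0%N).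
have h10 : (Pc (box_count eta t0 t1 p @^-1` [set 1%R]) <=
    Pc (box_count eta t0 t1 p @^-1` [set 0%R]))%E.
  by rewrite -h1 -h0 lee_fin ler_piMl ?expR_ge0.
have h := @chfmod_two_atoms _ Wc R Pc (box_count eta t0 t1 p) theta (m * expR (- m)) mU ct h1 h10.
apply: le_trans h _; apply: le_trans (expR_ge1Dx _).
rewrite lerD2l lerN2.
have cm : 0 <= 1 - cos (theta / 2) by rewrite subr_ge0 cos_le1.
have em : expR (- 1) <= expR (- m) by rewrite ler_expR lerN2.
rewrite (_ : 2 * expR (- 1) * _ * m = 2 * m * (1 - cos (theta / 2)) * expR (- 1)); last by ring.
rewrite (_ : 2 * (m * _) * _ = 2 * m * (1 - cos (theta / 2)) * expR (- m)); last by ring.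
by apply: ler_wpM2l => //; apply: mulr_ge0 => //; exact: mulr_ge0.
Qed.

Lemma box_disjoint eta t0 t1 t0' t1' p p' : 0 < eta ->
  t1 <= t0' \/ t1' <= t0 \/ p != p' ->
  box eta t0 t1 p `&` box eta t0' t1' p' = set0.
Proof.
move=> e0 h; rewrite -subset0 => -[x e] [[/= x1 c1] [/= x2 c2]].
move: x1 x2; rewrite !in_itv /= => /andP[a1 a2] /andP[b1 b2].
case: h => [h|[h|h]].
- by have := lt_le_trans b1 (le_trans a2 h); rewrite ltxx.
- by have := lt_le_trans a1 (le_trans b2 h); rewrite ltxx.
- by have := cell_disjoint k e0 h; rewrite -subset0; apply; split; [exact: c1|exact: c2].
Qed.

Lemma measurable_box_count_gen_off eta t0 t1 p C (a : R) : 0 < eta -> 0 <= t0 -> t1 <= T ->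
  box eta t0 t1 p `&` C = set0 ->
  measurable_fun setT (fun w : g_sigma_algebraType (@gen_off R T d C) =>
    a * box_count eta t0 t1 p w).
Proof.
move=> e0 t00 t1T AC; apply: measurable_funM => //.
by apply: measurable_jumps_gen_off => //; exact: box_off_strip.
Qed.

Lemma measurable_of_gen_off C (f : omega T d -> R) :
  measurable_fun setT (f : g_sigma_algebraType (@gen_off R T d C) -> R) ->
  measurable_fun setT (f : Wc -> R).
Proof.
move=> mf; apply: completed_measurable_fun => _ S mS; rewrite setTI.
apply: (gen_off_measurable T0 (C := C)).
by rewrite -[X in <<s _ >> X]setTI; exact: mf.
Qed.

Lemma independent_of_completed C (f : omega T d -> R) :
  measurable_fun setT f ->
  independent_of P (gen_off C) f -> independent_of Pc (gen_off C) f.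
Proof.
move=> mf h B S sB mS.
have mB : measurable (B : set (omega T d)) by exact: (gen_off_measurable T0 sB).
have mfS : measurable (f @^-1` S : set (omega T d)) by rewrite -[X in measurable X]setTI; exact: mf.
have e1 : Pc (B `&` f @^-1` S) = P (B `&` f @^-1` S).
  by apply: completionE; exact: measurableI.
have e2 : Pc B = P B by exact: completionE.
have e3 : Pc (f @^-1` S) = P (f @^-1` S) by exact: completionE.
by rewrite [LHS]e1 [X in (X * _)%E]e2 [X in (_ * X)%E]e3; exact: h.
Qed.

(** The cells that start after u cover ]u, t] up to one cell. The truncated grid points
max (j t / n) (u + t / n) turn the sum into a telescoping one. *)
Lemma grid_length (u t : R) (n : nat) : (0 < n)%N -> 0 <= t -> 0 <= u ->
  t - u - t / n%:R <= \sum_(j < n | u <= j%:R * (t / n%:R)) (t / n%:R).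
Proof.
move=> n0 t0 u0; set dl := t / n%:R.
have dl0 : 0 <= dl by rewrite divr_ge0.
pose f (j : nat) := Num.max (j%:R * dl) (u + dl).
apply: (@le_trans _ _ (\sum_(j < n) (f j.+1 - f j))).
  rewrite -(big_mkord xpredT (fun j => f j.+1 - f j)) telescope_sumr //.
  have nd : n%:R * dl = t by rewrite /dl; field; rewrite pnatr_eq0 -lt0n.
  rewrite /f nd mul0r.
  have : t <= Num.max t (u + dl) by rewrite le_max lexx.
  by rewrite (@max_r _ _ 0) ?addr_ge0 //; lra.
rewrite [leRHS]big_mkcond /=; apply: ler_sum => j _; rewrite /f.
have e : j.+1%:R * dl = j%:R * dl + dl by rewrite -natr1; ring.
rewrite e; case: ifPn => h.
  rewrite lerBlDr ge_max; apply/andP; split.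
    by rewrite addrC lerD2l le_max lexx.
  by rewrite -[leLHS]add0r lerD // le_max lexx orbT.
rewrite -ltNge in h.
rewrite (max_r (x := j%:R * dl + dl)) ?lerD2r ?(ltW h) //.
rewrite max_r ?subrr //.
by rewrite (le_trans (ltW h)) // lerDl.
Qed.

(** Y0 collects all that is independent of the jumps. The factors of the boxes that lie
after u and have positive jumps of sizes in [1 / (2 lambda), 1 / lambda[ are kept;
the other boxes are left in the term bounded by the probability of A. On the kept
boxes the frequency lambda * alpha j * (i + 1) * eta lies between amin / 2 and 1, and
the means of the counts add up, up to one cell of the grid, to the elapsed time times
the Levy mass of these sizes. *)
Lemma disc_chfmod (lambda eta amin u t : R) (n K p : nat) (alpha : nat -> R)
    (A : set (omega T d)) (Y0 : omega T d -> R) :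
  let tt (j : nat) := j%:R * (t / n%:R) in
  1 <= lambda -> (0 < p)%N -> eta = (2 * p%:R * lambda)^-1 -> (p.*2 <= K)%N ->
  (0 < n)%N -> 0 <= u -> u <= t -> t <= T ->
  t / n%:R * fine (Pi (cell k (2 * lambda)^-1 (false, 0%N))) <= 1 ->
  0 <= amin -> (forall j, (j < n)%N -> amin <= alpha j <= 1) ->
  raw_filtration u A ->
  (forall C, measurable_fun setT (Y0 : g_sigma_algebraType (@gen_off R T d C) -> R)) ->
  chfmod Pc A (fun w => Y0 w + \sum_(j < n) \sum_(s : bool) \sum_(i < K)
    lambda * alpha j * ((-1) ^+ s * (i.+1%:R * eta)) *
      box_count eta (tt j) (tt j.+1) (s, i : nat) w) <=
  fine (Pc A) * expR (- (2 * expR (- 1) * (1 - cos (amin / 4)) * (c k / 2 * lambda `^ upsilon) *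
    (t - u - t / n%:R))).
Proof.
move=> tt l1 p0 etaE pK n0 u0 ut tT small am0 ha rA mY0.
have l0 : 0 < lambda by apply: lt_le_trans l1.
have pp0 : 0 < p%:R :> R by rewrite ltr0n.
have e0 : 0 < eta by rewrite etaE invr_gt0 !mulr_gt0.
have t0 : 0 <= t by exact: le_trans ut.
have dl0 : 0 <= t / n%:R by rewrite divr_ge0.
have pe : p%:R * eta = (2 * lambda)^-1.
  by rewrite etaE; field; rewrite !gt_eqF.
have nd : n%:R * (t / n%:R) = t by field; rewrite pnatr_eq0 -lt0n.
have ttS j : tt j.+1 = tt j + t / n%:R by rewrite /tt -natr1; ring.
have ttmono i j : (i <= j)%N -> tt i <= tt j.
  by move=> ij; rewrite /tt ler_wpM2r // ler_nat.
have tt0 j : 0 <= tt j by rewrite mulr_ge0.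
have ttT j : (j < n)%N -> tt j.+1 <= T.
  by move=> jn; rewrite (le_trans (ttmono _ _ jn)) // /tt nd.
pose I : finType := ('I_n * (bool * 'I_K))%type.
pose C (x : I) : set V := box eta (tt x.1) (tt x.1.+1) (x.2.1, x.2.2 : nat).
pose th (x : I) := lambda * alpha x.1 * ((-1) ^+ x.2.1 * (x.2.2.+1%:R * eta)).
pose U (x : I) (w : Wc) : R :=
  th x * box_count eta (tt x.1) (tt x.1.+1) (x.2.1, x.2.2 : nat) w.
(* the boxes that are kept: positive jumps, sizes of order 1 / lambda, after time u *)
pose S : pred I := fun x => [&& ~~ x.2.1, (p.-1 <= x.2.2 < p.*2.-1)%N & u <= tt x.1].
have disj x x' : x != x' -> C x `&` C x' = set0.
  move=> xx; apply: box_disjoint => //.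
  case: x x' xx => [j [s i]] [j' [s' i']] /= xx.
  have [jj|jj|jj] := ltngtP j j'; [by left; exact: ttmono|by right; left; exact: ttmono|].
  right; right; apply: contraNneq xx => -[-> ii].
  by apply/eqP; congr (_, (_, _)); exact: val_inj.
have mUg x x' : x != x' ->
    measurable_fun setT (U x : g_sigma_algebraType (gen_off (C x')) -> R).
  move=> xx; apply: measurable_box_count_gen_off => //; first exact: ttT.
  exact: disj.
have oC x : off_strip (T := T) (C x) by apply: box_off_strip => //; exact: ttT.
have mUW x : measurable_fun setT (U x : omega T d -> R).
  apply: measurable_funM => //; apply: measurableT_comp; first exact: fine_measurable.
  move=> _ X mX; rewrite setTI; apply: sub_gen_N.
  exact: (off_strip_jumps_measurable T0 (oC x) mX).
have mU x : measurable_fun setT (U x : Wc -> R) by exact: completed_measurable_fun.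
have sumE (w : Wc) : \sum_(j < n) \sum_(s : bool) \sum_(i < K)
    lambda * alpha j * ((-1) ^+ s * (i.+1%:R * eta)) *
      box_count eta (tt j) (tt j.+1) (s, i : nat) w =
    \sum_(x : I | ~~ S x) U x w + \sum_(x <- enum S) U x w.
  transitivity (\sum_(x : I) U x w); last by rewrite (bigID S) /= addrC big_enum.
  have -> : \sum_(x : I) U x w = \sum_(x : I) U (x.1, x.2) w.
    by apply: eq_bigr => -[j q] _.
  rewrite -(pair_bigA _ (fun j q => U (j, q) w)) /=; apply: eq_bigr => j _.
  have -> : \sum_(q : bool * 'I_K) U (j, q) w =
      \sum_(q : bool * 'I_K) U (j, (q.1, q.2)) w.
    by apply: eq_bigr => -[s i] _.
  by rewrite -(pair_bigA _ (fun s i => U (j, (s, i)) w)).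
pose Y w := Y0 w + \sum_(x : I | ~~ S x) U x w.
rewrite (@chfmod_eq _ Wc R Pc A _ (fun w => Y w + \sum_(x <- enum S) U x w)); last first.
  by move=> w _; rewrite sumE addrA.
have mA : measurable A by exact: (raw_filtration_sub T0 rA).
have mYc : measurable_fun setT (Y : Wc -> R).
  apply: measurable_funD; first exact: measurable_of_gen_off (mY0 set0).
  under eq_fun do rewrite big_mkcond /=.
  apply: measurable_sum => x; have [_|_] := boolP (~~ S x); [exact: mU|exact: measurable_cst].
have mAc : measurable (A : set Wc) by exact: completed_measurable.
rewrite (@chfmod_sum _ Wc R Pc I (enum S) (fun x => gen_off (C x)) U A Y) //; first last.
- by move=> i j _ _ ij; apply: mUg; rewrite eq_sym.
- move=> x; rewrite mem_enum => /and3P[xs xi xj]; split.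
  + apply: (raw_filtration_gen_off (u := u)) => //; first exact: le_trans tT.
    move=> [y e] [/= + _]; rewrite in_itv /= => /andP[h _].
    exact: le_lt_trans h.
  + exact: mU.
  + apply: independent_of_completed; first exact: mUW.
    exact: (independent_of_gen_off T0 PRM ind).
  + have mrest : measurable_fun setT ((fun w => \sum_(x' : I | ~~ S x') U x' w) :
        g_sigma_algebraType (gen_off (C x)) -> R).
      under eq_fun do rewrite big_mkcond /=.
      apply: measurable_sum => x'; have [nS|_] := boolP (~~ S x'); last exact: measurable_cst.
      apply: mUg; apply: contraNneq nS => ->; exact/and3P.
    exact: (measurable_funD (mY0 (C x)) mrest).
- by move=> x B _ sB; apply: completed_measurable; exact: (gen_off_measurable T0 sB).
- exact: enum_uniq.
apply: ler_pM; rewrite ?chfmod_ge0 //.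
- by apply: prodr_ge0 => x _; exact: chfmod_ge0.
- by apply: chfmod_le => //; exact: measurable_funTS.
pose kap := 2 * expR (- 1) * (1 - cos (amin / 4)).
pose mm (i : nat) := fine (Pi (cell k eta (false, i))).
have mm0 i : 0 <= mm i by rewrite fine_ge0.
have kap0 : 0 <= kap by rewrite mulr_ge0 ?mulr_ge0 ?expR_ge0 // subr_ge0 cos_le1.
have factor x : S x -> chfmod Pc setT (U x) <= expR (- (kap * (t / n%:R * mm x.2.2))).
  case: x => j [s i] /and3P[/= /negbTE sf /andP[i1 i2] uj]; rewrite {}sf in uj *.
  have ip1 : (p <= i.+1)%N by rewrite -(prednK p0).
  have ip2 : (i.+2 <= p.*2)%N by rewrite -(prednK (n := p.*2)) // double_gt0.
  have thE : th (j, (false, i)) = alpha j * (i.+1%:R / (2 * p%:R)).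
    rewrite /th /= expr0 mul1r etaE; field.
    by rewrite !gt_eqF.
  have q1 : 1 / 2 <= i.+1%:R / (2 * p%:R) :> R.
    rewrite ler_pdivlMr ?mulr_gt0 // mul1r mulrA mulVf ?mul1r ?ler_nat //.
  have q2 : i.+1%:R / (2 * p%:R) <= 1 :> R.
    rewrite ler_pdivrMr ?mulr_gt0 // mul1r -natrM mul2n ler_nat.
    exact: ltnW.
  have /andP[al1 al2] := ha j (ltn_ord j).
  set th0 := th (j, (false, i)) in thE *.
  (* half of the frequency lies in [amin / 4, 1], where the cosine is decreasing and
     nonnegative *)
  have b1 : amin / 4 <= th0 / 2.
    rewrite thE (_ : amin / 4 = amin * (1 / 2) / 2); last by field.
    by rewrite ler_pM2r ?invr_gt0 //; apply: ler_pM.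
  have b2 : th0 / 2 <= 1.
    have : alpha j * (i.+1%:R / (2 * p%:R)) <= 1 * 1.
      by apply: ler_pM; rewrite ?divr_ge0 ?mulr_ge0 ?(le_trans am0 al1).
    rewrite -thE mulr1 => th1.
    by rewrite ler_pdivrMr // mul1r (le_trans th1) // ler1n.
  have b0 : 0 <= th0 / 2 by apply: le_trans b1; rewrite divr_ge0.
  have cos0 : cos (th0 / 2) <= cos (amin / 4).
    have [->//|ne] := eqVneq (amin / 4) (th0 / 2).
    have pi1 : 1 <= pi :> R by rewrite (le_trans _ (pi_ge2 R)) // ler1n.
    have in1 : th0 / 2 \in `[0, pi] by rewrite in_itv /= b0 (le_trans b2).
    have in2 : amin / 4 \in `[0, pi].
      by rewrite in_itv /= divr_ge0 // (le_trans b1) // (le_trans b2).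
    by apply/ltW; rewrite ltr_cos // lt_neqAle ne.
  have cospos : 0 <= cos (th0 / 2).
    apply: cos_ge0_pihalf; have := pihalf_ge1 R => ph.
    by rewrite (le_trans b2 ph) andbT (le_trans _ b0) // lerNl oppr0 (le_trans _ ph).
  have dlE : tt j.+1 - tt j = t / n%:R by rewrite ttS; ring.
  (* every kept level lies in a single cell of step 1 / (2 lambda), to which the
     smallness of the mesh refers *)
  have mle : mm i <= fine (Pi (cell k (2 * lambda)^-1 (false, 0%N))).
    apply: fine_le.
    - by rewrite ge0_fin_numE //; exact: (levy_cell_lty ub c0 Pi_stable).
    - rewrite ge0_fin_numE //; apply: (levy_cell_lty ub c0 Pi_stable).
      by rewrite invr_gt0 mulr_gt0.
    apply: le_measure; rewrite ?inE; [exact: measurable_cell|exact: measurable_cell|].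
    move=> e; rewrite /cell /level /= expr0 mul1r => /andP[h1 h2]; apply/andP; split.
      by apply: le_trans h1; rewrite mul1r -pe ler_pM2r // ler_nat.
    apply: lt_le_trans h2 _.
    rewrite -pe mulrA ler_pM2r // -natrM ler_nat mul2n //.
  have := @box_count_chfmod eta (tt j) (tt j.+1) (false, i : nat) th0 e0 (tt0 j)
    (ttmono _ _ (leqnSn _)) (ttT _ (ltn_ord j)).
  rewrite dlE -/(mm i) => /(_ (le_trans (ler_wpM2l dl0 mle) small) cospos) h.
  apply: le_trans h _.
  rewrite ler_expR lerN2; apply: ler_wpM2r; first by rewrite mulr_ge0.
  by apply: ler_wpM2l; [rewrite mulr_ge0 ?expR_ge0|rewrite lerD2l lerN2].
apply: (@le_trans _ _ (\prod_(x <- enum S) expR (- (kap * (t / n%:R * mm x.2.2))))).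
  rewrite big_enum /= [leRHS]big_enum /=; apply: ler_prod => x xS.
  by rewrite chfmod_ge0 factor.
rewrite -expR_sum ler_expR sumrN lerN2 -mulr_sumr -mulrA ler_wpM2l //.
rewrite big_enum /=.
have -> : \sum_(x : I | S x) t / n%:R * mm x.2.2 =
    (\sum_(j < n | u <= tt j) (t / n%:R)) * \sum_(p.-1 <= i < p.*2.-1) mm i.
  pose rg (i : 'I_K) := (p.-1 <= i < p.*2.-1)%N.
  rewrite (eq_bigl (fun x : I => (u <= tt x.1) && (~~ x.2.1 && rg x.2.2))); last first.
    by move=> x; rewrite /S /rg [LHS]andbA [RHS]andbC.
  rewrite -(pair_big (fun j : 'I_n => u <= tt j)
    (fun q : bool * 'I_K => ~~ q.1 && rg q.2) (fun _ q => t / n%:R * mm q.2)) /=.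
  rewrite mulr_suml; apply: eq_bigr => j _.
  rewrite -(pair_big negb rg (fun _ i => t / n%:R * mm i)) /=.
  rewrite big_mkcond big_bool /= add0r -mulr_sumr; congr (_ * _).
  rewrite big_geq_mkord (@big_ord_widen_cond _ _ _ (p.*2.-1) K (fun i => p.-1 <= i)%N) //.
  by rewrite (leq_trans (leq_pred _)).
have gl := @grid_length u t n n0 t0 u0.
have lm := levy_mass_lower ub c0 Pi_stable k l1 p0 etaE.
have X0 : 0 <= c k / 2 * lambda `^ upsilon.
  by rewrite mulr_ge0 ?powR_ge0 // divr_ge0 // ltW.
apply: le_trans (ler_wpM2l X0 gl) _.
by rewrite mulrC; apply: ler_wpM2l => //; apply: sumr_ge0 => j _.
Qed.

End CellCharacteristic.

(** * The explicit Euler scheme *)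

Section Grids.
Variable R : realType.
Implicit Types (t s : R) (y : R -> R) (n : nat).

(** Written as a finite sum of indicator functions, the left-end grid approximation is
measurable jointly in the time and in a parameter of y. *)
Definition lstep (T : R) n y t : R :=
  \sum_(j < n.+1) \1_(`]j%:R * (T / n.+1%:R), j.+1%:R * (T / n.+1%:R)]%classic : set R) t *
     y (j%:R * (T / n.+1%:R)).

Definition rstep (T : R) n y t : R :=
  \sum_(j < n.+1) \1_(`[j%:R * (T / n.+1%:R), j.+1%:R * (T / n.+1%:R)[%classic : set R) t *
     y (j.+1%:R * (T / n.+1%:R)).

Lemma lstep_in (T : R) n y t (j : nat) : 0 < T -> (j < n.+1)%N ->
  j%:R * (T / n.+1%:R) < t -> t <= j.+1%:R * (T / n.+1%:R) ->
  lstep T n y t = y (j%:R * (T / n.+1%:R)).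
Proof.
move=> T0 jn j1 j2; have dl0 : 0 < T / n.+1%:R by rewrite divr_gt0.
rewrite /lstep (bigD1 (Ordinal jn)) //= indicE mem_set; last by rewrite /= in_itv /= j1.
rewrite mul1r big1 ?addr0 // => i im; rewrite indicE memNset ?mul0r //=.
rewrite in_itv /= => /andP[i1 i2]; move/negP : im; apply; apply/eqP/val_inj => /=.
have := lt_le_trans i1 j2; have := lt_le_trans j1 i2.
rewrite !ltr_pM2r // !ltr_nat !ltnS => a b; apply/eqP; by rewrite eqn_leq a b.
Qed.

Lemma lstepE (T : R) n y t : 0 < T -> 0 < t <= T ->
  exists s, [/\ 0 <= s, s < t, t <= s + T / n.+1%:R & lstep T n y t = y s].
Proof.
move=> T0 /andP[t0 tT]; set dl := T / n.+1%:R.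
have dl0 : 0 < dl by rewrite divr_gt0.
have nd : n.+1%:R * dl = T by rewrite /dl; field; rewrite nat1r.
have hx : exists j, (t <= j.+1%:R * dl) by exists n; rewrite nd.
have := ex_minnP hx; case=> m hm mmin.
have mn : (m < n.+1)%N by rewrite ltnS; apply: mmin; rewrite nd.
have m1 : m%:R * dl < t.
  case: m hm mmin mn => [|m] hm mmin mn; first by rewrite mul0r.
  by rewrite ltNge; apply/negP => /mmin; rewrite ltnn.
exists (m%:R * dl); split => //.
- by rewrite mulr_ge0 // ltW.
- by move: hm; rewrite -natr1 mulrDl mul1r.
exact: lstep_in.
Qed.

Lemma lstep_out (T : R) n y t : 0 < T -> ~ (0 < t <= T) -> lstep T n y t = 0.
Proof.
move=> T0 h; apply: big1 => j _; rewrite indicE memNset ?mul0r //=.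
have dl0 : 0 < T / n.+1%:R by rewrite divr_gt0.
rewrite in_itv /= => /andP[j1 j2]; apply: h; apply/andP; split.
  by apply: le_lt_trans j1; rewrite mulr_ge0 // ltW.
apply: le_trans j2 _.
have nd : n.+1%:R * (T / n.+1%:R) = T by field; rewrite nat1r.
by rewrite -[leRHS]nd ler_pM2r // ler_nat.
Qed.

Lemma rstepE (T : R) n y t : 0 < T -> 0 <= t < T ->
  exists s, [/\ s <= T, t < s, s <= t + T / n.+1%:R & rstep T n y t = y s].
Proof.
move=> T0 /andP[t0 tT]; set dl := T / n.+1%:R.
have dl0 : 0 < dl by rewrite divr_gt0.
have nd : n.+1%:R * dl = T by rewrite /dl; field; rewrite nat1r.
have hx : exists j, (t < j.+1%:R * dl) by exists n; rewrite nd.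
have := ex_minnP hx; case=> m hm mmin.
have mn : (m < n.+1)%N by rewrite ltnS; apply: mmin; rewrite nd.
have m1 : m%:R * dl <= t.
  case: m hm mmin mn => [|m] hm mmin mn; first by rewrite mul0r.
  by rewrite leNgt; apply/negP => /mmin; rewrite ltnn.
exists (m.+1%:R * dl); split => //.
- by rewrite -[leRHS]nd ler_pM2r // ler_nat.
- by rewrite -natr1 mulrDl mul1r lerD2r.
rewrite /rstep -/dl (bigD1 (Ordinal mn)) //= indicE mem_set; last by rewrite /= in_itv /= m1.
rewrite mul1r big1 ?addr0 // => i im; rewrite indicE memNset ?mul0r //=.
rewrite in_itv /= => /andP[i1 i2]; move/negP : im; apply; apply/eqP/val_inj => /=.
apply/eqP; rewrite eqn_leq (mmin _ i2) andbT.
by have := le_lt_trans i1 hm; rewrite ltr_pM2r // ltr_nat ltnS.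
Qed.

Lemma grid_mesh_small (T e : R) : 0 < T -> 0 < e -> \forall n \near \oo, T / n.+1%:R < e.
Proof.
move=> T0 e0; exists (Num.truncn (T / e)) => // n /= hn.
rewrite ltr_pdivrMr // mulrC -ltr_pdivrMr //.
by apply: (lt_le_trans (truncnS_gt _)); rewrite ler_nat ltnS.
Qed.

Lemma lstep_cvg (T : R) y t (l : R) : 0 < T -> 0 < t <= T ->
  y s @[s --> t^'-] --> l -> lstep T n y t @[n --> \oo] --> l.
Proof.
move=> T0 tT /cvgrPdist_lt yl; apply/cvgrPdist_lt => e e0.
have [dl /= dl0 hd] := yl _ e0.
have := grid_mesh_small T0 dl0; apply: filterS => n hn.
have [s [s0 st ts ->]] := lstepE n y T0 tT.
apply: hd => //=; rewrite ger0_norm ?subr_ge0 ?(ltW st) //.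
by rewrite ltrBlDl (le_lt_trans ts) // ltrD2l.
Qed.

Lemma rstep_cvg (T : R) y t (l : R) : 0 < T -> 0 <= t < T ->
  y s @[s --> t^'+] --> l -> rstep T n y t @[n --> \oo] --> l.
Proof.
move=> T0 tT /cvgrPdist_lt yl; apply/cvgrPdist_lt => e e0.
have [dl /= dl0 hd] := yl _ e0.
have := grid_mesh_small T0 dl0; apply: filterS => n hn.
have [s [s0 st ts ->]] := rstepE n y T0 tT.
apply: hd => //=; rewrite distrC ger0_norm ?subr_ge0 ?(ltW st) //.
by rewrite ltrBlDl (le_lt_trans ts) // ltrD2l.
Qed.

Lemma measurable_right_continuous (T : R) (y : R -> R) : 0 < T ->
  (forall t, 0 <= t < T -> y s @[s --> t^'+] --> y t) ->
  measurable_fun `[0, T]%classic y.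
Proof.
move=> T0 hy.
have m1 : measurable_fun `[0, T[%classic y.
  apply: (@measurable_fun_cvg _ _ _ _ (fun n => rstep T n y)).
    move=> n; apply: measurable_funTS; apply: measurable_sum => j.
    apply: measurable_funM; last exact: measurable_cst.
    by apply: measurable_indic; exact: measurable_itv.
  by move=> t; rewrite /= in_itv /= => tT; apply: rstep_cvg => //; exact: hy.
apply/(measurable_fun_itv_bndo_bndcP) => //.
Qed.

End Grids.

Section Euler.
Variable R : realType.
Local Notation leb := (@lebesgue_measure R).
Variables (kappa t M : R) (x xl l : R -> R).
Hypothesis kappa0 : 0 <= kappa.
Hypothesis t0 : 0 < t.
Hypothesis xE : forall s, 0 <= s <= t ->
  x s = l s - kappa * \int[leb]_(r in `]0, s]) xl r.
Hypothesis xM : forall s, 0 <= s <= t -> `|x s| <= M.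
Hypothesis x_left : forall s, 0 < s <= t -> x r @[r --> s^'-] --> xl s.

Lemma left_value_le s : 0 < s <= t -> `|xl s| <= M.
Proof.
move=> st; have := lstep_cvg t0 st (x_left st).
move=> /(@cvg_norm _ _ _ _ _) /cvgr_to_le; apply; apply: nearW => n.
have [r [r0 rs _ ->]] := lstepE n x t0 st; apply: xM; rewrite r0 /=.
by rewrite ltW // (lt_le_trans rs) //; case/andP: st.
Qed.

Lemma measurable_left_value : measurable_fun `]0, t]%classic xl.
Proof.
apply: (@measurable_fun_cvg _ _ _ _ (fun n => lstep t n x)).
  move=> n; apply: measurable_funTS; apply: measurable_sum => j.
  apply: measurable_funM; last exact: measurable_cst.
  by apply: measurable_indic; exact: measurable_itv.
by move=> s; rewrite /= in_itv /= => st; apply: lstep_cvg => //; exact: x_left.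
Qed.

Lemma bounded_itv_integrable (D : set R) (f : R -> R) (B : R) : measurable D ->
  D `<=` `]0, t]%classic -> measurable_fun `]0, t]%classic f ->
  (forall s, 0 < s <= t -> `|f s| <= B) -> leb.-integrable D (EFin \o f).
Proof.
move=> mD Dt mf fB; apply: (@integrableS _ _ _ leb `]0, t]%classic) => //.
apply: measurable_bounded_integrable => //.
  have e : leb `]0, t]%classic = (t - 0)%:E.
    by rewrite lebesgue_measure_itv /= lte_fin t0 -EFinD.
  by rewrite [X in (X < _)%E]e ltry.
exists B; split; first exact: num_real.
move=> y By s; rewrite /= in_itv /= => st.
by apply: le_trans (fB _ st) _; exact: ltW.
Qed.

Let dl n : R := t / n.+1%:R.
Let tt n j : R := j%:R * dl n.

(** The solution after n + 1 explicit Euler steps of x = l - kappa int x, summed by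
parts in terms of the increments of l. *)
Definition euler_sum n : R := (1 - kappa * dl n) ^+ n.+1 * l 0 +
  \sum_(j < n.+1) (1 - kappa * dl n) ^+ (n - j) * (l (tt n j.+1) - l (tt n j)).

(** Subtracting the Euler recursion from the equation, the error satisfies a linear
recursion with coefficient q = 1 - kappa dl in [0, 1] and with the local error of
replacing x by its value at the left end of the cell as its inhomogeneity. *)
Lemma euler_error n : kappa * dl n <= 1 ->
  `|euler_sum n - x t| <= kappa * \int[leb]_(r in `]0, t]) `|xl r - lstep t n x r|.
Proof.
move=> kd.
have dl0 : 0 < dl n by rewrite divr_gt0.
have nd : n.+1%:R * dl n = t by rewrite /dl; field; rewrite nat1r.
have tt0 j : 0 <= tt n j by rewrite mulr_ge0 // ltW.
have ttt j : (j <= n.+1)%N -> tt n j <= t.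
  by move=> jn; rewrite -[leRHS]nd ler_pM2r // ler_nat.
have ttS j : tt n j.+1 = tt n j + dl n by rewrite /tt -natr1; ring.
pose q := 1 - kappa * dl n.
have q0 : 0 <= q by rewrite subr_ge0.
have q1 : q <= 1 by rewrite gerBl mulr_ge0 // ltW.
(* the Euler scheme after m steps *)
pose E m := q ^+ m * l 0 + \sum_(j < m) q ^+ (m.-1 - j) * (l (tt n j.+1) - l (tt n j)).
have ES m : E m.+1 = q * E m + (l (tt n m.+1) - l (tt n m)).
  rewrite /E big_ord_recr /= subnn expr0 mul1r exprS mulrDr mulrA addrA.
  congr (_ + _ + _); rewrite mulr_sumr; apply: eq_bigr => j _.
  rewrite mulrA -exprS; congr (_ ^+ _ * _).
  by case: m j => [[]//|m] j /=; rewrite subSn // -ltnS.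
have mst : measurable_fun `]0, t]%classic (fun r => xl r - lstep t n x r).
  apply: measurable_funB; first exact: measurable_left_value.
  apply: measurable_funTS; apply: measurable_sum => j.
  apply: measurable_funM; last exact: measurable_cst.
  by apply: measurable_indic; exact: measurable_itv.
have bst s : 0 < s <= t -> `|xl s - lstep t n x s| <= M + M.
  move=> st; apply: le_trans (ler_normB _ _) _; apply: lerD.
    exact: left_value_le.
  have [r [r0 rs _ ->]] := lstepE n x t0 st; apply: xM; rewrite r0 /=.
  by rewrite ltW // (lt_le_trans rs) //; case/andP: st.
have sub1 m : (m <= n.+1)%N -> `]0, tt n m]%classic `<=` `]0, t]%classic.
  move=> mn s; rewrite /= !in_itv /= => /andP[-> h].
  by rewrite (le_trans h) // ttt.
have mls : measurable_fun `]0, t]%classic (lstep t n x).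
  apply: measurable_funTS; apply: measurable_sum => j.
  apply: measurable_funM; last exact: measurable_cst.
  by apply: measurable_indic; exact: measurable_itv.
have bls s : 0 < s <= t -> `|lstep t n x s| <= M.
  move=> st; have [r [r0 rs _ ->]] := lstepE n x t0 st; apply: xM; rewrite r0 /=.
  by rewrite ltW // (lt_le_trans rs) //; case/andP: st.
have err m : (m <= n.+1)%N -> `|E m - x (tt n m)| <=
    kappa * \int[leb]_(r in `]0, tt n m]) `|xl r - lstep t n x r|.
  elim: m => [|m IH] mn.
    rewrite /E /tt expr0 mul1r big_ord0 addr0 mul0r xE ?lexx ?(ltW t0) //.
    by rewrite set_itv_ge ?bnd_simp ?ltxx // !Rintegral_set0 mulr0 subr0 subrr normr0.
  have m0t : 0 <= tt n m <= t by rewrite tt0 ttt // ltnW.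
  have m1t : 0 <= tt n m.+1 <= t by rewrite tt0 ttt.
  have U : `]0, tt n m.+1]%classic =
      `]0, tt n m]%classic `|` `]tt n m, tt n m.+1]%classic :> set R.
    apply/seteqP; split => s /=; rewrite !in_itv /=.
      move=> /andP[s0 s1]; have [h|h] := leP s (tt n m); first by left; rewrite s0.
      by right.
    case=> /andP[s0 s1].
      by rewrite s0 (le_trans s1) // ttS lerDl ltW.
    by rewrite (le_lt_trans _ s0).
  have spl (f : R -> R) : measurable_fun `]0, t]%classic f ->
      (exists B, forall s, 0 < s <= t -> `|f s| <= B) ->
    \int[leb]_(r in `]0, tt n m.+1]) f r =
    \int[leb]_(r in `]0, tt n m]) f r + \int[leb]_(r in `]tt n m, tt n m.+1]) f r.
    move=> mf [B fB].
    rewrite U Rintegral_setU //.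
    - by rewrite -U; exact: (bounded_itv_integrable _ (sub1 _ mn) mf fB).
    - rewrite disj_set2E; apply/eqP; rewrite -subset0 => s [/=].
      by rewrite !in_itv /= => /andP[_ h] /andP[+ _]; rewrite ltNge h.
  have sub2 : `]tt n m, tt n m.+1] `<=` `]0, t]%classic.
    by apply: subset_trans (sub1 _ mn); rewrite U; exact: subsetUr.
  have mlen : leb `]tt n m, tt n m.+1]%classic = (dl n)%:E.
    rewrite lebesgue_measure_itv /= lte_fin ttS ltrDl dl0 -EFinD; congr EFin; ring.
  have cellE : \int[leb]_(r in `]tt n m, tt n m.+1]) (xl r - lstep t n x r) =
      \int[leb]_(r in `]tt n m, tt n m.+1]) xl r - dl n * x (tt n m).
    rewrite RintegralB //; last 2 first.
    - exact: (bounded_itv_integrable _ sub2 measurable_left_value left_value_le).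
    - apply: (bounded_itv_integrable _ sub2 mls bls) => //.
    congr (_ - _).
    have -> : \int[leb]_(r in `]tt n m, tt n m.+1]) lstep t n x r =
        \int[leb]_(r in `]tt n m, tt n m.+1]) x (tt n m).
      apply: eq_Rintegral => r; rewrite inE /= in_itv /= => /andP[r1 r2].
      exact: (lstep_in x t0 mn r1 r2).
    by rewrite Rintegral_cst // [X in fine X]mlen mulrC.
  have -> : E m.+1 - x (tt n m.+1) = q * (E m - x (tt n m)) +
      kappa * \int[leb]_(r in `]tt n m, tt n m.+1]) (xl r - lstep t n x r).
    rewrite ES (xE m1t) (spl xl measurable_left_value (ex_intro _ M left_value_le)) cellE.
    have := xE m0t; set X1 := \int[leb]_(_ in `]0, tt n m]) _; set X2 := \int[leb]_(_ in _) _.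
    by rewrite /q => ->; ring.
  rewrite (spl (fun r => `|xl r - lstep t n x r|)); last 2 first.
  - exact: measurableT_comp.
  - by exists (M + M) => s st; rewrite normr_id; exact: bst.
  rewrite [in leRHS]mulrDr; apply: le_trans (ler_normD _ _) _.
  apply: lerD.
    rewrite normrM (ger0_norm q0); apply: le_trans (IH (ltnW mn)).
    by rewrite ler_piMl.
  rewrite normrM (ger0_norm kappa0); apply: ler_wpM2l => //.
  apply: le_normr_Rintegral => //.
  exact: (bounded_itv_integrable _ sub2 mst bst).
have := err n.+1 (leqnn _); rewrite {2}/tt nd.
suff -> : E n.+1 = euler_sum n by rewrite /tt nd.
by [].
Qed.

(** The integrand of the error tends to 0 pointwise because the left limits exist, and it
is bounded. *)
Lemma euler_cvg : euler_sum n @[n --> \oo] --> x t.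
Proof.
have i0 n s : 0 < s <= t -> `|xl s - lstep t n x s| <= M + M.
  move=> st; apply: le_trans (ler_normB _ _) _; apply: lerD.
    exact: left_value_le.
  have [r [r0 rs _ ->]] := lstepE n x t0 st; apply: xM; rewrite r0 /=.
  by rewrite ltW // (lt_le_trans rs) //; case/andP: st.
have mst n : measurable_fun `]0, t]%classic (fun r => `|xl r - lstep t n x r|).
  apply: measurableT_comp => //; apply: measurable_funB; first exact: measurable_left_value.
  apply: measurable_funTS; apply: measurable_sum => j.
  apply: measurable_funM; last exact: measurable_cst.
  by apply: measurable_indic; exact: measurable_itv.
have cv0 : (\int[leb]_(r in `]0%R, t]) (`|xl r - lstep t n x r|)%:E)%E @[n --> \oo] --> 0%E.
  have := @dominated_convergence _ _ R leb `]0%R, t]%classic (measurable_itv _)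
    (fun n r => (`|xl r - lstep t n x r|)%:E) (cst 0%E) (cst (M + M)%:E).
  case.
  - by move=> n; apply/measurable_EFinP; exact: mst.
  - exact: measurable_cst.
  - apply: aeW => s; rewrite /= in_itv /= => st.
    apply: cvg_EFin; first by apply: nearW.
    rewrite /= -(normr0 R) -(subrr (xl s)).
    apply: cvg_norm; apply: cvgB; first exact: cvg_cst.
    exact: lstep_cvg (x_left st).
  - exact: (@bounded_itv_integrable _ (cst (M + M)) `|M + M|).
  - by apply: aeW => s n; rewrite /= in_itv /= => st; rewrite lee_fin normr_id; exact: i0.
  by move=> _ _; rewrite integral0.
have cvR : kappa * \int[leb]_(r in `]0, t]) `|xl r - lstep t n x r| @[n --> \oo] --> 0.
  have cvf : \int[leb]_(r in `]0, t]) `|xl r - lstep t n x r| @[n --> \oo] --> 0.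
    exact: (fine_cvg cv0).
  have := cvgM (@cvg_cst _ kappa _ \oo _) cvf; rewrite mulr0; exact.
have kd : \forall n \near \oo, kappa * dl n <= 1.
  have [k0|k0] := leP kappa 0.
    by apply: nearW => n; rewrite (le_trans _ ler01) // mulr_le0_ge0 // divr_ge0 // ltW.
  have ki : 0 < kappa^-1 by rewrite invr_gt0.
  have := grid_mesh_small t0 ki; apply: filterS => n hn.
  by rewrite mulrC -ler_pdivlMr // div1r ltW.
move/cvgrPdist_lt : cvR => cvR; apply/cvgrPdist_lt => e e0.
near=> n.
have h1 : kappa * dl n <= 1 by near: n.
have h2 : `|0 - kappa * \int[leb]_(r in `]0, t]) `|xl r - lstep t n x r| | < e.
  by near: n; exact: cvR.
rewrite distrC; apply: le_lt_trans (euler_error h1) _.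
by move: h2; rewrite sub0r normrN; apply: le_lt_trans; exact: ler_norm.
Unshelve. all: by end_near. Qed.

End Euler.

(** * Limits under the cosine transform *)

Section CosLimit.
Variable R : realType.

Lemma cos_lipschitz (a b : R) : `|cos a - cos b| <= `|a - b|.
Proof.
wlog ab : a b / a < b.
  move=> h; have [ab|ba|->] := ltgtP a b; first exact: h.
    by rewrite distrC (distrC a); exact: h.
  by rewrite !subrr.
have [c cab e] : exists2 c, c \in `]a, b[ & cos b - cos a = - sin c * (b - a).
  apply: (@MVT R cos (fun x => - sin x)) => //.
    exact/continuous_subspaceT/continuous_cos.
rewrite distrC e normrM normrN (distrC a) ler_piMl //.
exact: sin_max.
Qed.

Context {dW : measure_display} {W : measurableType dW}.
Variable Q : probability W R.

(** From |D| <= delta + D^2 / delta for all delta > 0. *)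
Lemma integral_norm_cvg0 (D : nat -> W -> R) :
  (forall m, measurable_fun setT (D m)) ->
  (\int[Q]_w (D m w ^+ 2)%:E)%E @[m --> \oo] --> 0%E ->
  (\int[Q]_w `|D m w|%:E)%E @[m --> \oo] --> 0%E.
Proof.
move=> mD h.
have pw e x : 0 < e -> `|x| <= e + e^-1 * x ^+ 2 :> R.
  move=> e0; have : 0 <= (`|x| - e) ^+ 2 by rewrite sqr_ge0.
  rewrite -[x ^+ 2]real_normK ?num_real // => k.
  have n0 : 0 <= `|x| by [].
  rewrite -(ler_pM2l e0) mulrDr mulrA divff ?gt_eqF // mul1r; nra.
have est e m : 0 < e -> (\int[Q]_w `|D m w|%:E <=
    e%:E + (e^-1)%:E * \int[Q]_w (D m w ^+ 2)%:E)%E.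
  move=> e0; apply: (@le_trans _ _ (\int[Q]_w (e%:E + (e^-1)%:E * (D m w ^+ 2)%:E))%E).
    apply: ge0_le_integral => //.
    - apply/measurable_EFinP; exact: measurableT_comp.
    - apply: emeasurable_funD => //; apply: emeasurable_funM => //.
      by apply/measurable_EFinP; exact: measurable_funX.
    - by move=> w _; rewrite -EFinM -EFinD lee_fin; exact: pw.
  rewrite ge0_integralD //; last 3 first.
  - by move=> w _; rewrite lee_fin ltW.
  - by move=> w _; rewrite -EFinM lee_fin mulr_ge0 ?sqr_ge0 // invr_ge0 ltW.
  - apply: emeasurable_funM => //.
    by apply/measurable_EFinP; exact: measurable_funX.
  rewrite integral_cst // [X in (_ * X + _)%E](probability_setT Q) mule1 leeD2l //.
  rewrite ge0_integralZl_EFin ?invr_ge0 ?(ltW e0) //.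
  - by move=> w _; rewrite lee_fin sqr_ge0.
  - by apply/measurable_EFinP; exact: measurable_funX.
have fin0 : \forall m \near \oo, (\int[Q]_w `|D m w|%:E)%E \is a fin_num.
  have /fine_cvgP[fn _] := h; apply: filterS fn => m fm.
  rewrite ge0_fin_numE; last by apply: integral_ge0.
  apply: le_lt_trans (est 1 m ltr01) _.
  by rewrite -(fineK fm) ltry.
apply/fine_cvgP; split=> //; apply/cvgrPdist_le => e e0.
have /fine_cvgP[fn /cvgrPdist_le hc] := h.
have e20 : 0 < e / 2 by rewrite divr_gt0.
near=> m.
have fm : (\int[Q]_w (D m w ^+ 2)%:E)%E \is a fin_num by near: m.
have fm2 : (\int[Q]_w `|D m w|%:E)%E \is a fin_num by near: m.
have : `|0 - fine (\int[Q]_w (D m w ^+ 2)%:E)%E| <= e / 2 * (e / 2).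
  by near: m; apply: hc; rewrite mulr_gt0.
have f0 : 0 <= fine (\int[Q]_w (D m w ^+ 2)%:E)%E.
  by rewrite fine_ge0 // integral_ge0 // => w _; rewrite lee_fin sqr_ge0.
rewrite !sub0r !normrN (ger0_norm f0) => k.
rewrite ger0_norm /=; last by rewrite fine_ge0 // integral_ge0.
have := est _ m e20; rewrite -(fineK fm) -(fineK fm2) -EFinM -EFinD lee_fin /=.
move=> g; apply: le_trans g _.
rewrite [leRHS]splitr lerD2l mulrC ler_pdivrMr //.
Unshelve. all: by end_near. Qed.

(** The cosine is 1-Lipschitz, so L^1 convergence of the exponents suffices. *)
Lemma cos_limit (A : set W) (N : nat) (Ym : nat -> W -> R) (Y : W -> R)
    (G : 'I_N -> R) (D : nat -> 'I_N -> W -> R) (B : R) :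
  measurable A -> (forall m, measurable_fun setT (Ym m)) -> measurable_fun setT Y ->
  (forall m j, measurable_fun setT (D m j)) ->
  (forall m w, `|Y w - Ym m w| <= \sum_(j < N) G j * `|D m j w|) ->
  (forall j, 0 <= G j) ->
  (forall j, (\int[Q]_w (D m j w ^+ 2)%:E)%E @[m --> \oo] --> 0%E) ->
  (forall m, `|\int[Q]_(w in A) cos (Ym m w)| <= B) ->
  `|\int[Q]_(w in A) cos (Y w)| <= B.
Proof.
move=> mA mYm mY mD hD G0 hc hB.
have ic (Z : W -> R) : measurable_fun setT Z -> Q.-integrable A (EFin \o (fun w => cos (Z w))).
  by move=> mZ; apply: integrable_cos => //; exact: measurable_funTS.
have est m : (`|\int[Q]_(w in A) cos (Y w)|%:E <=
    B%:E + \sum_(j < N) (G j)%:E * \int[Q]_w `|D m j w|%:E)%E.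
  have -> : \int[Q]_(w in A) cos (Y w) = \int[Q]_(w in A) cos (Ym m w) +
      \int[Q]_(w in A) (cos (Y w) - cos (Ym m w)).
    by rewrite RintegralB ?ic // addrC subrK.
  apply: (@le_trans _ _ (B + `|\int[Q]_(w in A) (cos (Y w) - cos (Ym m w))|)%:E).
    by rewrite lee_fin (le_trans (ler_normD _ _)) // lerD2r.
  rewrite EFinD leeD2l //.
  have id : Q.-integrable A (EFin \o (fun w => cos (Y w) - cos (Ym m w))).
    by have := integrableB mA (ic _ mY) (ic _ (mYm m)).
  rewrite EFin_normr_Rintegral //; apply: le_trans (le_abse_integral _ mA _) _.
    by case/integrableP : id.
  have mDa j : measurable_fun setT (fun w => `|D m j w|%:E).
    by apply/measurable_EFinP; exact: measurableT_comp.
  apply: (@le_trans _ _ (\int[Q]_w (\sum_(j < N) (G j)%:E * `|D m j w|%:E))%E).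
    apply: (@le_trans _ _ (\int[Q]_(w in A) (\sum_(j < N) (G j)%:E * `|D m j w|%:E))%E).
      apply: ge0_le_integral => //.
      - by apply: measurableT_comp => //; case/integrableP : id.
      - apply: emeasurable_sum => j; apply: emeasurable_funM => //.
        exact: measurable_funTS.
      move=> w _; under eq_bigr do rewrite -EFinM.
      rewrite sumEFin /= lee_fin; apply: le_trans (hD m w).
      exact: cos_lipschitz.
    apply: ge0_subset_integral => //.
    - by apply: emeasurable_sum => j; apply: emeasurable_funM.
    - by move=> w _; apply: sume_ge0 => j _; rewrite -EFinM lee_fin mulr_ge0.
  rewrite ge0_integral_sum //; last 2 first.
  - by move=> j; apply: emeasurable_funM.
  - by move=> j w _; rewrite -EFinM lee_fin mulr_ge0.
  by apply: lee_sum => j _; rewrite ge0_integralZl_EFin.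
have cv : (B%:E + \sum_(j < N) (G j)%:E * \int[Q]_w `|D m j w|%:E)%E @[m --> \oo] --> B%:E.
  have hs : (\sum_(j < N) (G j)%:E * \int[Q]_w `|D m j w|%:E)%E @[m --> \oo] -->
      (\sum_(j < N) (G j)%:E * 0)%E.
    apply: cvg_nnesum => j _.
      by apply: nearW => m; rewrite mule_ge0 ?lee_fin // integral_ge0.
    by apply: cvgeZl => //; apply: integral_norm_cvg0.
  rewrite big1 in hs; last by move=> j _; rewrite mule0.
  rewrite -[X in _ --> X]adde0; apply: cvgeD => //; exact: cvg_cst.
rewrite -lee_fin; by apply: (cvge_ge _ cv); exact: nearW.
Qed.

End CosLimit.

(** * Approximation of the jump integral *)

Section JumpIntegral.
Context {R : realType} {T : R} {d : nat}.
Variables (upsilon : R) (c : 'I_d -> R).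
Variable Pi : {sigma_finite_measure set 'rV[R]_d -> \bar R}.
Hypothesis ub : 1 < upsilon < 2.
Hypothesis c0 : forall j, 0 < c j.
Hypothesis Pi_stable : truncated_stable upsilon c Pi.
Hypothesis T0 : 0 <= T.
Variable P : probability (omega T d) R.
Variable k : 'I_d.
Local Notation Pc := (completion P).
Local Notation leb := (@lebesgue_measure R).

Definition qcoef (eta : R) (p : bool * nat) : R := (-1) ^+ p.1 * (p.2.+1%:R * eta).

(** A deterministic simple integrand that approximates e |-> e_k: the quantization of
the k-th coordinate, constant in time. *)
Definition quant_integrand (eta : R) (K : nat) : simple_integrand R d (omega T d) 1 :=
  ([::], [seq NTerm ord0 0 T (fun=> qcoef eta (s, i)) (cell k eta (s, i)) |
            s <- [:: true; false], i <- iota 0 K]).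

Lemma big_quant_integrand (eta : R) (K : nat) (F : nterm R d (omega T d) 1 -> R) :
  \sum_(y <- (quant_integrand eta K).2) F y =
  \sum_(s : bool) \sum_(i < K)
    F (NTerm ord0 0 T (fun=> qcoef eta (s, i : nat)) (cell k eta (s, i : nat))).
Proof.
rewrite /quant_integrand /= cats0 big_cat /= !big_map big_bool /=.
have e (G : nat -> R) : \sum_(i <- iota 0 K) G i = \sum_(i < K) G i.
  by rewrite -(big_mkord xpredT G) /index_iota subn0.
by rewrite !e.
Qed.

Lemma simple_quant_ok eta K : 0 < eta -> simple_ok T (FP P) (quant_integrand eta K).
Proof.
move=> e0; split=> // j y0.
have ok (y : nterm R d (omega T d) 1) (s : bool) (i : nat) :
    y = NTerm ord0 0 T (fun=> qcoef eta (s, i)) (cell k eta (s, i)) ->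
    nterm_ok T (FP P) y.
  move=> ->; split => //=.
  - move=> C mC t t0; have [Cq|Cq] := pselect (C (qcoef eta (s, i))).
      rewrite (_ : _ @^-1` C = setT); last by apply/seteqP; split.
      exact: (@measurableT _ (g_sigma_algebraType _)).
    rewrite (_ : _ @^-1` C = set0); last by apply/seteqP; split.
    exact: (@measurable0 _ (g_sigma_algebraType _)).
  - by exists `|qcoef eta (s, i)|.
  - exact: cell_off_origin.
have {}ok (l : seq (bool * nat)) : (j < size [seq NTerm ord0 0 T (fun=> qcoef eta q) (cell k eta q) | q <- l])%N ->
   nterm_ok T (FP P) (nth y0 [seq NTerm ord0 0 T (fun=> qcoef eta q) (cell k eta q) | q <- l] j).
  by elim: l j => [//|[s i] l IH] [|j] /=; [move=> _; exact: ok|exact: IH].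
have -> : (quant_integrand eta K).2 = [seq NTerm ord0 0 T (fun=> qcoef eta q) (cell k eta q) |
    q <- [seq (s, i) | s <- [:: true; false], i <- iota 0 K]].
  by rewrite map_allpairs.
exact: ok.
Qed.

Lemma simple_quant_integral eta K t w : 0 <= t <= T ->
  simple_integral Pi (fun _ : 'I_1 => id) (quant_integrand eta K) t w =
  \sum_(s : bool) \sum_(i < K) qcoef eta (s, i : nat) *
    (box_count k eta 0 t (s, i : nat) w - t * fine (Pi (cell k eta (s, i : nat)))).
Proof.
move=> /andP[t0 tT]; rewrite /simple_integral big_nil add0r big_quant_integrand.
apply: eq_bigr => s _; apply: eq_bigr => i _ /=.
by rewrite /compensated min_l // (min_r tT) subr0.
Qed.

Lemma simple_quant_error : exists2 C : R, 0 <= C & forall eta K,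
  0 < eta -> 1 < K.+1%:R * eta ->
  (integrand_norm2 T Pi P
    (fun i r w => (simple_Z (quant_integrand eta K) i r w - 0)%R)
    (fun i r w e => (simple_U (quant_integrand eta K) i r w e - e 0 k)%R) <=
   (C * eta `^ ((2 - upsilon) / 2))%:E)%E.
Proof.
have [C C0 hC] := levy_quant_error ub c0 Pi_stable k.
exists (T * C); first exact: mulr_ge0.
move=> eta K e0 Ke; rewrite /integrand_norm2.
pose D (r : R) := (\int[Pi]_e ((\1_(`]0, T]%classic : set R) r * quant eta K (e 0 k) - e 0 k) ^+ 2)%:E)%E.
have inE (w : omega T d) (r : R) : (\sum_(i < 1)
    ((enorm (simple_Z (quant_integrand eta K) i r w - 0) ^+ 2)%:E +
     \int[Pi]_e ((simple_U (quant_integrand eta K) i r w e - e 0 k) ^+ 2)%:E))%E = D r.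
  rewrite big_ord1 (_ : enorm _ = 0); last first.
    rewrite /simple_Z big_nil subrr /enorm /dot big1 ?sqrtr0 // => i _.
    by rewrite mxE mulr0.
  rewrite expr0n /= add0e; apply: eq_integral => e _; congr ((_ - _) ^+ 2)%:E.
  rewrite /simple_U big_mkcond big_quant_integrand quant_cells mulr_sumr.
  apply: eq_bigr => s _; rewrite mulr_sumr; apply: eq_bigr => i _ /=.
  by rewrite !mulrA.
have D0 r : (0 <= D r)%E by apply: integral_ge0 => e _; rewrite lee_fin sqr_ge0.
pose D1 := (\int[Pi]_e ((quant eta K (e 0%R k) - e 0%R k) ^+ 2)%:E)%E.
have DE r : 0 < r <= T -> D r = D1.
  by move=> rT; apply: eq_integral => e _; rewrite indicE mem_set ?mul1r.
have D1le : (D1 <= (C * eta `^ ((2 - upsilon) / 2))%:E)%E by exact: hC.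
have mDr : measurable_fun `]0, T]%classic D.
  apply: (eq_measurable_fun (cst D1)); last exact: measurable_cst.
  by move=> r; rewrite mem_setE /= in_itv /= => /DE.
have inner (w : omega T d) : (\int[leb]_(r in `[0%R, T]) (\sum_(i < 1)
    ((enorm (simple_Z (quant_integrand eta K) i r w - 0) ^+ 2)%:E +
     \int[Pi]_e ((simple_U (quant_integrand eta K) i r w e - e 0 k) ^+ 2)%:E)))%E =
   (D1 * T%:E)%E.
  under eq_integral do rewrite inE.
  rewrite -integral_itv_obnd_cbnd // (eq_integral (cst D1)); last first.
    by move=> r; rewrite mem_setE /= in_itv /= => /DE.
  have lE : leb `]0, T]%classic = T%:E.
    rewrite lebesgue_measure_itv /= lte_fin.
    case: ltP => [_|T1]; first by rewrite -EFinD subr0.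
    by congr EFin; apply/le_anti; rewrite T0.
  by rewrite integral_cst //; congr (_ * _)%E; exact: lE.
under eq_integral do rewrite inner.
rewrite integral_cst // [X in (_ * X <= _)%E](probability_setT Pc) mule1 muleC.
by rewrite -mulrA EFinM; apply: lee_wpmul2l.
Qed.

Lemma measurable_box_count eta t p : 0 < eta -> 0 <= t <= T ->
  measurable_fun setT (box_count (T := T) k eta 0 t p).
Proof.
move=> e0 /andP[t0 tT]; apply: measurableT_comp; first exact: fine_measurable.
have h := @measurable_jumps_gen R T d 0 t (cell k eta p) (lexx _) tT (cell_off_origin k p e0).
move=> _ S mS; rewrite setTI; apply: sub_gen_N.
by rewrite -[X in <<s _ >> X]setTI; exact: h.
Qed.

End JumpIntegral.

(** * Decay of the cosine transform for a linear equation *)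

Section CosDominated.
Context {dW : measure_display} {W : measurableType dW} {R : realType}.
Variable Q : probability W R.

Lemma Rintegral_cos_cvg (A : set W) (Yn : nat -> W -> R) (Y : W -> R) :
  measurable A -> (forall n, measurable_fun setT (Yn n)) -> measurable_fun setT Y ->
  {ae Q, forall w, Yn n w @[n --> \oo] --> Y w} ->
  \int[Q]_(w in A) cos (Yn n w) @[n --> \oo] --> \int[Q]_(w in A) cos (Y w).
Proof.
move=> mA mYn mY cY.
have [||||| _ _ cv] := @dominated_convergence _ _ R Q A mA
  (fun n w => (cos (Yn n w))%:E) (fun w => (cos (Y w))%:E) (cst 1%E).
- move=> n; apply/measurable_EFinP.
  by apply: (measurable_cos_comp (Y := Yn n)); exact: measurable_funTS.
- apply/measurable_EFinP.
  by apply: (measurable_cos_comp (Y := Y)); exact: measurable_funTS.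
- apply: filterS cY => w cw _; apply: cvg_EFin; first exact: nearW.
  exact: (cvg_comp _ _ cw (@continuous_cos R (Y w))).
- by apply: (@bounded_integrable _ _ _ Q A (cst 1) 1) => // w _; rewrite normr1.
- by apply: aeW => w n _; rewrite lee_fin cos_max.
have fn : (\int[Q]_(w in A) (cos (Y w))%:E)%E \is a fin_num.
  by apply: integrable_fin_num => //; apply: integrable_cos => //; exact: measurable_funTS.
by apply: fine_cvg; rewrite /Rintegral fineK.
Qed.

(** Both integrals agree with the integral over the union. *)
Lemma Rintegral_null_diff (A B : set W) (f : W -> R) :
  measurable A -> measurable B -> Q (A `\` B) = 0%E -> Q (B `\` A) = 0%E ->
  Q.-integrable setT (EFin \o f) -> \int[Q]_(w in A) f w = \int[Q]_(w in B) f w.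
Proof.
move=> mA mB AB BA fi.
have key (D N : set W) : measurable D -> measurable N -> Q (N `\` D) = 0%E ->
    (\int[Q]_(w in D `|` N) (f w)%:E = \int[Q]_(w in D) (f w)%:E)%E.
  move=> mD mN ND0; have mDN : measurable (D `|` N) by exact: measurableU.
  have mN' : measurable (N `\` D) by exact: measurableD.
  rewrite (negligible_integral mN' mDN _ ND0); last exact: integrableS fi.
  congr integral; apply/seteqP; split => w /=.
    by move=> [[//|Nw] h]; apply: contrapT => nD; apply: h.
  by move=> Dw; split; [left|case].
by rewrite /Rintegral -(key _ _ mA mB BA) -(key _ _ mB mA AB) setUC.
Qed.

Lemma measure_null_diff (A B : set W) :
  measurable A -> measurable B -> Q (A `\` B) = 0%E -> Q (B `\` A) = 0%E -> Q A = Q B.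
Proof.
move=> mA mB AB BA.
have key (D N : set W) : measurable D -> measurable N -> Q (N `\` D) = 0%E ->
    (Q N <= Q D)%E.
  move=> mD mN ND0; apply: (@le_trans _ _ (Q (D `|` (N `\` D)))).
    apply: le_measure; rewrite ?inE //; first exact: measurableU (measurableD _ _).
    by move=> w Nw; have [Dw|nD] := EM (D w); [left|right].
  apply: le_trans (measureU2 _ mD (measurableD mN mD)) _.
  by rewrite [X in (_ + X)%E]ND0 adde0.
by apply/eqP; rewrite eq_le !key.
Qed.

End CosDominated.

Lemma expR_decay_cvg (R : realType) (C a l : R) (y : nat -> R) : y n @[n --> \oo] --> l ->
  C * expR (- (a * y n)) @[n --> \oo] --> C * expR (- (a * l)).
Proof.
move=> yl; apply: cvgM; first exact: cvg_cst.
have c1 : - (a * y n) @[n --> \oo] --> - (a * l).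
  by apply: cvgN; apply: cvgM => //; exact: cvg_cst.
apply: (continuous_cvg _ (@continuous_expR R _)).
exact: c1.
Qed.

(** From 1 - y >= exp (- 2 y) for y <= 1 / 2. It bounds the Euler weights below uniformly
in the number of steps. *)
Lemma one_sub_pow_ge (R : realType) (y : R) (n : nat) : 0 <= y -> y <= 2^-1 ->
  expR (- (2 * (n%:R * y))) <= (1 - y) ^+ n.
Proof.
move=> y0 y2.
have h : expR (- (2 * y)) <= 1 - y.
  have y1 : 0 < 1 - y by lra.
  rewrite expRN -[leRHS]invrK lef_pV2 ?posrE ?expR_gt0 ?invr_gt0 //.
  apply: le_trans (expR_ge1Dx (2 * y)).
  rewrite -(ler_pM2r y1) mulVf ?gt_eqF //; nra.
rewrite (_ : - (2 * (n%:R * y)) = n%:R * (- (2 * y))); last by ring.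
by rewrite expRM_natl; apply: lerXn2r => //; rewrite nnegrE ?expR_ge0 //; lra.
Qed.

Section MeasurableDrivers.
Context {dS : measure_display} {S : measurableType dS} {R : realType}.

Lemma measurable_scale (a : R) (f : S -> R) :
  measurable_fun setT f -> measurable_fun setT (fun w => a * f w).
Proof. by move=> mf; exact: measurable_funM. Qed.

Lemma integrable_cos_scale (Q : probability S R) (a : R) (f : S -> R) :
  measurable_fun setT f -> Q.-integrable setT (EFin \o (fun w => cos (a * f w))).
Proof. by move=> mf; apply: integrable_cos => //; exact: measurable_scale. Qed.

Lemma measurable_driver_sum (f1 f2 f3 : S -> R) (b e : R) :
  measurable_fun setT f1 -> measurable_fun setT f2 -> measurable_fun setT f3 ->
  measurable_fun setT (fun w => f1 w + b + e * f2 w + f3 w).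
Proof.
move=> m1 m2 m3; apply: measurable_funD => //; apply: measurable_funD.
  exact: measurable_funD.
exact: measurable_funM.
Qed.

Lemma measurable_affine_sum (lambda a b e : R) (n : nat) (q z : 'I_n -> R)
    (f0 f1 : S -> R) (g1 g2 : 'I_n -> S -> R) :
  measurable_fun setT f0 -> measurable_fun setT f1 ->
  (forall j, measurable_fun setT (g1 j)) -> (forall j, measurable_fun setT (g2 j)) ->
  measurable_fun setT (fun w => lambda * (a * (f0 w + b + e * f1 w) +
    \sum_(j < n) q j * (z j + e * (g1 j w - g2 j w)))).
Proof.
move=> m0 m1 mg1 mg2.
apply: measurable_funM => //; apply: measurable_funD.
  apply: measurable_funM => //; apply: measurable_funD => //.
    exact: measurable_funD.
  exact: measurable_funM.
apply: measurable_sum => j; apply: measurable_funM => //; apply: measurable_funD => //.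
by apply: measurable_funM => //; apply: measurable_funB.
Qed.

Lemma measurable_euler_sum (kappa t lambda T : R) (n : nat) (g : S -> R -> R) :
  0 < t -> t <= T ->
  (forall s, 0 <= s <= T -> measurable_fun setT (g ^~ s)) ->
  measurable_fun setT (fun w => lambda * euler_sum kappa t (g w) n).
Proof.
move=> t0 tT mg.
have dl0 : 0 < t / n.+1%:R by rewrite divr_gt0.
have nd : n.+1%:R * (t / n.+1%:R) = t by field; rewrite nat1r.
have itv j : (j <= n.+1)%N -> 0 <= j%:R * (t / n.+1%:R) <= T.
  move=> jn; rewrite mulr_ge0 ?(ltW dl0) //=; apply: le_trans tT.
  by rewrite -[leRHS]nd ler_pM2r // ler_nat.
apply: measurable_funM => //; apply: measurable_funD.
  by apply: measurable_funM => //; apply: mg; rewrite lexx (le_trans (ltW t0)).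
apply: measurable_sum => j; apply: measurable_funM => //.
by apply: measurable_funB; apply: mg; apply: itv; rewrite // ltnW.
Qed.

End MeasurableDrivers.

Section SolutionCharacteristic.
Context {R : realType} {T : R} {d : nat}.
Variables (upsilon : R) (c : 'I_d -> R).
Variable Pi : {sigma_finite_measure set 'rV[R]_d -> \bar R}.
Hypothesis ub : 1 < upsilon < 2.
Hypothesis c0 : forall j, 0 < c j.
Hypothesis Pi_stable : truncated_stable upsilon c Pi.
Hypothesis T0 : 0 <= T.
Variable P : probability (omega T d) R.
Hypothesis PRM : poisson_random_measure Pi P.
Hypothesis ind : independent_coordinates P.
Variable k : 'I_d.
Local Notation Pc := (completion P).
Local Notation Wc := (completed P).
Local Notation leb := (@lebesgue_measure R).

Variables (kappa eps : R) (x xl J : R -> omega T d -> R) (beta : R -> R).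
Hypothesis kappa0 : 0 <= kappa.
Hypothesis mx : forall t, 0 <= t <= T -> measurable_fun setT (x t : Wc -> R).
Hypothesis mJ : forall t, 0 <= t <= T -> measurable_fun setT (J t : Wc -> R).
Hypothesis x_left : forall w t, 0 < t <= T -> x s w @[s --> t^'-] --> xl t w.
Hypothesis x_bounded : {ae Pc, forall w : Wc, exists M, forall t, 0 <= t <= T -> `|x t w| <= M}.
Hypothesis x_eq : {ae Pc, forall w : Wc, forall t, 0 <= t <= T ->
  x t w = coord_xi w 0 k + beta t + eps * coord_B w t 0 k + J t w -
    kappa * \int[leb]_(r in `]0, t]) xl r w}.
Hypothesis J_int : stochastic_integral Pi P (FP P) (fun _ : 'I_1 => id)
  (fun _ _ _ => 0) (fun _ _ _ e => e 0 k) J.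

(** The lower bound exp (- 2 kappa T) for the Euler weights enters as the amin of
disc_chfmod. *)
Definition decay_rate : R :=
  2 * expR (- 1) * (1 - cos (expR (- (2 * (kappa * T))) / 4)) * (c k / 2).

Lemma decay_rate_gt0 : 0 < decay_rate.
Proof.
apply: mulr_gt0; last by rewrite divr_gt0.
apply: mulr_gt0; first by rewrite mulr_gt0 ?expR_gt0.
set y := _ / 4.
have y0 : 0 < y by rewrite divr_gt0 ?expR_gt0.
have ypi : y <= pi.
  rewrite /y ler_pdivrMr //; apply: (@le_trans _ _ 1).
    by rewrite expR_le1 oppr_le0 !mulr_ge0.
  by have := pi_ge2 R; lra.
by rewrite subr_gt0 -cos0 ltr_cos // in_itv /= ?lexx ?pi_ge0 // ypi ltW.
Qed.

Section FixedTime.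
Variables (u t lambda : R) (A : set (omega T d)).
Hypothesis u0 : 0 <= u.
Hypothesis ut : u < t.
Hypothesis tT : t <= T.
Hypothesis l1 : 1 <= lambda.
Hypothesis rA : raw_filtration u A.

Let t0 : 0 < t. Proof. exact: le_lt_trans ut. Qed.
Let l0 : 0 < lambda. Proof. exact: lt_le_trans l1. Qed.

Let driver (w : omega T d) (s : R) : R :=
  coord_xi w 0 k + beta s + eps * coord_B w s 0 k + J s w.

(** With this step the sizes 1 / (2 lambda) and 1 / lambda are multiples of the step, as
levy_mass_lower requires. *)
Let eta (m : nat) : R := (2 * m.+1%:R * lambda)^-1.
(** Large enough for the quantization to cover the jumps up to size 1, and for the
levels up to 2 (m + 1) to exist. *)
Let K (m : nat) : nat := (Num.truncn (eta m)^-1 + m.+1.*2)%N.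
Let S (m : nat) : simple_integrand R d (omega T d) 1 := quant_integrand k (eta m) (K m).

Let eta0 m : 0 < eta m.
Proof. by rewrite invr_gt0 !mulr_gt0. Qed.

Let etaK m : 1 < (K m).+1%:R * eta m.
Proof.
rewrite -ltr_pdivrMr // div1r; apply: lt_le_trans (truncnS_gt _) _.
by rewrite ler_nat ltnS leq_addr.
Qed.

Let Iint m s w := simple_integral Pi (fun _ : 'I_1 => id) (S m) s w.

Let eta_cvg0 : eta m @[m --> \oo] --> 0.
Proof.
apply/cvgrPdist_lt => e e0; near=> m.
rewrite sub0r normrN ger0_norm; last exact: ltW.
have h : (2 * lambda)^-1 / m.+1%:R < e.
  by near: m; apply: grid_mesh_small => //; rewrite invr_gt0 mulr_gt0.
apply: le_lt_trans h; rewrite /eta le_eqVlt; apply/orP; left; apply/eqP.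
by rewrite mulrAC invfM.
Unshelve. all: by end_near. Qed.

Let Iint_cvg s : 0 <= s <= T ->
  (\int[Pc]_w ((Iint m s w - J s w) ^+ 2)%:E)%E @[m --> \oo] --> 0%E.
Proof.
move=> sT; have [_ _ h] := J_int; apply: h => //.
  by move=> m; exact: simple_quant_ok.
have [C C0 hC] := simple_quant_error ub c0 Pi_stable T0 P k.
have /andP[u1 u2] := ub.
pose a : R := (2 - upsilon) / 2.
have a0 : 0 < a by rewrite /a; lra.
have cv : (C * eta m `^ a)%:E @[m --> \oo] --> 0%E.
  apply: cvg_EFin; first exact: nearW.
  have h : eta m `^ a @[m --> \oo] --> 0.
    apply: (@cvg_comp _ _ _ eta (fun y => y `^ a) \oo (0:R)^'+).
      move=> B [e /= e0 hB]; move/cvgrPdist_lt : eta_cvg0 => /(_ _ e0).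
      by apply: filterS => m hm; apply: hB.
    exact: powR_cvg0.
  by have := cvgM (@cvg_cst _ C _ \oo _) h; rewrite mulr0; exact.
apply: (squeeze_cvge _ (cvg_cst 0%E) cv); apply: nearW => m.
apply/andP; split; last exact: hC.
apply: integral_ge0 => w _; apply: integral_ge0 => r _; apply: sume_ge0 => i _.
apply: adde_ge0; first by rewrite lee_fin sqr_ge0.
by apply: integral_ge0 => e _; rewrite lee_fin sqr_ge0.
Qed.

Let Im_mes m s : 0 <= s <= T -> measurable_fun setT (Iint m s : Wc -> R).
Proof.
move=> sT; apply: completed_measurable_fun.
have -> : Iint m s = fun w => \sum_(b : bool) \sum_(i < K m) qcoef (eta m) (b, i : nat) *
    (box_count k (eta m) 0 s (b, i : nat) w - s * fine (Pi (cell k (eta m) (b, i : nat)))).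
  by apply/funext => w; exact: simple_quant_integral.
apply: measurable_sum => b; apply: measurable_sum => i.
apply: measurable_funM => //; apply: measurable_funB => //.
exact: measurable_box_count.
Qed.

Let driver_m (m : nat) (w : omega T d) (s : R) : R :=
  coord_xi w 0 k + beta s + eps * coord_B w s 0 k + Iint m s w.

Let tt (n j : nat) : R := j%:R * (t / n.+1%:R).

Let tt_itv n j : (j <= n.+1)%N -> 0 <= tt n j <= T.
Proof.
move=> jn; have dl0 : 0 < t / n.+1%:R by rewrite divr_gt0.
rewrite mulr_ge0 ?(ltW dl0) //=; apply: le_trans tT.
have nd : n.+1%:R * (t / n.+1%:R) = t by field; rewrite nat1r.
by rewrite -[leRHS]nd ler_pM2r // ler_nat.
Qed.

(** The part of the Euler sum of the approximate driver that does not depend on the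
jumps: initial value, drift, path and compensator. *)
Let Y0 (m n : nat) (w : omega T d) : R := lambda *
  ((1 - kappa * (t / n.+1%:R)) ^+ n.+1 * (coord_xi w 0 k + beta 0 + eps * coord_B w 0 0 k) +
   \sum_(j < n.+1) (1 - kappa * (t / n.+1%:R)) ^+ (n - j) *
     (beta (tt n j.+1) - beta (tt n j) +
      eps * (coord_B w (tt n j.+1) 0 k - coord_B w (tt n j) 0 k) -
      t / n.+1%:R * \sum_(b : bool) \sum_(i < K m) qcoef (eta m) (b, i : nat) *
         fine (Pi (cell k (eta m) (b, i : nat))))).

Let box_count_diff m s1 s2 p (w : omega T d) : 0 <= s1 -> s1 <= s2 -> s2 <= T ->
  box_count k (eta m) 0 s2 p w - box_count k (eta m) 0 s1 p w =
  box_count k (eta m) s1 s2 p w.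
Proof.
move=> s10 s12 s2T; rewrite /box_count /box.
have oC := cell_off_origin k p (eta0 m).
rewrite (jumps_stripE w s10 s12 s2T oC) fineB //.
- by rewrite ge0_fin_numE //; apply: jumps_strip_lty.
- by rewrite ge0_fin_numE //; apply: jumps_strip_lty => //; exact: le_trans s2T.
Qed.

Let driver_mE m n w : lambda * euler_sum kappa t (driver_m m w) n =
  Y0 m n w + \sum_(j < n.+1) \sum_(b : bool) \sum_(i < K m)
    lambda * (1 - kappa * (t / n.+1%:R)) ^+ (n - j) * ((-1) ^+ b * (i.+1%:R * eta m)) *
      box_count k (eta m) (tt n j) (tt n j.+1) (b, i : nat) w.
Proof.
have I0 : Iint m 0 w = 0.
  rewrite /Iint simple_quant_integral ?lexx //; apply: big1 => b _; apply: big1 => i _.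
  rewrite mul0r subr0 /box_count /box set_itv_ge ?bnd_simp ?ltxx //.
  by rewrite set0X measure0 mulr0.
rewrite /euler_sum /Y0 /driver_m I0 addr0.
pose Z (j : nat) := \sum_(b : bool) \sum_(i < K m) qcoef (eta m) (b, i : nat) *
  box_count k (eta m) (tt n j) (tt n j.+1) (b, i : nat) w.
have -> : \sum_(j < n.+1) \sum_(b : bool) \sum_(i < K m)
    lambda * (1 - kappa * (t / n.+1%:R)) ^+ (n - j) * ((-1) ^+ b * (i.+1%:R * eta m)) *
      box_count k (eta m) (tt n j) (tt n j.+1) (b, i : nat) w =
    lambda * \sum_(j < n.+1) (1 - kappa * (t / n.+1%:R)) ^+ (n - j) * Z j.
  set q := 1 - kappa * _.
  rewrite mulr_sumr; apply: eq_bigr => j _; rewrite mulrA /Z mulr_sumr.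
  apply: eq_bigr => b _; rewrite mulr_sumr; apply: eq_bigr => i _.
  by rewrite /qcoef mulrA.
rewrite -mulrDr; congr (lambda * _).
rewrite -[RHS]addrA; congr (_ + _); rewrite -big_split /=; apply: eq_bigr => j _.
rewrite -mulrDr; congr (_ * _).
have j1 := tt_itv (ltn_ord j); have j0 := tt_itv (ltnW (ltn_ord j)).
have IE : Iint m (tt n j.+1) w - Iint m (tt n j) w =
    Z j - t / n.+1%:R * \sum_(b : bool) \sum_(i < K m) qcoef (eta m) (b, i : nat) *
         fine (Pi (cell k (eta m) (b, i : nat))).
  rewrite /Iint !simple_quant_integral // /Z mulr_sumr -!sumrB; apply: eq_bigr => b _.
  rewrite mulr_sumr -!sumrB; apply: eq_bigr => i _.
  rewrite -(@box_count_diff m (tt n j) (tt n j.+1)); [|by case/andP: j0| |by case/andP: j1].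
    have -> : tt n j.+1 = tt n j + t / n.+1%:R by rewrite /tt -natr1; ring.
    ring.
  by rewrite /tt ler_wpM2r ?ler_nat // divr_ge0 // ltW.
rewrite -/(tt n j) -/(tt n j.+1).
have := IE; set I1 := Iint m (tt n j.+1) w; set I2 := Iint m (tt n j) w; set ZZ := Z j.
set CC := t / n.+1%:R * _; move=> IE'.
rewrite (_ : ZZ = I1 - I2 + CC); last by rewrite IE'; ring.
ring.
Qed.

Let mB s : 0 <= s <= T -> measurable_fun setT (fun w : Wc => coord_B w s 0 k).
Proof.
by move=> sT; apply: (@measurable_of_gen_off R T d T0 P set0); exact: measurable_path_gen_off.
Qed.

Let mxi : measurable_fun setT (fun w : Wc => coord_xi w 0 k).
Proof.
by apply: (@measurable_of_gen_off R T d T0 P set0); exact: measurable_xi_gen_off.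
Qed.

Let driver_measurable s : 0 <= s <= T -> measurable_fun setT (fun w : Wc => driver w s).
Proof. by move=> sT; exact: (measurable_driver_sum (beta s) eps mxi (mB sT) (mJ sT)). Qed.

Let driver_m_measurable m s : 0 <= s <= T ->
  measurable_fun setT (fun w : Wc => driver_m m w s).
Proof. by move=> sT; exact: (measurable_driver_sum (beta s) eps mxi (mB sT) (Im_mes m sT)). Qed.

Let mA : measurable (A : set Wc).
Proof.
apply: (@completed_measurable _ _ _ P).
exact: (raw_filtration_sub T0 rA).
Qed.

Let driver_bound n : kappa * (t / n.+1%:R) <= 2^-1 ->
  t / n.+1%:R * fine (Pi (cell k (2 * lambda)^-1 (false, 0%N))) <= 1 ->
  `|\int[Pc]_(w in A) cos (lambda * euler_sum kappa t (driver w) n)| <=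
  fine (Pc A) * expR (- (decay_rate * lambda `^ upsilon * (t - u - t / n.+1%:R))).
Proof.
move=> kd small; set q := 1 - kappa * (t / n.+1%:R).
have dl0 : 0 < t / n.+1%:R by rewrite divr_gt0.
have nd : n.+1%:R * (t / n.+1%:R) = t by field; rewrite nat1r.
have kd0 : 0 <= kappa * (t / n.+1%:R) by rewrite mulr_ge0 // ltW.
have q0 : 0 <= q by rewrite subr_ge0 (le_trans kd) // invf_le1 ?ler1n.
have q1 : q <= 1 by rewrite gerBl.
pose D (m : nat) (j : 'I_n.+2) (w : Wc) : R := Iint m (tt n j) w - J (tt n j) w.
apply: (@cos_limit R _ Wc Pc A n.+2
  (fun m w => lambda * euler_sum kappa t (driver_m m w) n) _ (fun=> 3 * lambda) D).
- exact: mA.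
- by move=> m; exact: (measurable_euler_sum kappa lambda n t0 tT (@driver_m_measurable m)).
- exact: (measurable_euler_sum kappa lambda n t0 tT driver_measurable).
- move=> m j; have jn : (j <= n.+1)%N by rewrite -ltnS.
  exact: (measurable_funB (Im_mes m (tt_itv jn)) (mJ (tt_itv jn))).
- move=> m w; rewrite -mulrBr normrM (gtr0_norm l0) -mulr_sumr [3 * lambda]mulrC -mulrA.
  rewrite ler_pM2l //.
  pose e (j : nat) := J (tt n j) w - Iint m (tt n j) w.
  have tt0 : tt n 0 = 0 by rewrite /tt mul0r.
  have -> : euler_sum kappa t (driver w) n - euler_sum kappa t (driver_m m w) n =
      q ^+ n.+1 * e 0%N + \sum_(j < n.+1) q ^+ (n - j) * (e j.+1 - e j).
    rewrite /euler_sum opprD addrACA -sumrB; congr (_ + _).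
      by rewrite -mulrBr /e tt0 /driver /driver_m; congr (_ * _); ring.
    apply: eq_bigr => j _; rewrite -mulrBr; congr (_ * _).
    by rewrite /e /driver /driver_m; ring.
  have eD (j : 'I_n.+2) : `|e j| = `|D m j w| by rewrite /e /D distrC.
  have qe i y : `|q ^+ i * y| <= `|y|.
    by rewrite normrM ger0_norm ?exprn_ge0 // ler_piMl // exprn_ile1.
  have s1 : `|e 0%N| <= \sum_(j < n.+2) `|D m j w|.
    rewrite big_ord_recl -[X in _ <= X + _](eD ord0) lerDl; exact: sumr_ge0.
  have s2 : \sum_(j < n.+1) `|e j.+1| <= \sum_(j < n.+2) `|D m j w|.
    under [leRHS]eq_bigr do rewrite -eD.
    by rewrite [leRHS]big_ord_recl lerDr.
  have s3 : \sum_(j < n.+1) `|e j| <= \sum_(j < n.+2) `|D m j w|.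
    under [leRHS]eq_bigr do rewrite -eD.
    by rewrite [leRHS]big_ord_recr lerDl.
  apply: le_trans (ler_normD _ _) _.
  have s4 : `|\sum_(j < n.+1) q ^+ (n - j) * (e j.+1 - e j)| <=
      \sum_(j < n.+1) `|e j.+1| + \sum_(j < n.+1) `|e j|.
    apply: le_trans (ler_norm_sum _ _ _) _; rewrite -big_split /=.
    apply: ler_sum => j _; apply: le_trans (qe _ _) _; exact: ler_normB.
  have := qe n.+1 (e 0%N); lra.
- by move=> _; rewrite mulr_ge0 // ltW.
- by move=> j; apply: Iint_cvg; apply: tt_itv; rewrite -ltnS.
move=> m.
apply: le_trans (chfmod_cos _ _ _) _.
rewrite (@chfmod_eq _ Wc R Pc A _ _ (fun w _ => @driver_mE m n w)).
have h := @disc_chfmod R T d upsilon c Pi ub c0 Pi_stable T0 P PRM ind k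
  lambda (eta m) (expR (- (2 * (kappa * T)))) u t n.+1 (K m) m.+1 (fun j => q ^+ (n - j)) A (Y0 m n).
rewrite (_ : decay_rate * _ * _ = 2 * expR (- 1) * (1 - cos (expR (- (2 * (kappa * T))) / 4)) *
  (c k / 2 * lambda `^ upsilon) * (t - u - t / n.+1%:R)); last by rewrite /decay_rate; ring.
apply: h => //.
- by rewrite leq_addl.
- exact: ltW.
- move=> j jn; apply/andP; split; last exact: exprn_ile1.
  apply: le_trans (one_sub_pow_ge (n - j) kd0 kd); rewrite ler_expR lerN2.
  rewrite ler_pM2l // mulrCA ler_wpM2l // (le_trans _ tT) //.
  rewrite -[leRHS]nd ler_pM2r // ler_nat; apply: leq_trans (leq_subr _ _) _ => //.
- move=> C; have T00 : (0:R) <= 0 <= T by apply/andP.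
  have h0 := @measurable_xi_gen_off R T d k C.
  have h1 := @measurable_path_gen_off R T d 0 k C T00.
  have h2 (j : 'I_n.+1) := @measurable_path_gen_off R T d _ k C (@tt_itv n j.+1 (ltn_ord j)).
  have h3 (j : 'I_n.+1) := @measurable_path_gen_off R T d _ k C (@tt_itv n j (ltnW (ltn_ord j))).
  pose zz (j : 'I_n.+1) := beta (tt n j.+1) - beta (tt n j) -
      t / n.+1%:R * \sum_(b : bool) \sum_(i < K m) qcoef (eta m) (b, i : nat) *
         fine (Pi (cell k (eta m) (b, i : nat))).
  have := @measurable_affine_sum _ _ _ lambda (q ^+ n.+1) (beta 0) eps n.+1
    (fun j => q ^+ (n - j)) zz _ _ _ _ h0 h1 h2 h3.
  congr measurable_fun; apply/funext => w; rewrite /Y0; congr (_ * (_ + _)).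
  by apply: eq_bigr => j _; congr (_ * _); rewrite /zz addrAC.
Qed.

Let mesh_cvg0 : t / n.+1%:R @[n --> \oo] --> 0.
Proof.
apply/cvgrPdist_lt => e e0; near=> n.
rewrite sub0r normrN ger0_norm ?divr_ge0 ?(ltW t0) //.
by near: n; exact: grid_mesh_small.
Unshelve. all: by end_near. Qed.

Let mesh_mul_small (a e : R) : 0 <= a -> 0 < e ->
  \forall n \near \oo, t / n.+1%:R * a <= e.
Proof.
move=> a0 e0; have a1 : 0 < a + 1 by rewrite ltr_wpDl.
near=> n.
have h : t / n.+1%:R < e / (a + 1) by near: n; apply: grid_mesh_small; rewrite ?divr_gt0.
have d0 : 0 <= t / n.+1%:R by rewrite divr_ge0 // ltW.
apply: (@le_trans _ _ (t / n.+1%:R * (a + 1))); first by rewrite ler_wpM2l // lerDl.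
by rewrite -ler_pdivlMr // ltW.
Unshelve. all: by end_near. Qed.

(** Limit of driver_bound as the mesh of the Euler scheme tends to 0. *)
Lemma raw_chf :
  `|\int[Pc]_(w in A) cos (lambda * x t w)| <=
  fine (Pc A) * expR (- (decay_rate * lambda `^ upsilon * (t - u))).
Proof.
have tT0 : 0 <= t <= T by rewrite ltW.
have cvL : \int[Pc]_(w in A) cos (lambda * euler_sum kappa t (driver w) n) @[n --> \oo] -->
    \int[Pc]_(w in A) cos (lambda * x t w).
  apply: (@Rintegral_cos_cvg _ Wc R Pc A).
  - exact: mA.
  - by move=> n; exact: (measurable_euler_sum kappa lambda n t0 tT driver_measurable).
  - exact: (measurable_scale lambda (mx tT0)).
  - move: x_bounded x_eq; apply: filterS2 => w [M xM] xE.
    apply: cvgM; first exact: cvg_cst.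
    apply: (@euler_cvg R kappa t M (x ^~ w) (xl ^~ w) (driver w) kappa0 t0).
    + by move=> s /andP[s0 st]; rewrite /= xE // s0 (le_trans st).
    + by move=> s /andP[s0 st]; apply: xM; rewrite s0 (le_trans st).
    + by move=> s /andP[s0 st]; apply: x_left; rewrite s0 (le_trans st).
have cvR : fine (Pc A) * expR (- (decay_rate * lambda `^ upsilon * (t - u - t / n.+1%:R)))
    @[n --> \oo] --> fine (Pc A) * expR (- (decay_rate * lambda `^ upsilon * (t - u))).
  apply: expR_decay_cvg.
  by have := cvgB (@cvg_cst _ (t - u) _ \oo _) mesh_cvg0; rewrite subr0; exact.
have n1 : \forall n \near \oo, t / n.+1%:R * kappa <= 2^-1.
  by apply: mesh_mul_small => //; rewrite invr_gt0.
have n2 : \forall n \near \oo,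
    t / n.+1%:R * fine (Pi (cell k (2 * lambda)^-1 (false, 0%N))) <= 1.
  by apply: mesh_mul_small => //; exact: fine_ge0.
apply: (ler_cvg_to (cvg_norm cvL) cvR).
move: n1 n2; apply: filterS2 => n; rewrite mulrC => h1 h2.
exact: driver_bound.
Qed.

End FixedTime.

(** Up to a null set, A belongs to the raw past of the time halfway between s and t; the
right-continuous augmentation costs the factor 1 / 2. *)
Lemma augmented_chf (s t lambda : R) (A : set (omega T d)) :
  0 <= s -> s < t -> t <= T -> 1 <= lambda -> FP P s A ->
  `|\int[Pc]_(w in A) cos (lambda * x t w)| <=
  fine (Pc A) * expR (- (decay_rate * lambda `^ upsilon * ((t - s) / 2))).
Proof.
move=> s0 st tT l1 FA.
(* any raw time strictly between s and t would do *)
pose u := (s + t) / 2.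
have su : s < u by rewrite /u ltr_pdivlMr //; lra.
have ut : u < t by rewrite /u ltr_pdivrMr //; lra.
have [B rB nAB] := augmented_approx (smallest_sigma_algebra _ _) (FA _ su).
have h := raw_chf (le_trans s0 (ltW su)) ut tT l1 rB.
have mB : measurable (B : set Wc).
  by apply: (@completed_measurable _ _ _ P); exact: (raw_filtration_sub T0 rB).
have mA : measurable (A : set Wc) by exact: (FP_measurable T0 FA).
have [mD D0] := completed_negligible nAB.
have tT0 : 0 <= t <= T by rewrite (le_trans s0 (ltW st)).
have mC : Pc.-integrable setT (EFin \o (fun w : Wc => cos (lambda * x t w))).
  exact: (integrable_cos_scale Pc lambda (mx tT0)).
have [mAB mBA] : measurable (A `\` B : set Wc) /\ measurable (B `\` A : set Wc).
  by split; exact: measurableD.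
have AB0 : Pc (A `\` B) = 0%E.
  apply/eqP; rewrite eq_le measure_ge0 andbT -D0.
  by apply: le_measure; rewrite ?inE //; exact: subsetUl.
have BA0 : Pc (B `\` A) = 0%E.
  apply/eqP; rewrite eq_le measure_ge0 andbT -D0.
  by apply: le_measure; rewrite ?inE //; exact: subsetUr.
rewrite (Rintegral_null_diff mA mB AB0 BA0 mC) (measure_null_diff mA mB AB0 BA0).
apply: le_trans h _; rewrite (_ : t - u = (t - s) / 2) //.
by rewrite /u; field.
Qed.

(** The bound is continuous in t, so it passes to times increasing to t. *)
Lemma left_limit_chf (s t lambda : R) (A : set (omega T d)) :
  0 <= s -> s < t -> t <= T -> 1 <= lambda -> FP P s A ->
  `|\int[Pc]_(w in A) cos (lambda * xl t w)| <=
  fine (Pc A) * expR (- (decay_rate * lambda `^ upsilon * ((t - s) / 2))).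
Proof.
move=> s0 st tT l1 FA.
pose r (n : nat) := t - (t - s) / n.+2%:R.
have rt n : r n < t by rewrite /r gtrBl divr_gt0 // subr_gt0.
have sr n : s < r n.
  rewrite /r ltrBrDr -ltrBrDl ltr_pdivrMr // ltr_pMr ?subr_gt0 //.
  by rewrite ltr1n.
have rT n : 0 <= r n <= T.
  by rewrite (le_trans s0 (ltW (sr n))) (le_trans (ltW (rt n))).
have r_cvg : r n @[n --> \oo] --> t^'-.
  move=> B [e /= e0 hB].
  have h := @grid_mesh_small R (t - s) e.
  have : \forall n \near \oo, (t - s) / n.+1%:R < e by apply: h; rewrite ?subr_gt0.
  apply: filterS => n hn; apply: hB; last exact: rt.
  rewrite /= /r opprB addrC subrK ger0_norm ?divr_ge0 ?subr_ge0 ?(ltW st) //.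
  apply: le_lt_trans hn; rewrite ler_pM2l ?subr_gt0 // lef_pV2 ?posrE //.
  by rewrite ler_nat.
have r_cvg0 : r n @[n --> \oo] --> t.
  by apply: (cvg_trans r_cvg); exact: cvg_within.
have t0 : 0 < t <= T by rewrite (le_lt_trans s0 st).
have xr_cvg w : x (r n) w @[n --> \oo] --> xl t w.
  by move=> B nB; exact: (r_cvg _ (@x_left w t t0 B nB)).
have mxl : measurable_fun setT (xl t : Wc -> R).
  apply: (@measurable_fun_cvg _ _ _ _ (fun n => x (r n) : Wc -> R)).
    by move=> n; exact: (mx (rT n)).
  by move=> w _; exact: xr_cvg.
have mA : measurable (A : set Wc) by exact: (FP_measurable T0 FA).
have cvL : \int[Pc]_(w in A) cos (lambda * x (r n) w) @[n --> \oo] -->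
    \int[Pc]_(w in A) cos (lambda * xl t w).
  apply: (@Rintegral_cos_cvg _ Wc R Pc A).
  - exact: mA.
  - by move=> n; exact: (measurable_scale lambda (mx (rT n))).
  - exact: (measurable_scale lambda mxl).
  - apply: aeW => w; apply: cvgM; first exact: cvg_cst.
    exact: xr_cvg.
have cvR : fine (Pc A) * expR (- (decay_rate * lambda `^ upsilon * ((r n - s) / 2)))
    @[n --> \oo] --> fine (Pc A) * expR (- (decay_rate * lambda `^ upsilon * ((t - s) / 2))).
  apply: expR_decay_cvg.
  apply: cvgM; last exact: cvg_cst.
  by apply: cvgB; last exact: cvg_cst.
apply: (ler_cvg_to (cvg_norm cvL) cvR); apply: nearW => n.
by apply: augmented_chf => //; have /andP[] := rT n.
Qed.

End SolutionCharacteristic.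

(** * Regularity of the law of the solution *)

(** Near each point the path is bounded by its one-sided limits and its value, and
[0, T] is compact. *)
Lemma cadlag_bounded (R : realType) (T : R) (y : R -> R) :
  (forall t, 0 <= t < T -> y s @[s --> t^'+] --> y t) ->
  (forall t, 0 < t <= T -> cvg (y s @[s --> t^'-])) ->
  exists M, forall t, 0 <= t <= T -> `|y t| <= M.
Proof.
move=> yr yl.
have /compact_near_coveringP cov := @segment_compact R 0 T.
have := cov R (pinfty_nbhs R) (fun M t => 0 <= t <= T -> `|y t| <= M) _.
case.
  move=> t; rewrite /= in_itv /= => tT; have /andP[t0 t1] := tT.
  (* a bound on the left of t, then one on the right *)
  have [e1 [K1 [e10 h1]]] : exists e K, 0 < e /\ forall s, t - e < s -> s < t -> 0 <= s <= T -> `|y s| <= K.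
    have [t00|tp] := leP t 0.
      by exists 1, 0; split => // s _ st /andP[s0 _]; have := lt_le_trans st t00; rewrite ltNge s0.
    have /yl /cvg_ex [l /cvgrPdist_lt /(_ _ ltr01) [e /= e0 he]] : 0 < t <= T by rewrite tp.
    exists e, (`|l| + 1); split => // s es st _.
    have := he s; rewrite /= ltr_norml ltrBlDr ltrBrDr => /(_ _ st) hs.
    have {}hs : `|l - y s| < 1 by apply: hs; apply/andP; split; lra.
    have := ler_normB l (l - y s); rewrite opprB addrCA subrr addr0; lra.
  have [e2 [K2 [e20 h2]]] : exists e K, 0 < e /\ forall s, t < s -> s < t + e -> 0 <= s <= T -> `|y s| <= K.
    have [t11|tp] := leP T t.
      by exists 1, 0; split => // s st _ /andP[_ s1]; have := lt_le_trans st (le_trans s1 t11); rewrite ltxx.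
    have /yr /cvgrPdist_lt /(_ _ ltr01) [e /= e0 he] : 0 <= t < T by rewrite t0.
    exists e, (`|y t| + 1); split => // s st es _.
    have := he s; rewrite /= ltr_norml ltrBlDr ltrBrDr => /(_ _ st) hs.
    have {}hs : `|y t - y s| < 1 by apply: hs; apply/andP; split; lra.
    have := ler_normB (y t) (y t - y s); rewrite opprB addrCA subrr addr0; lra.
  pose e := Num.min e1 e2; pose K := Num.max (Num.max K1 K2) `|y t|.
  exists (ball t e, [set i | K <= i]); first split => /=.
  - by apply: nbhsx_ballx; rewrite /e lt_min e10.
  - by exists K; split; [exact: num_real|move=> x; exact: ltW].
  move=> [s M] [/= hb KM] sT; move: hb; rewrite -ball_normE /ball_ /= /e lt_min.
  rewrite !ltr_norml => /andP[/andP[b1 b2] /andP[b3 b4]].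
  apply: le_trans KM; rewrite /K !le_max.
  have [st|st|<-] := ltgtP s t; last by rewrite lexx orbT.
  - by rewrite h1 //; lra.
  - by rewrite h2 ?orbT //; lra.
move=> M [_ h]; exists (M + 1) => t tT.
by apply: (h (M + 1)); rewrite ?ltrDl //= in_itv.
Qed.

(** The larger function may be non-measurable, as a supremum over uncountably many
times: the integral of a nonnegative function is a supremum over the simple
functions below it. *)
Lemma ge0_le_integral_dom (dW : measure_display) (W : measurableType dW) (R : realType)
    (mu : {measure set W -> \bar R}) (D : set W) (f g : W -> \bar R) :
  (forall w, D w -> 0 <= f w)%E -> (forall w, D w -> f w <= g w)%E ->
  (\int[mu]_(w in D) f w <= \int[mu]_(w in D) g w)%E.
Proof.
move=> f0 fg; have g0 w : D w -> (0 <= g w)%E.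
  by move=> Dw; apply: le_trans (fg w Dw); exact: f0.
rewrite !ge0_integralE //; apply: le_ereal_sup => _ [h hf <-]; exists h => // w.
apply: le_trans (hf w) _; rewrite /patch; case: ifPn => //; rewrite inE => Dw; exact: fg.
Qed.

Section L2Continuity.
Context {dW : measure_display} {W : measurableType dW} {R : realType}.
Variable Q : probability W R.

(** S need not be measurable, so the dominating function is built from the supremum of
the sequence Z n ^+ 2, which is measurable and below S. *)
Lemma sqr_diff_cvg0 (Z : nat -> W -> R) (z : W -> R) (S : W -> \bar R) :
  (forall n, measurable_fun setT (Z n)) -> measurable_fun setT z ->
  (forall w, Z n w @[n --> \oo] --> z w) ->
  (forall n w, ((Z n w ^+ 2)%:E <= S w)%E) -> (forall w, ((z w ^+ 2)%:E <= S w)%E) ->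
  (\int[Q]_w S w < +oo)%E ->
  (\int[Q]_w ((Z n w - z w) ^+ 2)%:E)%E @[n --> \oo] --> 0%E.
Proof.
move=> mZ mz cZ ZS zS Sfin.
have S0 w : (0 <= S w)%E by apply: le_trans (zS w); rewrite lee_fin sqr_ge0.
have mZ2 n : measurable_fun setT (fun w => (Z n w ^+ 2)%:E).
  by apply/measurable_EFinP; exact: measurable_funX.
have mz2 : measurable_fun setT (fun w => (z w ^+ 2)%:E).
  by apply/measurable_EFinP; exact: measurable_funX.
pose D w := esups (fun n => (Z n w ^+ 2)%:E) 0%N.
have ZD n w : ((Z n w ^+ 2)%:E <= D w)%E.
  by apply: ereal_sup_ubound; exists n.
have D0 w : (0 <= D w)%E by apply: le_trans (ZD 0%N w); rewrite lee_fin sqr_ge0.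
have DS w : (D w <= S w)%E.
  by apply: ge_ereal_sup => _ [n _ <-]; exact: ZS.
have mD : measurable_fun setT D by apply: measurable_fun_esups.
have iD : Q.-integrable setT D.
  apply/integrableP; split => //; apply: le_lt_trans Sfin.
  by apply: ge0_le_integral_dom => w _; rewrite ?abse_ge0 // gee0_abs.
have iz : Q.-integrable setT (fun w => (z w ^+ 2)%:E).
  apply/integrableP; split => //; apply: le_lt_trans Sfin.
  by apply: ge0_le_integral_dom => w _; rewrite ?abse_ge0 // gee0_abs // lee_fin sqr_ge0.
have [||||| _ _ cv] := @dominated_convergence _ _ R Q setT measurableT
  (fun n w => ((Z n w - z w) ^+ 2)%:E) (cst 0%E)
  (fun w => 2%:E * (D w + (z w ^+ 2)%:E))%E.
- move=> n; apply/measurable_EFinP; apply: measurable_funX.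
  exact: measurable_funB.
- exact: measurable_cst.
- apply: aeW => w _; apply: cvg_EFin; first exact: nearW.
  have h : Z n w - z w @[n --> \oo] --> 0.
    by rewrite -(subrr (z w)); apply: cvgB; [exact: cZ|exact: cvg_cst].
  have : (Z n w - z w) * (Z n w - z w) @[n --> \oo] --> (0 * 0 : R) by exact: cvgM.
  by rewrite mul0r.
- by apply: integrableZl => //; exact: integrableD.
- apply: aeW => w n _; rewrite /= ger0_norm ?sqr_ge0 //.
  apply: (@le_trans _ _ (2%:E * ((Z n w ^+ 2)%:E + (z w ^+ 2)%:E))%E).
    rewrite -EFinD -EFinM lee_fin; have := sqr_ge0 (Z n w + z w); nra.
  by rewrite lee_pmul2l // leeD2r.
by move: cv; rewrite integral0.
Qed.

End L2Continuity.

Lemma enorm_sqr (R : realType) (d : nat) (x : 'rV[R]_d) : enorm x ^+ 2 = \sum_i x 0 i ^+ 2.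
Proof.
have e : dot x x = \sum_i x 0 i ^+ 2 by apply: eq_bigr => i _; rewrite expr2.
by rewrite /enorm e sqr_sqrtr // sumr_ge0 // => i _; exact: sqr_ge0.
Qed.

Section Wasserstein.
Context {dW : measure_display} {W : measurableType dW} {R : realType} {d : nat}.
Variable Q : probability W R.
Variables (Xa Xb : W -> 'rV[R]_d).
Hypotheses (mXa : measurable_fun setT Xa) (mXb : measurable_fun setT Xb).
Variables (mu nu : probability 'rV[R]_d R).
Hypothesis muE : forall A, measurable A -> mu A = Q (Xa @^-1` A).
Hypothesis nuE : forall A, measurable A -> nu A = Q (Xb @^-1` A).

Lemma law_in_P2 : (\int[Q]_w (enorm (Xa w) ^+ 2)%:E < +oo)%E -> P2 mu.
Proof.
rewrite /P2 /=.
pose XA := mfun_Sub (mem_set mXa : Xa \in mfun).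
have -> : (\int[mu]_x (enorm x ^+ 2)%:E = \int[distribution Q XA]_x (enorm x ^+ 2)%:E)%E.
  by apply: eq_measure_integral => A mA _; exact: (muE mA).
rewrite ge0_integral_pushforward //.
  by apply/measurable_EFinP; apply: measurable_funX; exact: measurable_enorm.
by move=> x _; rewrite lee_fin sqr_ge0.
Qed.

(** The joint law of Xa and Xb is a coupling. *)
Lemma W2_le_L2 : (\int[Q]_w (enorm (Xa w - Xb w) ^+ 2)%:E < +oo)%E ->
  W2 mu nu <= Num.sqrt (fine (\int[Q]_w (enorm (Xa w - Xb w) ^+ 2)%:E)%E).
Proof.
move=> fin.
have mXY : measurable_fun setT (fun w => (Xa w, Xb w)) by exact: measurable_fun_pair.
pose XY := mfun_Sub (mem_set mXY : (fun w => (Xa w, Xb w)) \in mfun).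
pose p : probability ('rV[R]_d * 'rV[R]_d)%type R := distribution Q XY.
have cp : coupling mu nu p.
  move=> A mA; rewrite muE // nuE //; split; congr (Q _).
    by apply/seteqP; split => w /=; [case|].
  by apply/seteqP; split => w /=; [case|].
have pE : (\int[p]_z (enorm (z.1 - z.2) ^+ 2)%:E = \int[Q]_w (enorm (Xa w - Xb w) ^+ 2)%:E)%E.
  rewrite ge0_integral_pushforward //; last by move=> x _; rewrite lee_fin sqr_ge0.
  apply/measurable_EFinP; under eq_fun do rewrite enorm_sqr.
  apply: measurable_sum => i; apply: measurable_funX.
  under eq_fun do rewrite !mxE.
  by apply: measurable_funB; apply: measurableT_comp (measurable_coord i) _.
apply: ler_wsqrtr; apply: fine_le.
- rewrite ge0_fin_numE.
    by apply: le_lt_trans fin; apply: ereal_inf_lbound; exists p.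
  apply: le_ereal_inf_tmp => _ [r _ <-]; apply: integral_ge0 => z _.
  by rewrite lee_fin sqr_ge0.
- by rewrite ge0_fin_numE // integral_ge0 // => w _; rewrite lee_fin sqr_ge0.
- by rewrite -pE; apply: ereal_inf_lbound; exists p.
Qed.

End Wasserstein.

Lemma enorm_continuous (R : realType) (d : nat) : continuous (@enorm R d).
Proof.
have c : continuous (fun x : 'rV[R]_d => \sum_(i < d) x 0 i * x 0 i).
  apply: continuous_big; first exact: add_continuous.
  by move=> i _ x; apply: continuousM; exact: coord_continuous.
by move=> x; apply: (continuous_comp (c x)); exact: sqrt_continuous.
Qed.

Lemma enorm0 (R : realType) (d : nat) : enorm (0 : 'rV[R]_d) = 0.
Proof. by rewrite /enorm /dot big1 ?sqrtr0 // => i _; rewrite mxE mul0r. Qed.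

Lemma enorm_ge0 (R : realType) (d : nat) (x : 'rV[R]_d) : 0 <= enorm x.
Proof. exact: sqrtr_ge0. Qed.

Lemma enorm_sub_sqr (R : realType) (d : nat) (x y : 'rV[R]_d) :
  enorm (x - y) ^+ 2 <= 2 * enorm x ^+ 2 + 2 * enorm y ^+ 2.
Proof.
rewrite !enorm_sqr !mulr_sumr -big_split /=; apply: ler_sum => i _; rewrite !mxE.
have := sqr_ge0 (x 0 i + y 0 i); nra.
Qed.

Section SolutionRegularity.
Context {dW : measure_display} {W : measurableType dW} {R : realType} {T : R} {d : nat}.
Hypothesis T0 : 0 < T.
Variable Q : probability W R.
Variable X : R -> W -> 'rV[R]_d.
Hypothesis mX : forall t, 0 <= t <= T -> measurable_fun setT (X t).
Hypothesis cX : forall w, cadlag T (X^~ w).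
Hypothesis supX : (\int[Q]_w
  ereal_sup [set (enorm (X t w) ^+ 2)%:E | t in `[0%R, T]] < +oo)%E.
Variables (mu : R -> probability 'rV[R]_d R) (H : probability 'rV[R]_d R -> 'rV[R]_d) (LH : R).
Hypothesis muE : forall t, 0 <= t <= T -> forall A : set 'rV[R]_d, measurable A ->
  mu t A = Q (X t @^-1` A).
Hypothesis H_lipschitz : forall mu nu, P2 mu -> P2 nu ->
  enorm (H mu - H nu) <= LH * W2 mu nu.

Let S w := ereal_sup [set (enorm (X t w) ^+ 2)%:E | t in `[0%R, T]].

Let XS t w : 0 <= t <= T -> ((enorm (X t w) ^+ 2)%:E <= S w)%E.
Proof. by move=> tT; apply: ereal_sup_ubound; exists t => //=; rewrite in_itv. Qed.

Let mN2 t : 0 <= t <= T -> measurable_fun setT (fun w => (enorm (X t w) ^+ 2)%:E).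
Proof.
move=> tT; apply/measurable_EFinP; apply: measurable_funX.
by apply: measurableT_comp (mX tT); exact: measurable_enorm.
Qed.

Let N2_le t : 0 <= t <= T -> (\int[Q]_w (enorm (X t w) ^+ 2)%:E <= \int[Q]_w S w)%E.
Proof.
move=> tT; apply: ge0_le_integral_dom => w _; first by rewrite lee_fin sqr_ge0.
exact: XS.
Qed.

Lemma measurable_enorm_diff s t : 0 <= s <= T -> 0 <= t <= T ->
  measurable_fun setT (fun w => enorm (X s w - X t w)).
Proof.
move=> sT tT.
have e w : enorm (X s w - X t w) = Num.sqrt (\sum_i (X s w 0 i - X t w 0 i) ^+ 2).
  by rewrite -[LHS]ger0_norm ?enorm_ge0 // -sqrtr_sqr enorm_sqr; under eq_bigr do rewrite !mxE.
under eq_fun do rewrite e.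
apply: measurableT_comp.
  by apply: continuous_measurable_fun; exact: sqrt_continuous.
apply: measurable_sum => i; apply: measurable_funX; apply: measurable_funB.
  exact: measurableT_comp (measurable_coord i) (mX sT).
exact: measurableT_comp (measurable_coord i) (mX tT).
Qed.

Let diff_le s t : 0 <= s <= T -> 0 <= t <= T ->
  (\int[Q]_w (enorm (X s w - X t w) ^+ 2)%:E <= 4%:E * \int[Q]_w S w)%E.
Proof.
move=> sT tT.
apply: (@le_trans _ _ (\int[Q]_w (2%:E * (enorm (X s w) ^+ 2)%:E + 2%:E * (enorm (X t w) ^+ 2)%:E))%E).
  apply: ge0_le_integral_dom => w _; first by rewrite lee_fin sqr_ge0.
  by rewrite -!EFinM -EFinD lee_fin enorm_sub_sqr.
rewrite ge0_integralD //; last 4 first.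
- by move=> w _; rewrite -EFinM lee_fin mulr_ge0 // sqr_ge0.
- by apply: emeasurable_funM => //; exact: mN2.
- by move=> w _; rewrite -EFinM lee_fin mulr_ge0 // sqr_ge0.
- by apply: emeasurable_funM => //; exact: mN2.
rewrite !ge0_integralZl_EFin //; try exact: mN2; try by move=> w _; rewrite lee_fin sqr_ge0.
rewrite (_ : 4%:E = 2%:E + 2%:E :> \bar R)%E; last by rewrite -EFinD; congr EFin; ring.
have S0 : (0 <= \int[Q]_w S w)%E.
  apply: le_trans (N2_le sT); apply: integral_ge0 => w _; by rewrite lee_fin sqr_ge0.
rewrite ge0_muleDl //; apply: leeD; rewrite lee_pmul2l //; exact: N2_le.
Qed.

Let S_fin : (\int[Q]_w S w)%E \is a fin_num.
Proof.
rewrite ge0_fin_numE //; apply: integral_ge0 => w _.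
have T00 : (0 : R) <= 0 <= T by rewrite lexx ltW.
by apply: le_trans (XS w T00); rewrite lee_fin sqr_ge0.
Qed.

Let diff_fin s t : 0 <= s <= T -> 0 <= t <= T ->
  (\int[Q]_w (enorm (X s w - X t w) ^+ 2)%:E < +oo)%E.
Proof.
move=> sT tT; apply: le_lt_trans (diff_le sT tT) _.
by rewrite -(fineK S_fin) -EFinM ltry.
Qed.

Let P2_mu t : 0 <= t <= T -> P2 (mu t).
Proof.
move=> tT; apply: (law_in_P2 (mX tT) (muE tT)).
exact: le_lt_trans (N2_le tT) supX.
Qed.

Let H_diff s t k : 0 <= s <= T -> 0 <= t <= T ->
  `|H (mu s) 0 k - H (mu t) 0 k| <=
  `|LH| * Num.sqrt (fine (\int[Q]_w (enorm (X s w - X t w) ^+ 2)%:E)%E).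
Proof.
move=> sT tT.
have -> : H (mu s) 0 k - H (mu t) 0 k = (H (mu s) - H (mu t)) 0 k by rewrite !mxE.
apply: le_trans (coord_le_enorm _ _) _.
apply: le_trans (H_lipschitz (P2_mu sT) (P2_mu tT)) _.
apply: (@le_trans _ _ (`|LH| * W2 (mu s) (mu t))).
  by apply: ler_wpM2r; [exact: sqrtr_ge0|exact: ler_norm].
apply: ler_wpM2l => //.
exact: (W2_le_L2 (mX sT) (mX tT) (muE sT) (muE tT) (diff_fin sT tT)).
Qed.

Lemma mean_field_bounded k : exists M, forall t, 0 <= t <= T -> `|H (mu t) 0 k| <= M.
Proof.
have T00 : (0 : R) <= 0 <= T by rewrite lexx ltW.
exists (`|LH| * Num.sqrt (fine (4%:E * \int[Q]_w S w)%E) + `|H (mu 0) 0 k|) => t tT.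
rewrite -[X in `|X|](subrK (H (mu 0) 0 k)).
apply: le_trans (ler_normD _ _) _; rewrite lerD2r.
apply: le_trans (H_diff k tT T00) _; apply: ler_wpM2l => //.
apply: ler_wsqrtr; apply: fine_le; last exact: diff_le.
  rewrite ge0_fin_numE; first exact: diff_fin.
  by apply: integral_ge0 => w _; rewrite lee_fin sqr_ge0.
by rewrite fin_numM.
Qed.

(** The Wasserstein distance between the laws at two times is at most the L^2 distance
of the values, which tends to 0 by dominated convergence. *)
Lemma mean_field_right_continuous k t : 0 <= t < T ->
  H (mu s) 0 k @[s --> t^'+] --> H (mu t) 0 k.
Proof.
move=> /andP[t0 tT].
have tTT : 0 <= t <= T by rewrite t0 ltW.
apply/cvg_at_rightP => u [ut u_cvg].
(* the law is only prescribed on [0, T] *)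
pose v n := Num.min (u n) T.
have vt n : t < v n by rewrite /v lt_min ut.
have vT n : 0 <= v n <= T by rewrite (le_trans t0 (ltW (vt n))) /v ge_min lexx orbT.
have uv : \forall n \near \oo, u n = v n.
  have : \forall n \near \oo, u n < T by apply: (cvgr_lt _ u_cvg).
  by apply: filterS => n h; rewrite /v min_l // ltW.
have v_cvg : v n @[n --> \oo] --> t.
  by apply: cvg_trans u_cvg; apply: near_eq_cvg; exact: uv.
suff h : H (mu (v n)) 0 k @[n --> \oo] --> H (mu t) 0 k.
  apply: cvg_trans h; apply: near_eq_cvg; move: uv; apply: filterS => n ->.
  by [].
have v_right : v n @[n --> \oo] --> t^'+.
  move=> B [e /= e0 hB]; move/cvgrPdist_lt : v_cvg => /(_ _ e0).
  by apply: filterS => n hn; apply: hB => //.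
have Xv w : X (v n) w @[n --> \oo] --> X t w.
  have [h _] := cX w; have {}h := h t; rewrite t0 tT in h.
  by move=> B nB; exact: (v_right _ (h isT B nB)).
have Nv w : enorm (X (v n) w - X t w) / 2 @[n --> \oo] --> (0:R).
  rewrite -[X in _ --> X](mul0r 2^-1) -(enorm0 R d) -(subrr (X t w)).
  apply: cvgM; last exact: cvg_cst.
  apply: (continuous_cvg _ (@enorm_continuous R d _)).
  by apply: cvgB; [exact: Xv|exact: cvg_cst].
have mN n : measurable_fun setT (fun w => enorm (X (v n) w - X t w) / 2).
  by apply: measurable_funM => //; exact: measurable_enorm_diff.
(* half of the difference is dominated by S itself, which spares the scaling of the
   integral of a non-measurable function *)
have NS n w : (((enorm (X (v n) w - X t w) / 2) ^+ 2)%:E <= S w)%E.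
  rewrite expr_div_n; have h := enorm_sub_sqr (X (v n) w) (X t w).
  have h2 : enorm (X (v n) w - X t w) ^+ 2 / 2 ^+ 2 <= 
      Num.max (enorm (X (v n) w) ^+ 2) (enorm (X t w) ^+ 2).
    rewrite ler_pdivrMr ?exprn_gt0 //; move: h.
    by have [|] := leP (enorm (X (v n) w) ^+ 2) (enorm (X t w) ^+ 2); lra.
  apply: (@le_trans _ _ (Num.max (enorm (X (v n) w) ^+ 2) (enorm (X t w) ^+ 2))%:E).
    by rewrite lee_fin.
  by have [_|_] := leP (enorm (X (v n) w) ^+ 2) (enorm (X t w) ^+ 2); apply: XS.
have S0 w : (((0:R) ^+ 2)%:E <= S w)%E.
  by rewrite expr0n /=; apply: le_trans (NS 0%N w); rewrite lee_fin sqr_ge0.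
have cE := @sqr_diff_cvg0 _ _ R Q (fun n w => enorm (X (v n) w - X t w) / 2) (fun=> 0) S
  mN (measurable_cst _) Nv NS S0 supX.
have cF : fine (\int[Q]_w ((enorm (X (v n) w - X t w) / 2 - 0) ^+ 2)%:E)%E @[n --> \oo] --> (0:R).
  exact: (fine_cvg cE).
have EE n : fine (\int[Q]_w (enorm (X (v n) w - X t w) ^+ 2)%:E)%E =
    4 * fine (\int[Q]_w ((enorm (X (v n) w - X t w) / 2 - 0) ^+ 2)%:E)%E.
  rewrite -[4 in RHS]/(fine 4%:E) -fineM //; last first.
    rewrite ge0_fin_numE; last by apply: integral_ge0 => w _; rewrite lee_fin sqr_ge0.
    apply: le_lt_trans supX; apply: ge0_le_integral_dom => w _; first by rewrite lee_fin sqr_ge0.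
    by rewrite subr0; exact: NS.
  rewrite -ge0_integralZl_EFin //; last 2 first.
  - by move=> w _; rewrite lee_fin sqr_ge0.
  - by apply/measurable_EFinP; apply: measurable_funX; apply: measurable_funB => //; exact: mN.
  congr fine; apply: eq_integral => w _; rewrite -EFinM; congr EFin.
  by rewrite subr0 expr_div_n; field.
have cB : `|LH| * Num.sqrt (fine (\int[Q]_w (enorm (X (v n) w - X t w) ^+ 2)%:E)%E)
    @[n --> \oo] --> (0:R).
  rewrite -[X in _ --> X](mulr0 `|LH|) -(sqrtr0 R); apply: cvgM; first exact: cvg_cst.
  apply: (continuous_cvg _ (@sqrt_continuous R _)).
  have c4 : 4 * fine (\int[Q]_w ((enorm (X (v n) w - X t w) / 2 - 0) ^+ 2)%:E)%E @[n --> \oo] -->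
      (0:R).
    by rewrite -[X in _ --> X](mulr0 4); apply: cvgM; [exact: cvg_cst|exact: cF].
  by under eq_fun do rewrite EE.
apply/cvgrPdist_lt => e e0; move/cvgrPdist_lt : cB => /(_ _ e0).
apply: filterS => n; rewrite sub0r normrN => hn; rewrite distrC.
by apply: le_lt_trans (H_diff k (vT n) tTT) _; apply: le_lt_trans hn; exact: ler_norm.
Qed.

End SolutionRegularity.

Lemma integrable_le_1D (dW : measure_display) (W : measurableType dW) (R : realType)
    (mu : {measure set W -> \bar R}) (D : set W) (f g : W -> R) :
  measurable D -> measurable_fun D f ->
  mu.-integrable D (EFin \o cst 1) -> mu.-integrable D (EFin \o g) ->
  (forall w, D w -> 0 <= g w) -> (forall w, D w -> `|f w| <= 1 + g w) ->
  mu.-integrable D (EFin \o f).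
Proof.
move=> mD mf i1 ig g0 fg.
apply: (@le_integrable _ _ R mu D mD _ (EFin \o (fun w => 1 + g w))).
- exact/measurable_EFinP.
- by move=> w Dw /=; rewrite lee_fin [leRHS]ger0_norm ?fg ?addr_ge0 ?g0.
- exact: (integrableD mD i1 ig).
Qed.

(** From |h_k| <= 1 + |h|^q. *)
Lemma coord_integrable_Lq (R : realType) (T : R) (d : nat) (q : R) (h : R -> 'rV[R]_d) (k : 'I_d) :
  1 <= q -> 0 <= T -> measurable_fun `[0, T] h ->
  (\int[lebesgue_measure]_(t in `[0%R, T]) (enorm (h t) `^ q)%:E < +oo)%E ->
  (@lebesgue_measure R).-integrable `[0, T] (EFin \o (fun t => h t 0 k)).
Proof.
move=> q1 T0 mh hq.
have mD : measurable (`[0, T]%classic : set R) by exact: measurable_itv.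
have mk : measurable_fun `[0, T] (fun t => h t 0 k).
  exact: (measurableT_comp (measurable_coord k) mh).
have mq : measurable_fun `[0, T] (fun t => enorm (h t) `^ q).
  exact: (measurableT_comp (@measurable_powR R q) (measurableT_comp (@measurable_enorm R d) mh)).
have i1 : (@lebesgue_measure R).-integrable `[0, T] (EFin \o cst 1).
  apply: measurable_bounded_integrable => //.
    have e : lebesgue_measure (`[0, T]%classic : set R) = (T - 0)%:E.
      rewrite lebesgue_measure_itv /= lte_fin -EFinD.
      by case: ltgtP T0 => // <-; rewrite subrr.
    by rewrite [X in (X < _)%E]e ltry.
  by exists 1; split; [exact: num_real|move=> y y1 t _; rewrite /= normr1; exact: ltW].
have iq : (@lebesgue_measure R).-integrable `[0, T] (EFin \o (fun t => enorm (h t) `^ q)).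
  apply/integrableP; split; first exact/measurable_EFinP.
  apply: le_lt_trans hq; rewrite le_eqVlt; apply/orP; left; apply/eqP.
  by apply: eq_integral => t _ /=; rewrite ger0_norm ?powR_ge0.
apply: (integrable_le_1D _ _ i1 iq) => //.
- by move=> t _; exact: powR_ge0.
- move=> t _; apply: le_trans (coord_le_enorm _ _) _.
  have [e1|e1] := leP (enorm (h t)) 1.
    by apply: le_trans e1 _; rewrite lerDl powR_ge0.
  apply: (@le_trans _ _ (enorm (h t) `^ q)); last by rewrite lerDr.
  by rewrite -[leLHS](powRr1 (enorm_ge0 _)); apply: ler_powR => //; exact: ltW.
Qed.

(** * Occupation times and Tonelli's theorem *)

Section TonelliSections.
Context {d1 d2 : measure_display} {T1 : measurableType d1} {T2 : measurableType d2}.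
Context {R : realType}.
Variables (m1 : {sigma_finite_measure set T1 -> \bar R}).
Variables (m2 : {sigma_finite_measure set T2 -> \bar R}).

Lemma tonelli_sections (A : set (T1 * T2)) : measurable A ->
  (\int[m1]_x m2 (xsection A x) = \int[m2]_y m1 (ysection A y))%E.
Proof.
move=> mA; have := indic_fubini_tonelli m1 m2 mA.
by rewrite (indic_fubini_tonelli_FE m2 mA) (indic_fubini_tonelli_GE m1 mA).
Qed.

(** Tonelli for the indicator function of N `&` (I `*` A). *)
Lemma tonelli_sections_on (N : set (T1 * T2)) (I : set T1) (A : set T2) :
  measurable N -> measurable I -> measurable A ->
  (\int[m1]_(x in I) m2 (A `&` xsection N x) =
   \int[m2]_(y in A) m1 (ysection N y `&` I))%E.
Proof.
move=> mN mI mA.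
have mD : measurable (N `&` (I `*` A)) by apply: measurableI => //; exact: measurableX.
have H := tonelli_sections mD.
rewrite [in RHS]integral_mkcond [in LHS]integral_mkcond.
have e1 : (\int[m1]_x m2 (xsection (N `&` (I `*` A)) x) =
    \int[m1]_x ((fun x => m2 (A `&` xsection N x)) \_ I) x)%E.
  apply: eq_integral => x _; rewrite /patch; case: ifPn; rewrite ?inE ?notin_setE => Ix.
    congr (m2 _); rewrite !xsectionE; apply/seteqP; split => y /=.
      by move=> [h [_ Ay]].
    by move=> [Ay h].
  rewrite (_ : xsection _ _ = set0) ?measure0 //.
  by rewrite xsectionE; apply/seteqP; split => y //= [_ []].
have e2 : (\int[m2]_y m1 (ysection (N `&` (I `*` A)) y) =
    \int[m2]_y ((fun y => m1 (ysection N y `&` I)) \_ A) y)%E.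
  apply: eq_integral => y _; rewrite /patch; case: ifPn; rewrite ?inE ?notin_setE => Ay.
    congr (m1 _); rewrite !ysectionE; apply/seteqP; split => x /=.
      by move=> [h [Ix _]].
    by move=> [h Ix].
  rewrite (_ : ysection _ _ = set0) ?measure0 //.
  by rewrite ysectionE; apply/seteqP; split => x //= [_ []].
by rewrite -e1 -e2.
Qed.

End TonelliSections.

Section SquareOfLength.
Variables (R : realType) (T : R).
Local Notation leb := (@lebesgue_measure R).

(** The square B `*` B splits along the diagonal into two halves that are mirror images of
each other, up to the diagonal itself, whose sections are points. *)
Lemma sqr_length_le (B : set R) : measurable B -> B `<=` `]0, T]%classic ->
  (leb B * leb B <= 2%:E * \int[leb]_(t in B) leb (B `&` `]t, T]))%E.
Proof.
move=> mB BT.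
(* the open half square above the diagonal *)
pose D := [set p : R * R | p.1 < p.2].
have mD : measurable D.
  rewrite (_ : D = setT `&` [set p : R * R | p.1 < p.2]); last by rewrite setTI.
  exact: measurable_fun_ltr.
have mDC := measurableC mD.
have B0 : (0 <= leb B)%E by exact: measure_ge0.
have e1 t : B t -> B `&` `]t, T]%classic = B `&` xsection D t.
  move=> Bt; rewrite xsectionE; apply/seteqP; split => r /=; rewrite /D /= in_itv /=.
    by move=> [Br /andP[tr _]].
  by move=> [Br tr]; split => //; rewrite tr /=; have /= := BT _ Br; rewrite in_itv /= => /andP[].
have m1 : measurable_fun setT (fun t => leb (B `&` xsection D t)).
  have mDB : measurable (D `&` (setT `*` B)) by apply: measurableI => //; exact: measurableX.
  have := measurable_fun_xsection leb mDB.
  congr measurable_fun; apply/funext => t /=; congr (leb _).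
  by rewrite !xsectionE; apply/seteqP; split => r /=; [case=> ? []|case].
have m2 : measurable_fun setT (fun t => leb (B `&` xsection (~` D) t)).
  have mDB : measurable (~` D `&` (setT `*` B)) by apply: measurableI => //; exact: measurableX.
  have := measurable_fun_xsection leb mDB.
  congr measurable_fun; apply/funext => t /=; congr (leb _).
  by rewrite !xsectionE; apply/seteqP; split => r /=; [case=> ? []|case].
have split1 : (leb B * leb B = \int[leb]_(t in B) leb (B `&` xsection D t) +
    \int[leb]_(t in B) leb (B `&` xsection (~` D) t))%E.
  rewrite -ge0_integralD //; last 2 first.
  - exact: measurable_funTS.
  - exact: measurable_funTS.
  rewrite -integral_cst //; apply: eq_integral => t _ /=.
  rewrite -measureU.
  - congr (leb _); rewrite !xsectionE -setIUr -preimage_setU setUv preimage_setT setIT.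
    by [].
  - by apply: measurableI => //; exact: measurable_xsection.
  - by apply: measurableI => //; exact: measurable_xsection.
  - by rewrite !xsectionE; apply/seteqP; split => r //= [[_ h] [_]] /(_ h).
have split2 : (\int[leb]_(t in B) leb (B `&` xsection (~` D) t) <=
    \int[leb]_(t in B) leb (B `&` xsection D t))%E.
  rewrite tonelli_sections_on //; apply: ge0_le_integral_dom => // t Bt.
  have -> : ysection (~` D) t `&` B = (B `&` [set t]) `|` (B `&` xsection D t).
    rewrite ysectionE xsectionE; apply/seteqP; split => r /=; rewrite /D /=.
      move=> [/negP]; rewrite -leNgt le_eqVlt => /orP[/eqP <-|tr] Br; first by left.
      by right.
    by move=> [[Br ->]|[Br tr]]; split => //; apply/negP; rewrite -leNgt // ltW.
  rewrite setUC measureU0 //.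
  - by apply: measurableI => //; exact: measurable_xsection.
  - by apply: measurableI => //; exact: measurable_set1.
  - apply/eqP; rewrite eq_le measure_ge0 andbT -(lebesgue_measure_set1 t).
    apply: le_measure; rewrite ?inE.
    + by apply: measurableI => //; exact: measurable_set1.
    + exact: measurable_set1.
    + by move=> r [].
rewrite split1 (_ : 2%:E = 1 + 1 :> \bar R)%E; last by rewrite -EFinD; congr EFin; ring.
rewrite ge0_muleDl // !mul1e.
have -> : (\int[leb]_(t in B) leb (B `&` `]t, T]) = \int[leb]_(t in B) leb (B `&` xsection D t))%E.
  by apply: eq_integral => t; rewrite inE => Bt; rewrite e1.
by rewrite leeD2l.
Qed.

End SquareOfLength.

(** * Small balls from the decay of the cosine transform *)

Section FejerBound.
Variable R : realType.

(** Every distance j.+1 between l and m occurs at most twice. *)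
Lemma sum_distance_le (n l : nat) (g : nat -> R) : (l < n)%N -> (forall j, 0 <= g j) ->
  \sum_(m < n) (if (l == m)%N then 1 else g (if (l < m)%N then m - l else l - m)%N) <=
  1 + 2 * \sum_(j < n) g j.+1.
Proof.
move=> ln g0.
pose F m := if (l == m)%N then 1 else g (if (l < m)%N then m - l else l - m)%N.
rewrite -(big_mkord xpredT F) (big_cat_nat (n := l)) ?(ltnW ln) //= (@big_cat_nat _ _ _ l.+1 l) //=.
rewrite big_nat1 {2}/F eqxx.
have wide a : (a <= n)%N -> \sum_(0 <= j < a) g j.+1 <= \sum_(j < n) g j.+1.
  move=> an; rewrite -(big_mkord xpredT (fun j => g j.+1)) [leRHS](big_cat_nat (n := a)) //=.
  by rewrite lerDl; apply: sumr_ge0.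
have s1 : \sum_(0 <= m < l) F m <= \sum_(j < n) g j.+1.
  apply: le_trans (wide l (ltnW ln)); rewrite big_nat_rev /= le_eqVlt; apply/orP; left; apply/eqP.
  apply: eq_big_nat => i /andP[_ il]; rewrite add0n /F.
  have h : (l - i.+1 < l)%N by rewrite ltn_subrL (leq_ltn_trans _ il).
  rewrite gtn_eqF // ltnNge (ltnW h) /= subKn //.
have s2 : \sum_(l.+1 <= m < n) F m <= \sum_(j < n) g j.+1.
  apply: le_trans (wide (n - l.+1)%N (leq_subr _ _)).
  rewrite -{1}[l.+1]add0n big_addn le_eqVlt; apply/orP; left; apply/eqP.
  apply: eq_big_nat => i _; rewrite /F.
  have h : (l < i + l.+1)%N by rewrite addnS ltnS leq_addl.
  by rewrite ltn_eqF // h addnS -addSn addnK.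
by rewrite mulr2n mulrDl mul1r; lra.
Qed.

Context {dW : measure_display} {W : measurableType dW}.
Variable Q : probability W R.

(** Integrate the Fejer kernel over A: from below by its values on the small ball, from
above term by term, the difference of two indices being the frequency. *)
Lemma fejer_small_ball (A : set W) (Y : W -> R) (n : nat) (g : nat -> R) :
  measurable A -> measurable_fun setT Y -> (forall j, 0 <= g j) ->
  (forall m, (0 < m)%N -> `|\int[Q]_(w in A) cos (m%:R * Y w)| <= fine (Q A) * g m) ->
  n%:R ^+ 2 * cos 1 ^+ 2 * fine (Q (A `&` [set w | n%:R * `|Y w| <= 1])) <=
  fine (Q A) * (n%:R * (1 + 2 * \sum_(j < n) g j.+1)).
Proof.
move=> mA mY g0 hg.
set B := [set w | _].
have mB : measurable B.
  rewrite (_ : B = setT `&` [set w | n%:R * `|Y w| <= 1]); last by rewrite setTI.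
  apply: measurable_fun_ler => //; apply: measurable_funM => //.
  exact: measurableT_comp.
have mAB : measurable (A `&` B) by exact: measurableI.
have ic a : Q.-integrable A (EFin \o (fun w => cos (a * Y w))).
  by apply: integrable_cos => //; apply: measurable_funM => //; exact: measurable_funTS.
have icS (p : nat) (f : 'I_p -> W -> R) :
    (forall i, Q.-integrable A (EFin \o f i)) ->
    Q.-integrable A (EFin \o (fun w => \sum_(i < p) f i w)) /\
    \int[Q]_(w in A) \sum_(i < p) f i w = \sum_(i < p) \int[Q]_(w in A) f i w.
  elim: p f => [|p IH] f fi.
    split.
      rewrite (_ : (fun w => _) = cst 0); last by apply/funext => w; rewrite big_ord0.
      by apply: (@bounded_integrable _ _ _ Q A (cst 0) 0) => // w _; rewrite normr0.
    under eq_Rintegral do rewrite big_ord0.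
    by rewrite big_ord0 Rintegral_cst // mul0r.
  have [i1 e1] := IH (fun i => f (widen_ord (leqnSn p) i)) (fun i => fi _).
  split.
    rewrite (_ : (fun w => \sum_(i < p.+1) f i w) =
      fun w => \sum_(i < p) f (widen_ord (leqnSn p) i) w + f ord_max w); last first.
      by apply/funext => w; rewrite big_ord_recr.
    exact: (integrableDr mA i1 (fi ord_max)).
  under eq_Rintegral do rewrite big_ord_recr /=.
  by rewrite RintegralD // e1 big_ord_recr.
have ifj : Q.-integrable A (EFin \o (fun w => fejer n (Y w))).
  rewrite (_ : (fun w => _) = fun w => \sum_(l < n) \sum_(m < n) cos ((l%:R - m%:R) * Y w)).
    by apply: (icS _ _ _).1 => l; apply: (icS _ _ _).1.
  by apply/funext => w; rewrite fejerE.
have up : \int[Q]_(w in A) fejer n (Y w) <= fine (Q A) * (n%:R * (1 + 2 * \sum_(j < n) g j.+1)).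
  under eq_Rintegral do rewrite fejerE.
  rewrite (icS _ _ _).2; last by move=> l; apply: (icS _ _ _).1.
  under eq_bigr do rewrite (icS _ _ _).2 //.
  apply: (@le_trans _ _ (\sum_(l < n) fine (Q A) * (1 + 2 * \sum_(j < n) g j.+1))); last first.
    by rewrite sumr_const card_ord -[leLHS]mulr_natl mulrCA.
  apply: ler_sum => l _.
  apply: le_trans (_ : fine (Q A) * \sum_(m < n)
      (if (l == m :> nat)%N then 1 else g (if (l < m)%N then m - l else l - m)%N) <= _); last first.
    by apply: ler_wpM2l; [exact: fine_ge0|exact: sum_distance_le].
  rewrite mulr_sumr; apply: ler_sum => m _.
  have [->|lm] := eqVneq (l : nat) m.
    under eq_Rintegral do rewrite subrr mul0r cos0.
    by rewrite Rintegral_cst // mul1r mulr1.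
  have [lt|ge] := ltnP l m.
    have h : (0 < m - l)%N by rewrite subn_gt0.
    apply: le_trans (ler_norm _) (le_trans _ (hg _ h)).
    rewrite le_eqVlt; apply/orP; left; apply/eqP; congr (`|_|).
    by apply: eq_Rintegral => w _; rewrite -cosN -mulNr opprB natrB // ltnW.
  have h : (0 < l - m)%N by rewrite subn_gt0 ltn_neqAle eq_sym lm.
  apply: le_trans (ler_norm _) (le_trans _ (hg _ h)).
  rewrite le_eqVlt; apply/orP; left; apply/eqP; congr (`|_|).
  by apply: eq_Rintegral => w _; rewrite natrB.
apply: le_trans up.
have c0 : 0 <= n%:R ^+ 2 * cos 1 ^+ 2 :> R by rewrite mulr_ge0 ?sqr_ge0.
rewrite -lee_fin EFinM fineK ?fin_num_measure // -integral_cst //.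
rewrite [leRHS]fineK; last by apply: integrable_fin_num.
apply: (@le_trans _ _ (\int[Q]_(w in A `&` B) (fejer n (Y w))%:E)%E).
  apply: ge0_le_integral_dom => w; first by rewrite lee_fin.
  by move=> [_ Bw]; rewrite lee_fin fejer_lower.
apply: ge0_subset_integral => //.
- by case/integrableP : ifj.
- by move=> w _; rewrite lee_fin fejer_ge0.
Qed.

End FejerBound.

Lemma integral_decay_le (R : realType) (s T a : R) : 0 < a ->
  (\int[lebesgue_measure]_(t in `]s, T]) (expR (- (a * (t - s))))%:E <= (a^-1)%:E)%E.
Proof.
move=> a0; have [sT|Ts] := ltP s T; last first.
  by rewrite set_itv_ge ?bnd_simp -?leNgt // integral_set0 lee_fin invr_ge0 ltW.
have dg (t : R) : is_derive t (1 : R) (fun t : R => - (a * (t - s))) (- a).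
  have h := is_deriveN (is_deriveZ a (is_deriveB (is_derive_id t (1 : R)) (is_derive_cst s t (1 : R)))).
  by apply: (is_derive_eq h); rewrite subr0 /GRing.scale /= mulr1.
have de t := @is_derive1_comp R expR (fun t : R => - (a * (t - s))) t _ _
  (is_derive_expR (- (a * (t - s)))) (dg t).
pose F (t : R) := - a^-1 * expR (- (a * (t - s))).
have dF t : is_derive t (1 : R) F (expR (- (a * (t - s)))).
  apply: (is_derive_eq (is_deriveZ (- a^-1) (de t))).
  by rewrite /GRing.scale /=; field; rewrite gt_eqF.
have ce : continuous (fun t : R => expR (- (a * (t - s)))).
  by move=> t; apply: differentiable_continuous; apply/derivable1_diffP; case: (de t).
have cF : continuous F.
  by move=> t; apply: differentiable_continuous; apply/derivable1_diffP; case: (dF t).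
rewrite integral_itv_obnd_cbnd; last first.
  apply/measurable_EFinP; apply: measurable_funTS; exact: continuous_measurable_fun.
rewrite (@continuous_FTC2 _ _ F) //; last 3 first.
- exact: continuous_subspaceT.
- split.
  + by move=> t _; case: (dF t).
  + by apply: cvg_at_right_filter; exact: cF.
  + by apply: cvg_at_left_filter; exact: cF.
- by move=> t _; rewrite derive1E; case: (dF t).
rewrite -EFinB lee_fin /F subrr mulr0 oppr0 expR0 mulr1 opprK.
by rewrite gerDr mulNr oppr_le0 mulr_ge0 ?expR_ge0 // invr_ge0 ltW.
Qed.

Section Occupation.
Context {dW : measure_display} {W : measurableType dW} {R : realType}.
Variables (Q : probability W R) (T : R) (N : set (R * W)).
Hypothesis mN : measurable N.
Hypothesis NT : forall p, N p -> 0 < p.1 <= T.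
Local Notation leb := (@lebesgue_measure R).

Definition occupied s w := leb (ysection N w `&` `]s, T]%classic).

Lemma occupied_ge0 s w : (0 <= occupied s w)%E.
Proof. exact: measure_ge0. Qed.

Lemma measurable_occupied s : measurable_fun setT (occupied s).
Proof.
have mD : measurable (N `&` (`]s, T] `*` setT)).
  by apply: measurableI => //; apply: measurableX => //; exact: measurable_itv.
have := measurable_fun_ysection leb mD.
congr measurable_fun; apply/funext => w; rewrite /occupied /=; congr (leb _).
by rewrite !ysectionE; apply/seteqP; split => t /=; [case=> ? []|case].
Qed.

Lemma occupied_le s w : 0 <= s <= T -> (occupied s w <= T%:E)%E.
Proof.
move=> /andP[s0 sT].
have e : leb (`]s, T]%classic : set R) = (T - s)%:E.
  rewrite lebesgue_measure_itv /= lte_fin -EFinD.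
  by case: ltgtP sT => // -> _; rewrite subrr.
apply: (@le_trans _ _ (leb (`]s, T]%classic : set R))); last first.
  by rewrite [X in (X <= _)%E]e lee_fin gerBl.
apply: le_measure; rewrite ?inE; [|exact: measurable_itv|exact: subIsetr].
by apply: measurableI; [exact: measurable_ysection|exact: measurable_itv].
Qed.

Lemma occupied_integral s w (f : R -> R) :
  (forall t, s < t <= T -> f t = \1_(ysection N w) t) ->
  (\int[leb]_(t in `[s, T]) (f t)%:E = occupied s w)%E.
Proof.
move=> fE; have mB : measurable (ysection N w) by exact: measurable_ysection.
rewrite -integral_itv_obnd_cbnd; last first.
  have mi : measurable_fun `]s, T]%classic (EFin \o (\1_(ysection N w) : R -> R)).
    by apply/measurable_EFinP; apply: measurable_funTS; exact: measurable_indic.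
  apply: eq_measurable_fun mi => t.
  by rewrite inE /= in_itv /= => /fE ->.
under eq_integral => t.
  rewrite inE /= in_itv /= => /fE ->; over.
by rewrite integral_indic //; exact: measurable_itv.
Qed.

Lemma occupied_le_integral (s K : R) (A : set W) (b : R -> R) : measurable A ->
  (forall t, s < t <= T -> (Q (A `&` xsection N t) <= Q A * (b t)%:E)%E) ->
  (forall t, 0 <= b t) -> measurable_fun `]s, T] b ->
  (\int[leb]_(t in `]s, T]) (b t)%:E <= K%:E)%E ->
  (\int[Q]_(w in A) occupied s w <= Q A * K%:E)%E.
Proof.
move=> mA hb b0 mb bK; rewrite -tonelli_sections_on //.
have fA : Q A \is a fin_num by exact: fin_num_measure.
apply: (@le_trans _ _ (\int[leb]_(t in `]s, T]) ((fine (Q A))%:E * (b t)%:E))%E).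
  apply: ge0_le_integral_dom => t; first by [].
  by rewrite /= in_itv /= => st; rewrite fineK //; exact: hb.
rewrite ge0_integralZl_EFin //; last 3 first.
- by move=> t _; rewrite lee_fin.
- exact/measurable_EFinP.
- exact: fine_ge0.
by rewrite fineK //; apply: lee_pmul => //; apply: integral_ge0 => t _; rewrite lee_fin.
Qed.

(** By sqr_length_le and Tonelli, the second moment is at most twice the integral over t
of the expectation, on the event xsection N t, of the time spent in N after t. *)
Lemma occupied_sqr_integral (K : R) :
  0 <= K ->
  (forall t, 0 < t <= T ->
    (\int[Q]_(w in xsection N t) occupied t w <= Q (xsection N t) * K%:E)%E) ->
  (\int[Q]_w occupied 0 w <= K%:E)%E ->
  (\int[Q]_w (occupied 0 w * occupied 0 w) <= (2 * K ^+ 2)%:E)%E.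
Proof.
move=> K0 hK h0.
(* pairs of times r > t in the same section of N *)
pose D : set (R * (R * W)) := [set p | [/\ N (p.1, p.2.2), N (p.2.1, p.2.2) & p.2.1 < p.1]].
have mD : measurable D.
  have m1 : measurable_fun setT (fun p : R * (R * W) => (p.1, p.2.2)).
    by apply: measurable_fun_pair => //; exact: measurableT_comp.
  have m2 : measurable_fun setT (fun p : R * (R * W) => p.2).
    exact: measurable_snd.
  have m3 : measurable (setT `&` [set p : R * (R * W) | p.2.1 < p.1]).
    by apply: measurable_fun_ltr => //; exact: measurableT_comp.
  rewrite (_ : D = (setT `&` (fun p => (p.1, p.2.2)) @^-1` N) `&`
    ((setT `&` (fun p => p.2) @^-1` N) `&` (setT `&` [set p : R * (R * W) | p.2.1 < p.1]))).
    by apply: measurableI; [exact: m1|apply: measurableI => //; exact: m2].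
  apply/seteqP; split => -[r [t w]] /=; first by move=> [? ? ?].
  by move=> [[_ ?] [[_ ?] [_ ?]]].
pose F (p : R * W) := leb (ysection D p).
have mF : measurable_fun setT F by exact: measurable_fun_ysection.
have F0 p : (0 <= F p)%E by exact: measure_ge0.
have FE t w : F (t, w) = ((fun w => occupied t w) \_ (xsection N t)) w.
  rewrite /F /patch; case: ifPn; rewrite ?inE ?notin_setE xsectionE /= => Ntw.
    congr (leb _); rewrite !ysectionE; apply/seteqP; split => r /=; rewrite in_itv /=.
      by move=> [/= h _ tr]; split => //; rewrite tr /=; have /andP[] := NT h.
    by move=> [h /andP[tr _]].
  rewrite (_ : ysection _ _ = set0) ?measure0 // ysectionE.
  by apply/seteqP; split => r //= [].
have FE2 t w : F (t, w) = ((fun t => occupied t w) \_ (ysection N w)) t.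
  by rewrite FE /patch xsectionE ysectionE.
have Ny w : ysection N w `<=` `]0, T]%classic.
  by rewrite ysectionE => t /= /NT; rewrite in_itv.
have y0 w : ysection N w `&` `]0, T]%classic = ysection N w by apply: setIidl.
apply: (@le_trans _ _ (\int[Q]_w (2%:E * \int[leb]_t F (t, w)))%E).
  apply: ge0_le_integral_dom => w _; first by rewrite mule_ge0.
  rewrite /occupied y0; under [in leRHS]eq_integral do rewrite FE2.
  rewrite -integral_mkcond; apply: sqr_length_le => //.
  exact: measurable_ysection.
rewrite ge0_integralZl_EFin //; last 2 first.
- by move=> w _; apply: integral_ge0.
- exact: (measurable_fun_fubini_tonelli_G (m1 := leb) F).
rewrite -(fubini_tonelli (m1 := leb) (m2 := Q) F) //.
rewrite EFinM; apply: lee_pmul => //; first by apply: integral_ge0 => t _; apply: integral_ge0.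
apply: (@le_trans _ _ (\int[leb]_t (K%:E * Q (xsection N t)))%E).
  apply: ge0_le_integral_dom => t _; first by apply: integral_ge0.
  under eq_integral do rewrite FE.
  rewrite -integral_mkcond muleC.
  have [t0|t0] := pselect (0 < t <= T); first exact: hK.
  rewrite (_ : xsection N t = set0) ?integral_set0 ?measure0 ?mul0e //.
  by rewrite xsectionE; apply/seteqP; split => w //= /NT.
rewrite ge0_integralZl_EFin //; last exact: measurable_fun_xsection.
rewrite expr2 EFinM; apply: lee_pmul => //; first by apply: integral_ge0.
rewrite tonelli_sections //; apply: le_trans h0.
by rewrite /occupied; under [in leRHS]eq_integral do rewrite y0.
Qed.

End Occupation.

Section Distance.
Context {R : realType} {d : nat}.

(** The nearest point of the k-th hyperplane is obtained by setting the k-th coordinate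
to 0. *)
Lemma edist_SigmaP (x : 'rV[R]_d) (rho : R) : (1 <= d)%N ->
  (Defs.edist x Sigma <= rho%:E)%E <-> exists k, `|x 0 k| <= rho.
Proof.
move=> d1; split.
  pose k0 : 'I_d := Ordinal d1.
  have [k _ hk] := @Order.TotalTheory.arg_minP _ _ _ k0 xpredT (fun k => `|x 0 k|) isT.
  move=> h; exists k; rewrite -lee_fin; apply: le_trans h.
  apply: le_ereal_inf_tmp => _ [y [j _ /= yj] <-]; rewrite lee_fin.
  apply: le_trans (hk j isT) _; apply: le_trans (coord_le_enorm _ j).
  by rewrite !mxE yj subr0.
move=> [k hk]; apply: (@le_trans _ _ `|x 0 k|%:E); last by rewrite lee_fin.
pose y := x - x 0 k *: delta_mx 0 k.
apply: ereal_inf_lbound; exists y.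
  by exists k => //; rewrite /= !mxE !eqxx mulr1 subrr.
congr EFin; rewrite /y opprB addrCA subrr addr0.
rewrite -[LHS]ger0_norm ?enorm_ge0 // -sqrtr_sqr enorm_sqr (bigD1 k) //= big1; last first.
  by move=> i ik; rewrite !mxE (negbTE ik) andbF mulr0 expr0n.
by rewrite addr0 !mxE !eqxx mulr1 sqrtr_sqr.
Qed.

End Distance.

Section JointMeasurability.
Context {dW : measure_display} {W : measurableType dW} {R : realType}.

(** The grid values lstep are jointly measurable and converge to the left limits; outside
of ]0, T] they are 0, like the limit. *)
Lemma measurable_left_value_joint (T : R) (x xl : R -> W -> R) : 0 < T ->
  (forall t, 0 <= t <= T -> measurable_fun setT (x t)) ->
  (forall w t, 0 < t <= T -> x s w @[s --> t^'-] --> xl t w) ->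
  measurable_fun setT (fun p : R * W => if 0 < p.1 <= T then xl p.1 p.2 else 0).
Proof.
move=> T0 mx x_left.
apply: (@measurable_fun_cvg _ _ _ _ (fun n (p : R * W) => lstep T n (x ^~ p.2) p.1)).
  move=> n; apply: measurable_sum => j; apply: measurable_funM.
    apply: measurableT_comp; last exact: measurable_fst.
    by apply: measurable_indic; exact: measurable_itv.
  apply: (@measurableT_comp _ _ _ _ _ _ (x (j%:R * (T / n.+1%:R))) _ snd) => //.
  have dl0 : 0 < T / n.+1%:R by rewrite divr_gt0.
  have nd : n.+1%:R * (T / n.+1%:R) = T by field; rewrite nat1r.
  apply: mx; rewrite mulr_ge0 ?(ltW dl0) //=.
  by rewrite -[leRHS]nd ler_pM2r // ler_nat ltnW // ltn_ord.
move=> [t w] _ /=; have [tT|tT] := boolP (0 < t <= T).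
  by apply: lstep_cvg => //; exact: x_left.
under eq_fun do rewrite (lstep_out _ _ T0 (negP tT)).
exact: cvg_cst.
Qed.

End JointMeasurability.

Section IntegralBounds.
Variables (R : realType) (D : set R).
Hypothesis mD : measurable D.
Local Notation leb := (@lebesgue_measure R).

(** Packages a bound on an integral with what is needed to add and scale such bounds. *)
Definition integral_within (f : R -> R) (K : R) : Prop :=
  [/\ measurable_fun D f, forall t, 0 <= f t & (\int[leb]_(t in D) (f t)%:E <= K%:E)%E].

Lemma integral_within_add f g K L : integral_within f K -> integral_within g L ->
  integral_within (fun t => f t + g t) (K + L).
Proof.
move=> [mf f0 fK] [mg g0 gL]; split; first exact: measurable_funD.
  by move=> t; rewrite addr_ge0.
under eq_integral do rewrite EFinD.
rewrite ge0_integralD //; [|by move=> t _; rewrite lee_fin|exact/measurable_EFinP|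
  by move=> t _; rewrite lee_fin|exact/measurable_EFinP].
by rewrite EFinD leeD.
Qed.

Lemma integral_within_scale f K a : 0 <= a -> integral_within f K ->
  integral_within (fun t => a * f t) (a * K).
Proof.
move=> a0 [mf f0 fK]; split; first exact: measurable_funM.
  by move=> t; rewrite mulr_ge0.
under eq_integral do rewrite EFinM.
rewrite ge0_integralZl_EFin //; [|by move=> t _; rewrite lee_fin|exact/measurable_EFinP].
by rewrite EFinM; apply: lee_pmul => //; apply: integral_ge0 => t _; rewrite lee_fin.
Qed.

Lemma integral_within_sum (I : finType) (f : I -> R -> R) (K : I -> R) :
  (forall i, integral_within (f i) (K i)) ->
  integral_within (fun t => \sum_i f i t) (\sum_i K i).
Proof.
move=> h; have : forall r : seq I,
    integral_within (fun t => \sum_(i <- r) f i t) (\sum_(i <- r) K i).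
  elim=> [|i r IH]; last first.
    rewrite big_cons; under eq_fun do rewrite big_cons; exact: integral_within_add.
  rewrite big_nil; split.
  - by under eq_fun do rewrite big_nil; exact: measurable_cst.
  - by move=> t; rewrite big_nil.
  - by under eq_integral do rewrite big_nil; rewrite integral0.
exact.
Qed.

End IntegralBounds.

(** The constant C of the conditional bound. The factor 2 / cos 1 ^+ 2 comes from
n^-1 <= 2 rho for n = floor (1 / rho), and the bracket bounds the time integral of
1 + 2 sum_m exp (- delta m^upsilon (t - s) / 2). *)
Definition occupation_rate (R : realType) (T : R) (d : nat) (upsilon : R) (c : 'I_d -> R)
    (kappa : R) : R :=
  2 / cos 1 ^+ 2 * \sum_(k < d) (T + 4 / decay_rate (T := T) c k kappa * (1 + (upsilon - 1)^-1)).

Section Rate.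
Context {R : realType} {T : R} {d : nat}.
Variables (upsilon : R) (c : 'I_d -> R) (kappa : R).
Hypothesis ub : 1 < upsilon < 2.
Hypothesis c0 : forall j, 0 < c j.
Hypothesis T0 : 0 < T.
Hypothesis kappa0 : 0 <= kappa.
Let dr k := decay_rate (T := T) c k kappa.

Lemma occupation_rate_ge0 : 0 <= occupation_rate T upsilon c kappa.
Proof.
have /andP[u1 _] := ub.
rewrite /occupation_rate mulr_ge0 ?divr_ge0 ?sqr_ge0 //.
apply: sumr_ge0 => k _; rewrite addr_ge0 ?(ltW T0) // mulr_ge0 //.
  by rewrite divr_ge0 // ltW // decay_rate_gt0 // ltW.
by rewrite addr_ge0 // invr_ge0 subr_ge0 ltW.
Qed.

(** The bound that the Fejer kernel of order n gives for the probability, conditionally on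
the past of s, of being near Sigma at time t. *)
Definition ball_bound (n : nat) (s t : R) : R :=
  (n%:R * cos 1 ^+ 2)^-1 * \sum_(k < d) (1 + 2 * \sum_(j < n)
    expR (- (dr k * j.+1%:R `^ upsilon / 2 * (t - s)))).

Lemma cos1_sqr_gt0 : 0 < cos 1 ^+ 2 :> R.
Proof. by rewrite exprn_gt0 // cos1_gt0. Qed.

Lemma ball_bound_integral (rho s : R) : 0 < rho <= 1 -> 0 <= s <= T ->
  integral_within `]s, T] (ball_bound (Num.truncn rho^-1) s)
    (occupation_rate T upsilon c kappa * rho).
Proof.
move=> /andP[r0 r1] /andP[s0 sT]; set n := Num.truncn rho^-1.
have /andP[u1 u2] := ub.
have i1 : 1 <= rho^-1 by rewrite invf_ge1.
(* as rho <= 1, the integer n is positive and rho^-1 < n + 1 <= 2 n *)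
have n1 : (0 < n)%N by rewrite /n truncn_gt0.
have nr : (n%:R)^-1 <= 2 * rho.
  have h : rho^-1 < n.+1%:R by exact: truncnS_gt.
  rewrite -[leRHS]invrK lef_pV2 ?posrE ?ltr0n ?invr_gt0 ?mulr_gt0 // invfM.
  have h1 : (n.+1%:R : R) <= 2 * n%:R by rewrite -natrM ler_nat mul2n -addnn -addn1 leq_add2l.
  by rewrite ler_pdivrMl //; exact: le_trans (ltW h) h1.
have mD : measurable (`]s, T]%classic : set R) by exact: measurable_itv.
have w1 : integral_within `]s, T] (fun=> 1) T.
  split => //; rewrite integral_cst // mul1e.
  have e : lebesgue_measure (`]s, T]%classic : set R) = (T - s)%:E.
    rewrite lebesgue_measure_itv /= lte_fin -EFinD.
    by case: ltgtP sT => // -> _; rewrite subrr.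
  by rewrite [X in (X <= _)%E]e lee_fin gerBl.
pose a k (j : nat) := dr k * j.+1%:R `^ upsilon / 2.
have dr0 k : 0 < dr k by apply: decay_rate_gt0 => //; exact: ltW.
have a0 k j : 0 < a k j by rewrite divr_gt0 // mulr_gt0 // powR_gt0.
have wg k (j : 'I_n) : integral_within `]s, T] (fun t => expR (- (a k j * (t - s)))) (a k j)^-1.
  split.
  - apply: measurable_funTS; apply: measurableT_comp; first exact: measurable_expR.
    by apply: measurable_funN; apply: measurable_funM => //; apply: measurable_funB.
  - by move=> t; exact: expR_ge0.
  - exact: integral_decay_le.
have wk k := integral_within_add mD w1 (integral_within_scale mD (ler0n _ 2)
  (integral_within_sum mD (wg k))).
have nc0 : 0 <= (n%:R * cos 1 ^+ 2)^-1 :> R by rewrite invr_ge0 mulr_ge0 ?sqr_ge0.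
have [h1 h2 h3] := integral_within_scale mD nc0 (integral_within_sum mD wk).
split => //; apply: le_trans h3 _; rewrite lee_fin.
apply: (@le_trans _ _ ((n%:R * cos 1 ^+ 2)^-1 *
    \sum_(k < d) (T + 4 / dr k * (1 + (upsilon - 1)^-1)))).
  apply: ler_wpM2l => //; apply: ler_sum => k _; rewrite lerD2l.
  rewrite (_ : 2 * _ = 4 / dr k * \sum_(j < n) j.+1%:R `^ (- upsilon)).
    by apply: ler_wpM2l; [rewrite divr_ge0 // ltW|exact: sum_powR_le].
  rewrite !mulr_sumr; apply: eq_bigr => j _.
  by rewrite /a powRN; field; rewrite !gt_eqF // powR_gt0.
rewrite /occupation_rate; set S := \sum_(k < d) _.
have S0 : 0 <= S.
  apply: sumr_ge0 => k _; rewrite addr_ge0 ?(ltW T0) // mulr_ge0 //.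
    by rewrite divr_ge0 // ltW.
  by rewrite addr_ge0 // invr_ge0 subr_ge0 ltW.
rewrite [leRHS]mulrAC; apply: ler_wpM2r => //.
by rewrite invfM [leRHS]mulrAC; apply: ler_wpM2r => //; rewrite invr_ge0 sqr_ge0.
Qed.

End Rate.

Lemma measurable_norm_le (dS : measure_display) (S : measurableType dS) (R : realType)
    (f : S -> R) (r : R) : measurable_fun setT f -> measurable [set w | `|f w| <= r].
Proof.
move=> mf; rewrite -[X in measurable X]setTI; apply: measurable_fun_ler => //.
exact: measurableT_comp.
Qed.

Section SmallBallUnion.
Context {dW : measure_display} {W : measurableType dW} {R : realType}.
Variable Q : probability W R.

Lemma measure_union_le (I : finType) (A : set W) (B : I -> set W) :
  measurable A -> (forall i, measurable (B i)) ->
  (Q (A `&` [set w | exists i, B i w]) <= \sum_i Q (A `&` B i))%E.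
Proof.
move=> mA mB.
have h : forall r : seq I, measurable (\big[setU/set0]_(i <- r) (A `&` B i)) /\
    (Q (\big[setU/set0]_(i <- r) (A `&` B i)) <= \sum_(i <- r) Q (A `&` B i))%E.
  elim=> [|i r [mI IH]]; first by rewrite !big_nil measure0.
  have mi : measurable (A `&` B i) by exact: measurableI.
  rewrite !big_cons; split; first exact: measurableU.
  by apply: le_trans (measureU2 _ mi mI) _; exact: leeD2l.
have [mU hU] := h (index_enum I); apply: le_trans hU.
have e : A `&` [set w | exists i, B i w] = \big[setU/set0]_(i <- index_enum I) (A `&` B i).
  rewrite -bigcup_seq; apply/seteqP; split => w /=.
    by move=> [Aw [i Bi]]; exists i => //=; rewrite mem_index_enum.
  by move=> [i _ [Aw Bi]]; split => //; exists i.
by rewrite e.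
Qed.

(** The union of the small balls of the coordinates, the frequencies being integers. *)
Lemma small_ball_union (d : nat) (A : set W) (Y : 'I_d -> W -> R) (n : nat) (rho : R)
    (g : 'I_d -> nat -> R) :
  measurable A -> (forall k, measurable_fun setT (Y k)) -> (0 < n)%N -> n%:R * rho <= 1 ->
  (forall k j, 0 <= g k j) ->
  (forall k m, (0 < m)%N -> `|\int[Q]_(w in A) cos (m%:R * Y k w)| <= fine (Q A) * g k m) ->
  (Q (A `&` [set w | exists k, `|Y k w| <= rho]%R) <=
   Q A * ((n%:R * cos 1 ^+ 2)^-1 * \sum_(k < d) (1 + 2 * \sum_(j < n) g k j.+1))%:E)%E.
Proof.
move=> mA mY n0 nr g0 hg.
have nR : (0 : R) < n%:R by rewrite ltr0n.
have mB k : measurable [set w | n%:R * `|Y k w| <= 1].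
  rewrite -[X in measurable X]setTI; apply: measurable_fun_ler => //.
  by apply: measurable_funM => //; exact: measurableT_comp.
have mB' k : measurable [set w | `|Y k w| <= rho] by exact: measurable_norm_le.
have fQ B : measurable B -> Q B \is a fin_num by move=> mC; exact: fin_num_measure.
apply: le_trans (measure_union_le mA mB') _.
rewrite -[Q A]fineK ?fQ // -EFinM mulr_sumr mulr_sumr -sumEFin.
apply: lee_sum => k _.
apply: (@le_trans _ _ (Q (A `&` [set w | n%:R * `|Y k w| <= 1]))).
  apply: le_measure; rewrite ?inE; [exact: measurableI|exact: measurableI|].
  move=> w [Aw /= h]; split => //=; apply: le_trans nr.
  by rewrite ler_pM2l.
have mAB : measurable (A `&` [set w | n%:R * `|Y k w| <= 1]) by exact: measurableI.
rewrite -[leLHS]fineK ?fQ // lee_fin.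
have h := @fejer_small_ball R _ W Q A (Y k) n (g k) mA (mY k) (g0 k) (hg k).
have c0 : 0 < cos 1 ^+ 2 :> R by exact: cos1_sqr_gt0.
have q0 : 0 < n%:R ^+ 2 * cos 1 ^+ 2 :> R by rewrite mulr_gt0 // exprn_gt0.
rewrite -(ler_pM2l q0); apply: le_trans h _.
rewrite le_eqVlt; apply/orP; left; apply/eqP.
by field; rewrite !gt_eqF // cos1_gt0.
Qed.

End SmallBallUnion.

(** * Conditional expectations *)

Section ConditionalExpectation.
Context {dW : measure_display} {W : measurableType dW} {R : realType}.
Variables (Q : probability W R) (G : set (set W)).
Hypothesis sG : sigma_algebra setT G.
Hypothesis Gm : G `<=` measurable.
Variable Z : W -> R.
Hypothesis Z0 : forall w, 0 <= Z w.
Hypothesis iZ : Q.-integrable setT (EFin \o Z).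
Local Notation GT := (g_sigma_algebraType G).

Let mGT (A : set W) : measurable (A : set GT) -> measurable A.
Proof.
by move: A; apply: smallest_sub => //; exact: sigma_algebra_measurable.
Qed.

Definition integral_on (A : set GT) : \bar R := \int[Q]_(w in A) (Z w)%:E.

Let mZ : measurable_fun setT (fun w => (Z w)%:E).
Proof. by case/integrableP : iZ. Qed.

Let integral_on0 : integral_on set0 = 0%E.
Proof. by rewrite /integral_on integral_set0. Qed.

Let integral_on_ge0 A : (0 <= integral_on A)%E.
Proof. by apply: integral_ge0 => w _; rewrite lee_fin. Qed.

Let integral_on_sigma_additive : semi_sigma_additive integral_on.
Proof.
move=> F mF tF mUF.
have Z0' w : (0 <= (Z w)%:E)%E by rewrite lee_fin.
by apply: (semi_sigma_additive_nng_induced mZ Z0') => //; [move=> i; exact: mGT|exact: mGT].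
Qed.

HB.instance Definition _ := isMeasure.Build _ GT R integral_on
  integral_on0 integral_on_ge0 integral_on_sigma_additive.

Let integral_on_fin : fin_num_fun integral_on.
Proof.
move=> A mA; apply: integrable_fin_num; first exact: mGT.
by apply: integrableS iZ => //; exact: mGT.
Qed.

HB.instance Definition _ := @Measure_isFinite.Build _ GT R integral_on integral_on_fin.

(** The Radon-Nikodym derivative, on the sigma-algebra G, of the measure with density Z. *)
Lemma conditional_version : exists Y : W -> R,
  [/\ Q.-integrable setT (EFin \o Y), measurable_wrt G Y &
    forall A, G A -> (\int[Q]_(w in A) (Y w)%:E = \int[Q]_(w in A) (Z w)%:E)%E].
Proof.
have mid : measurable_fun setT (id : W -> GT).
  by move=> _ A mA; rewrite setTI; exact: mGT.
(* the image of Q under the identity is the restriction of Q to G *)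
pose idm := mfun_Sub (mem_set mid : (id : W -> GT) \in mfun).
pose mu : probability GT R := distribution Q idm.
have dom : integral_on `<< mu.
  apply/null_content_dominatesP => A mA QA.
  rewrite /integral_on; apply: null_set_integral.
  - exact: mGT.
  - exact: measurable_funTS.
  - exact: QA.
have [f [f0 ffin fi fE]] := radon_nikodym_sigma_finite dom.
have mf : measurable_fun setT f by case/integrableP : fi.
have fQ (A : set W) : measurable (A : set GT) ->
    (\int[mu]_(w in A) f w = \int[Q]_(w in A) f w)%E.
  move=> mA; rewrite ge0_integral_pushforward //.
  exact: measurable_funTS.
pose Y (w : W) := fine (f w).
have YE w : (Y w)%:E = f w by rewrite fineK.
have mY : measurable_fun setT (Y : GT -> R).
  by apply: measurableT_comp => //; exact: fine_measurable.
have mYW : measurable_fun setT Y.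
  move=> _ C mC; rewrite setTI; have := mY measurableT C mC; rewrite setTI => h.
  exact: (mGT h).
exists Y; split.
- apply/integrableP; split; first exact/measurable_EFinP.
  under eq_integral do rewrite /= ger0_norm ?fine_ge0 // YE.
  rewrite -(fQ setT) //; case/integrableP : fi => _.
  by under eq_integral do rewrite gee0_abs //.
- move=> C mC.
  have : measurable (Y @^-1` C : set GT) by rewrite -[X in measurable X]setTI; exact: mY.
  by move: (Y @^-1` C); exact: smallest_sub.
move=> A GA; have mA : measurable (A : set GT) by exact: sub_sigma_algebra.
by under eq_integral do rewrite YE; rewrite -fQ // -fE.
Qed.

End ConditionalExpectation.

Section AboveLevel.
Context {dW : measure_display} {W : measurableType dW} {R : realType}.
Variable Q : probability W R.

(** On {a < Y} the positive function Y - a has a nonpositive integral. *)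
Lemma above_level_null (Y : W -> R) (a : R) :
  Q.-integrable setT (EFin \o Y) ->
  (\int[Q]_(w in [set w | (a < Y w)%R]) (Y w)%:E <= a%:E * Q [set w | (a < Y w)%R])%E ->
  Q [set w | a < Y w] = 0%E.
Proof.
move=> iY; set D := [set w | _].
have mY : measurable_fun setT Y by apply/measurable_EFinP; case/integrableP : iY.
have mD : measurable D.
  by rewrite -[X in measurable X]setTI; apply: measurable_fun_ltr.
have iYD : Q.-integrable D (EFin \o Y) by exact: integrableS iY.
have ia : Q.-integrable D (EFin \o cst a).
  by apply: (@bounded_integrable _ _ _ Q D (cst a) `|a|).
rewrite -integral_cst // => h.
have i0 : (\int[Q]_(w in D) `| (Y w - a)%:E | = 0)%E.
  apply/eqP; rewrite eq_le; apply/andP; split; last by apply: integral_ge0.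
  rewrite (_ : (\int[Q]_(w in D) `| (Y w - a)%:E | =
      \int[Q]_(w in D) (Y w)%:E - \int[Q]_(w in D) cst a%:E w)%E).
    by rewrite leeBlDr ?add0e //; exact: (integrable_fin_num mD ia).
  rewrite -integralB //; apply: eq_integral => w; rewrite inE => Dw.
  by rewrite gee0_abs // lee_fin subr_ge0 ltW.
have mYa : measurable_fun D (fun w => (Y w - a)%:E).
  by apply/measurable_EFinP; apply: measurable_funB => //; exact: measurable_funTS.
have /(ae_eq_integral_abs Q mD mYa) [N [mN QN hN]] := i0.
apply/eqP; rewrite eq_le measure_ge0 andbT -QN; apply: le_measure; rewrite ?inE //.
move=> w Dw; apply: hN => /= /(_ Dw) /eqP; rewrite eqe subr_eq0 => /eqP e.
by move: Dw; rewrite /D /= e ltxx.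
Qed.

End AboveLevel.

(** * The occupation time of the solution *)

Section Solution.
Context {R : realType} {T : R} {d : nat}.
Variables (upsilon : R) (c : 'I_d -> R).
Variable Pi : {sigma_finite_measure set 'rV[R]_d -> \bar R}.
Hypothesis ub : 1 < upsilon < 2.
Hypothesis c0 : forall j, 0 < c j.
Hypothesis Pi_stable : truncated_stable upsilon c Pi.
Hypothesis T0 : 0 < T.
Hypothesis d1 : (1 <= d)%N.
Variable P : probability (omega T d) R.
Hypothesis PRM : poisson_random_measure Pi P.
Hypothesis ind : independent_coordinates P.
Variables (q kappa eps LH : R) (H : probability 'rV[R]_d R -> 'rV[R]_d) (h : R -> 'rV[R]_d).
Hypothesis kappa0 : 0 <= kappa.
Hypothesis q1 : 1 <= q.
Hypothesis H_lipschitz : forall mu nu, P2 mu -> P2 nu ->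
  enorm (H mu - H nu) <= LH * W2 mu nu.
Hypothesis mh : measurable_fun `[0, T] h.
Hypothesis h_Lq : (\int[lebesgue_measure]_(t in `[0%R, T]) (enorm (h t) `^ q)%:E < +oo)%E.
Variable X : R -> omega T d -> 'rV[R]_d.
Hypothesis solX : solution Pi kappa H h eps P X.
Local Notation Pc := (completion P).
Local Notation Wc := (completed P).
Local Notation leb := (@lebesgue_measure R).

Lemma solution_measurable t : 0 <= t <= T -> measurable_fun setT (X t : Wc -> 'rV[R]_d).
Proof.
by case: solX => aX _ _ _; exact: (@adapted_measurable_fun R T d (ltW T0) P _ _ X t aX).
Qed.

Lemma left_limit_cvg t w k : 0 < t <= T ->
  X s w 0 k @[s --> t^'-] --> left_limit X t w 0 k.
Proof.
case: solX => _ cX _ _ tT; have [_ /(_ t tT) h1] := cX w.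
exact: (continuous_cvg _ (@coord_continuous R 1 d 0 k _) h1).
Qed.

(** The map t |-> H (mu t) is right-continuous and bounded, and h is integrable, so the
drift splits into the linear term and the integral of a deterministic function; the
equation then has the form required by left_limit_chf. *)
Lemma solution_chf (k : 'I_d) (s t lambda : R) (A : set (omega T d)) :
  0 <= s -> s < t -> t <= T -> 1 <= lambda -> FP P s A ->
  `|\int[Pc]_(w in A) cos (lambda * left_limit X t w 0 k)| <=
  fine (Pc A) * expR (- (decay_rate (T := T) c k kappa * lambda `^ upsilon * ((t - s) / 2))).
Proof.
have mX := solution_measurable.
case: (solX) => aX cX supX [mu [J [muE Jint Xeq]]].
pose b s := H (mu s) 0 k + h s 0 k.
have [Mb hMb] := mean_field_bounded T0 mX supX muE H_lipschitz k.
have rcH := mean_field_right_continuous T0 mX cX supX muE H_lipschitz (k := k).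
have T0' := ltW T0.
have mHk : measurable_fun `[0, T] (fun s => H (mu s) 0 k).
  exact: measurable_right_continuous.
have mD : measurable (`[0, T]%classic : set R) by exact: measurable_itv.
have ih := coord_integrable_Lq k q1 T0' mh h_Lq.
have lT : (leb `[0%R, T]%classic < +oo)%E.
  have e : leb (`[0, T]%classic : set R) = (T - 0)%:E.
    by rewrite lebesgue_measure_itv /= lte_fin T0 -EFinD.
  by rewrite [X in (X < _)%E]e ltry.
have iH : leb.-integrable `[0, T] (EFin \o (fun s => H (mu s) 0 k)).
  apply: measurable_bounded_integrable => //; exists Mb; split; first exact: num_real.
  move=> y yM r; rewrite /= in_itv /= => rT; apply: le_trans (ltW yM); exact: hMb.
have ib : leb.-integrable `[0, T] (EFin \o b).
  by apply: integrableDr.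
have xb w : exists M, forall r, 0 <= r <= T -> `|X r w 0 k| <= M.
  have [h1 h2] := cX w; apply: cadlag_bounded => r rT.
    exact: (continuous_cvg _ (@coord_continuous R 1 d 0 k _) (h1 r rT)).
  apply/cvg_ex; exists (left_limit X r w 0 k); exact: left_limit_cvg.
apply: (@left_limit_chf R T d upsilon c Pi ub c0 Pi_stable T0' P PRM ind k kappa eps
  (fun r w => X r w 0 k) (fun r w => left_limit X r w 0 k) (J k)
  (fun r => \int[leb]_(u in `]0, r]) b u) kappa0).
- move=> r rT; exact: (measurableT_comp (measurable_coord k) (mX r rT)).
- move=> r rT; have [aJ _ _] := Jint k.
  exact: (@adapted_measurable_fun R T d T0' P _ _ (J k) r aJ rT).
- by move=> w r rT; exact: left_limit_cvg.
- by apply: aeW => w; exact: xb.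
- apply: completed_ae; move: Xeq; apply: filterS => w Xe r rT.
  have /andP[r0 rT'] := rT.
  rewrite (Xe r rT k).
  have [M hM] := xb w.
  have il : leb.-integrable `]0, r] (EFin \o (fun u => left_limit X u w 0 k)).
    have [rp|rn] := ltP 0 r; last first.
      by rewrite set_itv_ge ?bnd_simp -?leNgt //; exact: integrable_set0.
    apply: (@bounded_itv_integrable R r rp `]0, r]%classic _ M) => //.
    + apply: (@measurable_left_value R r (fun u => X u w 0 k) _ rp) => u /andP[u0 ur].
      by apply: left_limit_cvg; rewrite u0 (le_trans ur).
    + move=> u /andP[u0 ur].
      apply: (@left_value_le R r M (fun u => X u w 0 k) (fun u => left_limit X u w 0 k) rp).
      * by move=> v /andP[v0 vr]; apply: hM; rewrite v0 (le_trans vr).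
      * by move=> v /andP[v0 vr]; apply: left_limit_cvg; rewrite v0 (le_trans vr).
      * by rewrite u0.
  have ibr : leb.-integrable `]0, r] (EFin \o b).
    apply: (integrableS _ _ _ ib) => //.
    by move=> u; rewrite /= !in_itv /= => /andP[u0 ur]; rewrite (ltW u0) (le_trans ur).
  have ikl : leb.-integrable `]0, r] (EFin \o (fun u => - kappa * left_limit X u w 0 k)).
    by apply: integrableZlr => //; exact: measurable_itv.
  have -> : \int[leb]_(u in `[0, r]) (- kappa *: left_limit X u w + H (mu u) + h u) 0 k =
      - kappa * \int[leb]_(u in `]0, r]) left_limit X u w 0 k + \int[leb]_(u in `]0, r]) b u.
    have e u : (- kappa *: left_limit X u w + H (mu u) + h u) 0 k =
        - kappa * left_limit X u w 0 k + b u.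
      by rewrite !mxE /b addrA.
    rewrite -Rintegral_itv_obnd_cbnd; last first.
      rewrite (_ : _ \o _ = EFin \o (fun u => - kappa * left_limit X u w 0 k + b u)).
        by apply: integrableDr => //; exact: measurable_itv.
      by apply/funext => u /=; rewrite e.
    under eq_Rintegral do rewrite e.
    by rewrite RintegralD // RintegralZl.
  by ring.
- exact: Jint.
Qed.


Definition near_set (rho : R) : set (R * Wc) :=
  [set p | 0 < p.1 <= T /\ (Defs.edist (left_limit X p.1 p.2) Sigma <= rho%:E)%E].

Lemma left_limit_adapted t k : 0 < t <= T ->
  measurable_fun setT (fun w : g_sigma_algebraType (FP P t) => left_limit X t w 0 k).
Proof.
move=> tT; have /andP[t0 t1] := tT.
case: (solX) => aX _ _ _.
apply: (@measurable_fun_cvg _ (g_sigma_algebraType (FP P t)) R setT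
  (fun n (w : g_sigma_algebraType (FP P t)) => X (t - t / n.+2%:R) w 0 k)).
  move=> n; apply: (measurableT_comp (measurable_coord k)).
  move=> _ C mC; rewrite setTI; apply: sub_sigma_algebra.
  have r0 : 0 <= t - t / n.+2%:R <= T.
    rewrite subr_ge0 ler_pdivrMr // ler_peMr ?ler1n ?(ltW t0) //=.
    by apply: le_trans t1; rewrite gerBl divr_ge0 // ltW.
  apply: (FP_monotone _ (aX _ r0 C mC)).
  by rewrite gerBl divr_ge0 // ltW.
move=> w _; have xl := @left_limit_cvg t w k tT.
have r_cvg : t - t / n.+2%:R @[n --> \oo] --> t^'-.
  move=> B [e /= e0 hB].
  have : \forall n \near \oo, t / n.+1%:R < e by exact: grid_mesh_small.
  apply: filterS => n hn; apply: hB; last by rewrite /= gtrBl divr_gt0.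
  rewrite /= opprB addrC subrK ger0_norm ?divr_ge0 ?(ltW t0) //.
  apply: le_lt_trans hn; rewrite ler_pM2l // lef_pV2 ?posrE //.
  by rewrite ler_nat.
by move=> B nB; exact: (r_cvg _ (xl B nB)).
Qed.

Lemma near_set_section rho t : 0 < t <= T ->
  xsection (near_set rho) t = [set w | exists k, `|left_limit X t w 0 k| <= rho].
Proof.
move=> tT; rewrite xsectionE; apply/seteqP; split => w /=.
  by move=> [_ /(edist_SigmaP _ _ d1)].
by move=> hk; split => //; apply/(edist_SigmaP _ _ d1).
Qed.

(** The left limit at t is a limit of values of X before t. *)
Lemma near_set_FP rho t : 0 < t <= T -> FP P t (xsection (near_set rho) t).
Proof.
move=> tT; rewrite near_set_section //; apply: FP_generated.
rewrite (_ : [set w | _] = \bigcup_k [set w | `|left_limit X t w 0 k| <= rho]); last first.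
  by apply/seteqP; split => w /= [k]; [exists k|move=> _ ?; exists k].
apply: fin_bigcup_measurable => [|k _]; first exact: finite_finset.
exact: (measurable_norm_le rho (left_limit_adapted k tT)).
Qed.

Lemma measurable_near_set rho : measurable (near_set rho).
Proof.
have mD : measurable ([set p : R * Wc | 0 < p.1 <= T]).
  rewrite (_ : [set p | _] = `]0, T]%classic `*` setT); last first.
    by apply/seteqP; split => -[t w] /=; rewrite in_itv /= => // -[].
  by apply: measurableX => //; exact: measurable_itv.
rewrite (_ : near_set rho = \bigcup_k ([set p : R * Wc | 0 < p.1 <= T] `&`
    [set p | `|if 0 < p.1 <= T then left_limit X p.1 p.2 0 k else 0| <= rho])); last first.
  apply/seteqP; split => -[t w] /=.
    by move=> [tT /(edist_SigmaP _ _ d1)[k hk]]; exists k => //=; rewrite tT.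
  move=> [k _ /= [tT]]; rewrite tT => hk; split => //; apply/(edist_SigmaP _ _ d1); by exists k.
apply: fin_bigcup_measurable => [|k _]; first exact: finite_finset.
apply: measurableI; first exact: mD.
have mx t : 0 <= t <= T -> measurable_fun setT (fun w : Wc => X t w 0 k).
  by move=> tT; exact: (measurableT_comp (measurable_coord k) (solution_measurable tT)).
have xl (w : Wc) t : 0 < t <= T -> X s w 0 k @[s --> t^'-] --> left_limit X t w 0 k.
  by move=> tT; exact: (@left_limit_cvg t w k tT).
exact: (measurable_norm_le rho (@measurable_left_value_joint _ Wc R T
  (fun t w => X t w 0 k) (fun t w => left_limit X t w 0 k) T0 mx xl)).
Qed.

Lemma near_estimate rho s t (A : set (omega T d)) : 0 < rho <= 1 -> 0 <= s -> s < t -> t <= T ->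
  FP P s A ->
  (Pc (A `&` xsection (near_set rho) t) <=
   Pc A * (ball_bound (T := T) upsilon c kappa (Num.truncn rho^-1) s t)%:E)%E.
Proof.
move=> /andP[r0 r1] s0 st tT FA.
have tT' : 0 < t <= T by rewrite (le_lt_trans s0 st).
have i1 : 1 <= rho^-1 by rewrite invf_ge1.
rewrite near_set_section //.
apply: (@small_ball_union _ Wc R Pc d A (fun k w => left_limit X t w 0 k) _ rho
  (fun k m => expR (- (decay_rate (T := T) c k kappa * m%:R `^ upsilon / 2 * (t - s))))).
- exact: (FP_measurable (ltW T0) FA).
- move=> k _ C mC; rewrite setTI; apply: (FP_measurable (ltW T0) (t := t)).
  apply: FP_generated; rewrite -[X in measurable X]setTI.
  exact: (left_limit_adapted k tT').
- by rewrite truncn_gt0.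
- by rewrite -ler_pdivlMr // div1r truncn_le // invr_ge0 ltW.
- by move=> k j; exact: expR_ge0.
move=> k m m0.
have l1 : (1 : R) <= m%:R by rewrite ler1n.
have hk := solution_chf k s0 st tT l1 FA.
apply: le_trans hk _; rewrite le_eqVlt; apply/orP; left; apply/eqP.
by congr (_ * expR (- _)); ring.
Qed.

Variable rho : R.
Hypothesis rho01 : 0 < rho <= 1.
Let N : set (R * Wc) := near_set rho.
Let C := occupation_rate T upsilon c kappa.

Let mN : measurable N.
Proof. exact: (measurable_near_set rho). Qed.

Lemma occupationE s w : 0 <= s <= T ->
  (occupation T X s rho w)%:E = occupied T N s w.
Proof.
move=> sT; have /andP[s0 _] := sT.
have BE t : s < t <= T ->
    \1_[set r | (Defs.edist (left_limit X r w) Sigma <= rho%:E)%E] t = \1_(ysection N w) t :> R.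
  move=> /andP[st tT]; rewrite !indicE; congr ((_ : bool)%:R); apply/idP/idP.
    by rewrite !inE ysectionE /= => ?; split => //; rewrite (le_lt_trans s0 st).
  by rewrite !inE ysectionE /= => -[].
have fin : occupied T N s w \is a fin_num.
  by rewrite ge0_fin_numE ?occupied_ge0 //; apply: le_lt_trans (occupied_le mN w sT) (ltry _).
rewrite -[RHS]fineK //; congr ((fine _)%:E).
exact: (occupied_integral mN BE).
Qed.

(** The integral over t of the bound of near_estimate. *)
Lemma occupied_conditional s (A : set (omega T d)) : 0 <= s <= T -> FP P s A ->
  (\int[Pc]_(w in A) occupied T N s w <= Pc A * (C * rho)%:E)%E.
Proof.
move=> sT FA; have /andP[s0 _] := sT.
have [mb b0 bK] := ball_bound_integral (upsilon := upsilon) ub c0 T0 kappa0 rho01 sT.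
apply: (@occupied_le_integral _ Wc R Pc T N mN s (C * rho) A
  (ball_bound (T := T) upsilon c kappa (Num.truncn rho^-1) s)).
- exact: (FP_measurable (ltW T0) FA).
- move=> t /andP[st tT].
  exact: (near_estimate rho01 s0 st tT FA).
- exact: b0.
- exact: mb.
- exact: bK.
Qed.

Lemma occupation_ge0 s w : 0 <= s <= T -> 0 <= occupation T X s rho w.
Proof. by move=> sT; rewrite -lee_fin occupationE // occupied_ge0. Qed.

Lemma occupation_integrable s : 0 <= s <= T ->
  Pc.-integrable setT (EFin \o occupation T X s rho).
Proof.
move=> sT.
have e : EFin \o occupation T X s rho = occupied T N s.
  by apply/funext => w; exact: occupationE.
apply: (@bounded_integrable _ Wc R Pc setT _ T).
- exact: measurableT.
- by apply/measurable_EFinP; rewrite e; exact: measurable_occupied mN s.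
- move=> w _; rewrite ger0_norm ?occupation_ge0 // -lee_fin occupationE //.
  exact: occupied_le.
Qed.

Lemma conditional_occupation_exists s : 0 <= s <= T ->
  exists Y, cond_expectation P (FP P s) (occupation T X s rho) Y.
Proof.
move=> sT.
have FPm : FP P s `<=` (@measurable _ Wc) by move=> A; exact: (FP_measurable (ltW T0)).
have Z0 (w : Wc) : 0 <= occupation T X s rho w by exact: occupation_ge0.
have [Y [iY mY YE]] := @conditional_version _ Wc R Pc (FP P s) (@FP_sigma_algebra R T d P s)
  FPm _ Z0 (occupation_integrable sT).
by exists Y; split => //; exact: occupation_integrable.
Qed.

(** Test with the event {C rho < Y}, which belongs to the past of s. *)
Lemma conditional_occupation_le s Y : 0 <= s <= T ->
  cond_expectation P (FP P s) (occupation T X s rho) Y ->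
  {ae P, forall w, Y w <= C * rho}.
Proof.
move=> sT [iZ iY mY YE].
have FD : FP P s [set w | C * rho < Y w].
  rewrite (_ : [set w | _] = Y @^-1` `]C * rho, +oo[%classic).
    by apply: mY; exact: measurable_itv.
  by apply/seteqP; split => w /=; rewrite in_itv /= andbT.
have D0 : Pc [set w | C * rho < Y w] = 0%E.
  apply: (@above_level_null _ Wc R Pc Y (C * rho) iY).
  rewrite (YE _ FD) muleC; apply: le_trans (occupied_conditional sT FD).
  rewrite le_eqVlt; apply/orP; left; apply/eqP; apply: eq_integral => w _.
  exact: occupationE.
have := completion0_negligible D0; apply: negligibleS => w /= /negP.
by rewrite -ltNge.
Qed.

Lemma occupation_second_moment :
  (\int[Pc]_w ((occupation T X 0 rho w) ^+ 2)%:E <= (2 * (C * rho) ^+ 2)%:E)%E.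
Proof.
have T00 : (0 : R) <= 0 <= T by rewrite lexx ltW.
have C0 : 0 <= C * rho.
  have /andP[r0 _] := rho01.
  by rewrite mulr_ge0 ?(ltW r0) // (occupation_rate_ge0 ub c0 T0 kappa0).
under eq_integral do rewrite expr2 EFinM occupationE //.
apply: (@occupied_sqr_integral _ Wc R Pc T N mN) => //.
- by move=> p [].
- move=> t t0; have /andP[tp tT] := t0.
  by apply: occupied_conditional; [rewrite ltW|exact: (near_set_FP rho t0)].
- have FT : FP P 0 setT.
    have [s0 sC _] := @FP_sigma_algebra R T d P 0.
    by rewrite -(setD0 setT); exact: sC.
  apply: le_trans (occupied_conditional T00 FT) _.
  by rewrite [X in (X * _)%E](probability_setT Pc) mul1e.
Qed.

End Solution.

Theorem proposition8p3
    (R : realType) (T : R) (d : nat)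
    (upsilon : R) (c : 'I_d -> R)
    (Pi : {sigma_finite_measure set 'rV[R]_d -> \bar R})
    (a_lo a_hi : 'M[R]_d)
    (PP : set (probability (omega T d) R))
    (q : R) (law_xi : probability 'rV[R]_d R)
    (kappa : R) (H : probability 'rV[R]_d R -> 'rV[R]_d) (LH : R)
    (h : R -> 'rV[R]_d)
    (X : R -> probability (omega T d) R -> R -> omega T d -> 'rV[R]_d)
    (T_gt0 : 0 < T)
    (d_ge1 : (1 <= d)%N)
    (upsilon_bounds : 1 < upsilon < 2)
    (c_gt0 : forall j, 0 < c j)
    (Pi_stable : truncated_stable upsilon c Pi)
    (a_lo_posdef : posdef a_lo)
    (a_hi_posdef : posdef a_hi)
    (PP_nonempty : PP !=set0)
    (PP_affine : forall P, PP P -> affine_law Pi a_lo a_hi P)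
    (q_gt4 : 4 < q)
    (xi_law : forall P, PP P -> forall A : set 'rV[R]_d, measurable A ->
       P (coord_xi (d:=d) @^-1` A) = law_xi A)
    (xi_moment : (\int[law_xi]_x (enorm x `^ q)%:E < +oo)%E)
    (kappa_ge0 : 0 <= kappa)
    (H_lipschitz : forall mu nu, P2 mu -> P2 nu ->
       enorm (H mu - H nu) <= LH * W2 mu nu)
    (h_measurable : measurable_fun `[0, T] h)
    (h_Lq : (\int[lebesgue_measure]_(t in `[0%R, T])
               (enorm (h t) `^ q)%:E < +oo)%E)
    (X_solution : forall eps P, 0 <= eps <= 1 -> PP P ->
       solution Pi kappa H h eps P (X eps P)) :
  (exists C : R, forall eps P s rho,
     0 <= eps <= 1 -> PP P -> 0 <= s <= T -> 0 < rho <= 1 ->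
     (exists Y, cond_expectation P (FP P s) (occupation T (X eps P) s rho) Y) /\
     (forall Y, cond_expectation P (FP P s) (occupation T (X eps P) s rho) Y ->
        {ae P, forall w, Y w <= C * rho})) /\
  (exists C' : R, forall rho eps, 0 < rho <= 1 -> 0 <= eps <= 1 ->
     (ereal_sup [set \int[completion P]_w
                   ((occupation T (X eps P) 0 rho w) ^+ 2)%:E | P in PP]
      <= (C' * rho ^+ 2)%:E)%E).
Proof.
have q1 : 1 <= q by apply: le_trans (ltW q_gt4); rewrite ler1n.
split.
  exists (occupation_rate T upsilon c kappa) => eps P s rho eps01 PPP sT rho01.
  have solX := X_solution eps P eps01 PPP.
  have [ind PRM _ _ _] := PP_affine P PPP.
  split; first exact: (conditional_occupation_exists T_gt0 d_ge1 solX rho sT).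
  move=> Y; exact: (conditional_occupation_le upsilon_bounds c_gt0 Pi_stable T_gt0 d_ge1 PRM ind
    kappa_ge0 q1 H_lipschitz h_measurable h_Lq solX rho01 sT).
exists (2 * occupation_rate T upsilon c kappa ^+ 2) => rho eps rho01 eps01.
apply: ge_ereal_sup => _ [P PPP <-].
have solX := X_solution eps P eps01 PPP.
have [ind PRM _ _ _] := PP_affine P PPP.
rewrite -mulrA -exprMn.
exact: (occupation_second_moment upsilon_bounds c_gt0 Pi_stable T_gt0 d_ge1 PRM ind
  kappa_ge0 q1 H_lipschitz h_measurable h_Lq solX rho01).
Qed.
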